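(* Let $r\ge 0$. Then $U_\zeta(G_r)$ is a normal subalgebra of $U_\zeta$; that is, $U_\zeta(G_r)$ is closed under both the left adjoint action and the right adjoint action of $U_\zeta$ on itself.
   Context: Quantum groups. Let $\Phi$ be a finite indecomposable root system with simple roots $\Pi$, positive roots $\Phi^+$, Weyl group $W$, and $W$-invariant inner product $(\cdot,\cdot)$ normalized so that $(\alpha,\alpha)=2$ for short roots $\alpha$. Put $\alpha^\vee=2\alpha/(\alpha,\alpha)$. Let $q$ be an indeterminate, $\mathsf{A}=\mathbb{Z}[q,q^{-1}]$, $q_\alpha=q^{(\alpha,\alpha)/2}$, $[n]_\alpha=\frac{q_\alpha^n-q_\alpha^{-n}}{q_\alpha-q_\alpha^{-1}}$, $[n]_\alpha^!=[n]_\alpha\cdots[1]_\alpha$. Let $\mathbb{U}_q$ be the quantized enveloping algebra over $\mathbb{Q}(q)$ with generators $E_\alpha,F_\alpha,K_\alpha^{\pm1}$ ($\alpha\in\Pi$) and relations: $K_\alpha K_\alpha^{-1}=1$, $K_\alpha K_\beta=K_\beta K_\alpha$, $K_\alpha E_\beta K_\alpha^{-1}=q^{(\alpha,\beta)}E_\beta$, $K_\alpha F_\beta K_\alpha^{-1}=q^{-(\alpha,\beta)}F_\beta$, $E_\alpha F_\beta-F_\beta E_\alpha=\delta_{\alpha\beta}\frac{K_\alpha-K_\alpha^{-1}}{q_\alpha-q_\alpha^{-1}}$, and the quantum Serre relations. It is a Hopf algebra with $\Delta(E_\alpha)=E_\alpha\otimes1+K_\alpha\otimes E_\alpha$, $\Delta(F_\alpha)=F_\alpha\otimes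 K_\alpha^{-1}+1\otimes F_\alpha$, $\Delta(K_\alpha)=K_\alpha\otimes K_\alpha$, $\varepsilon(E_\alpha)=\varepsilon(F_\alpha)=0$, $\varepsilon(K_\alpha)=1$, and antipode $S(E_\alpha)=-K_\alpha^{-1}E_\alpha$, $S(F_\alpha)=-F_\alpha K_\alpha$, $S(K_\alpha)=K_\alpha^{-1}$. Let $U_{\mathsf{A}}$ be the $\mathsf{A}$-subalgebra generated by all $K_\alpha^{\pm1}$ and divided powers $E_\alpha^{(n)}=E_\alpha^n/[n]_\alpha^!$, $F_\alpha^{(n)}=F_\alpha^n/[n]_\alpha^!$ ($n\ge0$). Let $k$ be a field of characteristic $p\neq2$, with $p\ne3$ if $\Phi$ has type $G_2$ ($p=0$ allowed). Let $\ell$ be an odd positive integer, coprime to $p$ (if $p>0$), and coprime to $3$ if $\Phi$ has type $G_2$. Let $\zeta\in k$ be a primitive $\ell$-th root of unity, and regard $k$ as an $\mathsf{A}$-module via $q\mapsto\zeta$. $U_\zeta$ is the quotient of $U_{\mathsf{A}}\otimes_{\mathsf{A}}k$ by the two-sided ideal generated by all $K_\alpha^\ell-1$; it is a Hopf algebra. For $r\ge0$ (where $p>0$ is required if $r\geq1$), the Frobenius--Lusztig kernel $U_\zeta(G_r)$ is the subalgebra of $U_\zeta$ generated by $\{E_\alpha,E_\alpha^{(p^i\ell)},F_\alpha,F_\alpha^{(p^i\ell)},K_\alpha:\alpha\in\Pi,\ 0\le i\le r-1\}$. Thus $U_\zeta(G_0)=u_\zeta$ is the small quantum group, generated by the $E_\alpha,F_\alpha,K_\alpha$.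 For a Hopf algebra $H$, the left and right adjoint actions on itself are $\mathrm{Ad}_\ell(h)(a)=\sum h_{(1)}aS(h_{(2)})$ and $\mathrm{Ad}_r(h)(a)=\sum S(h_{(1)})ah_{(2)}$. *)

(* Defs.v *)
From HB Require Import structures.
From mathcomp Require Import all_boot all_order all_algebra.
From mathcomp Require Import generic_quotient ring_quotient finmap.
From mathcomp Require Import boolp.
From mathcomp Require Import monalg.

Set Implicit Arguments.
Unset Strict Implicit.
Unset Printing Implicit Defensive.

Import GRing.Theory Num.Theory.
Local Open Scope ring_scope.
Local Open Scope quotient_scope.

(* Unital associative algebras. The library's [algType] demands 1 != 0, which is
   not available for an algebra given by generators and relations. Scaling is a
   field of this mixin, and not inherited from lmodType, because Hierarchy Builder
   admits no join of lmodType and pzRingType; the module structure is recovered by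
   the instance that follows. *)
HB.mixin Record PzRing_isPzAlgebra (R : pzRingType) A of GRing.PzRing A := {
  pzscale : R -> A -> A;
  pzscaleA : forall a b v, pzscale a (pzscale b v) = pzscale (a * b) v;
  pzscale1 : left_id 1 pzscale;
  pzscaleDr : right_distributive pzscale +%R;
  pzscaleDl : forall v, {morph pzscale^~ v : a b / a + b};
  pzscaleAl : forall (c : R) (x y : A), pzscale c (x * y) = pzscale c x * y;
  pzscaleAr : forall (c : R) (x y : A), pzscale c (x * y) = x * pzscale c y
}.

#[short(type="pzAlgType")]
HB.structure Definition PzAlgebra (R : pzRingType) :=
  {A of GRing.PzRing A & PzRing_isPzAlgebra R A}.

HB.instance Definition _ (R : pzRingType) (A : pzAlgType R) :=
  GRing.Zmodule_isLmodule.Build R (PzAlgebra.sort A)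
    (@pzscaleA R A) (@pzscale1 R A) (@pzscaleDr R A) (@pzscaleDl R A).

Coercion PzAlgebra_sort__canonical__GRing_Lmodule :
  PzAlgebra.type >-> GRing.Lmodule.type.

Section PzAlgebraTheory.
Variables (R : pzRingType) (A : pzAlgType R).

Lemma pzscalerAl (c : R) (x y : A) : c *: (x * y) = (c *: x) * y.
Proof. exact: pzscaleAl. Qed.

Lemma pzscalerAr (c : R) (x y : A) : c *: (x * y) = x * (c *: y).
Proof. exact: pzscaleAr. Qed.

(* The subset generated by S under the ring operations and scaling by C. For C
   a subring of R this is the C-subalgebra generated by S. *)
Inductive gen_subalg (C : R -> Prop) (S : A -> Prop) : A -> Prop :=
| gen_subalg_in x : S x -> gen_subalg C S x
| gen_subalg1 : gen_subalg C S 1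
| gen_subalgB x y :
    gen_subalg C S x -> gen_subalg C S y -> gen_subalg C S (x - y)
| gen_subalgM x y :
    gen_subalg C S x -> gen_subalg C S y -> gen_subalg C S (x * y)
| gen_subalgZ c x : C c -> gen_subalg C S x -> gen_subalg C S (c *: x).

Fact gen_subalg_subring (C : R -> Prop) (S : A -> Prop) :
  subring_closed (fun x : A => `[< gen_subalg C S x >]).
Proof.
split=> [|x y /asboolP Hx /asboolP Hy|x y /asboolP Hx /asboolP Hy];
  apply/asboolP; [exact: gen_subalg1|exact: gen_subalgB|exact: gen_subalgM].
Qed.

End PzAlgebraTheory.


Section Span.
Variables (R : pzRingType) (V : lmodType R) (S : V -> Prop).

Inductive lin_span : V -> Prop :=
| span0 : lin_span 0
| spanDZ (c : R) (v w : V) : S v -> lin_span w -> lin_span (c *: v + w).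

Definition spanP : {pred V} := fun v => `[< lin_span v >].

Lemma lin_spanD v w : lin_span v -> lin_span w -> lin_span (v + w).
Proof.
elim=> [|c x y Sx _ IH] Hw; first by rewrite add0r.
by rewrite -addrA; apply: spanDZ => //; exact: IH.
Qed.

Lemma lin_spanZ c v : lin_span v -> lin_span (c *: v).
Proof.
elim=> [|d x y Sx _ IH]; first by rewrite scaler0; exact: span0.
by rewrite scalerDr scalerA; exact: spanDZ.
Qed.

Lemma lin_span_gen v : S v -> lin_span v.
Proof.
by move=> Sv; rewrite -[v]addr0 -[v]scale1r; apply: spanDZ => //; exact: span0.
Qed.

Fact spanP_zmod_closed : zmod_closed spanP.
Proof.
split=> [|x y /asboolP Hx /asboolP Hy]; apply/asboolP; first exact: span0.
by apply: lin_spanD => //; rewrite -scaleN1r; exact: lin_spanZ.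
Qed.

HB.instance Definition _ := GRing.isZmodClosed.Build V spanP spanP_zmod_closed.

Definition lquot := Quotient.quot spanP.

HB.instance Definition _ := Choice.on lquot.
HB.instance Definition _ := GRing.Zmodule.on lquot.

Definition lpi (v : V) : lquot := \pi_(Quotient.quot spanP) v.
Definition lrepr (v : lquot) : V := repr v.

Lemma lreprK v : lpi (lrepr v) = v.
Proof. exact: reprK. Qed.

Lemma lpi_eqP v w : lpi v = lpi w <-> lin_span (v - w).
Proof.
have E := Quotient.idealrBE spanP v w.
split=> [/eqP H|H]; first by apply/asboolP; rewrite -/(spanP _); move: E; rewrite H.
by apply/eqP; move: E; rewrite /lpi => <-; apply/asboolP.
Qed.

Lemma lpiD v w : lpi (v + w) = lpi v + lpi w.
Proof. by rewrite /lpi raddfD. Qed.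

Lemma lpiB v w : lpi (v - w) = lpi v - lpi w.
Proof. by rewrite /lpi raddfB. Qed.

Definition lquot_scale (c : R) (v : lquot) : lquot := lpi (c *: lrepr v).

Lemma lpi_scale c v : lquot_scale c (lpi v) = lpi (c *: v).
Proof.
apply/lpi_eqP; rewrite -scalerBr; apply/lin_spanZ/lpi_eqP; exact: lreprK.
Qed.

Fact lquot_scaleA a b v :
  lquot_scale a (lquot_scale b v) = lquot_scale (a * b) v.
Proof. by rewrite -[v]lreprK !lpi_scale scalerA. Qed.

Fact lquot_scale1 : left_id 1 lquot_scale.
Proof. by move=> v; rewrite -[v]lreprK lpi_scale scale1r. Qed.

Fact lquot_scaleDr : right_distributive lquot_scale +%R.
Proof.
move=> a v w; rewrite -[v]lreprK -[w]lreprK -lpiD !lpi_scale -lpiD.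
by rewrite scalerDr.
Qed.

Fact lquot_scaleDl v : {morph lquot_scale^~ v : a b / a + b}.
Proof.
by move=> a b; rewrite -[v]lreprK !lpi_scale -lpiD scalerDl.
Qed.

HB.instance Definition _ := GRing.Zmodule_isLmodule.Build R lquot
  lquot_scaleA lquot_scale1 lquot_scaleDr lquot_scaleDl.

Lemma lpiZ c v : lpi (c *: v) = c *: lpi v.
Proof. by rewrite -lpi_scale. Qed.

End Span.

Section QuotientAlgebra.
Variables (R : pzRingType) (A : pzAlgType R) (S : A -> Prop).

Definition ideal_gen (x : A) : Prop := exists a b s, S s /\ x = a * s * b.

(* The quotient of A by the two-sided ideal generated by S. *)
Definition aquot := lquot ideal_gen.

HB.instance Definition _ := GRing.Lmodule.on aquot.

Definition api (x : A) : aquot := lpi ideal_gen x.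

Lemma ideal_spanMl a x : lin_span ideal_gen x -> lin_span ideal_gen (a * x).
Proof.
elim=> [|c y z [b [d [s [Ss ->]]]] _ IH]; first by rewrite mulr0; exact: span0.
rewrite mulrDr -pzscalerAr; apply: spanDZ => //.
by exists (a * b), d, s; rewrite !mulrA.
Qed.

Lemma ideal_spanMr a x : lin_span ideal_gen x -> lin_span ideal_gen (x * a).
Proof.
elim=> [|c y z [b [d [s [Ss ->]]]] _ IH]; first by rewrite mul0r; exact: span0.
rewrite mulrDl -pzscalerAl; apply: spanDZ => //.
by exists b, (d * a), s; rewrite !mulrA.
Qed.

Definition aquot_mul (x y : aquot) : aquot := api (lrepr x * lrepr y).

Lemma api_mul x y : aquot_mul (api x) (api y) = api (x * y).
Proof.
have Hr z : lin_span ideal_gen (lrepr (api z) - z).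
  by apply/lpi_eqP; rewrite lreprK.
apply/lpi_eqP.
rewrite -[X in X - _](subrK (lrepr (api x) * y)) -mulrBr -addrA -mulrBl.
by apply: lin_spanD; [exact: ideal_spanMl | exact: ideal_spanMr].
Qed.

Lemma apiK (x : aquot) : exists y, x = api y.
Proof. by exists (lrepr x); rewrite /api lreprK. Qed.

Fact aquot_mulA : associative aquot_mul.
Proof.
move=> x y z; have [[[x' ->] [y' ->]] [z' ->]] := (apiK x, apiK y, apiK z).
by rewrite !api_mul mulrA.
Qed.

Fact aquot_mul1r : left_id (api 1) aquot_mul.
Proof. by move=> x; have [y ->] := apiK x; rewrite api_mul mul1r. Qed.

Fact aquot_mulr1 : right_id (api 1) aquot_mul.
Proof. by move=> x; have [y ->] := apiK x; rewrite api_mul mulr1. Qed.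

Fact aquot_mulDl : left_distributive aquot_mul +%R.
Proof.
move=> x y z; have [[[x' ->] [y' ->]] [z' ->]] := (apiK x, apiK y, apiK z).
by rewrite !api_mul /api -!lpiD -/(api _) api_mul mulrDl.
Qed.

Fact aquot_mulDr : right_distributive aquot_mul +%R.
Proof.
move=> x y z; have [[[x' ->] [y' ->]] [z' ->]] := (apiK x, apiK y, apiK z).
by rewrite !api_mul /api -!lpiD -/(api _) api_mul mulrDr.
Qed.

HB.instance Definition _ := GRing.Zmodule_isPzRing.Build aquot
  aquot_mulA aquot_mul1r aquot_mulr1 aquot_mulDl aquot_mulDr.

Lemma apiM x y : api (x * y) = api x * api y.
Proof. by rewrite -api_mul. Qed.

Lemma apiZ c x : api (c *: x) = c *: api x.
Proof. exact: lpiZ. Qed.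

Fact aquot_scaleAl (c : R) (x y : aquot) : c *: (x * y) = (c *: x) * y.
Proof.
have [[x' ->] [y' ->]] := (apiK x, apiK y).
by rewrite -apiM -!apiZ -apiM pzscalerAl.
Qed.

Fact aquot_scaleAr (c : R) (x y : aquot) : c *: (x * y) = x * (c *: y).
Proof.
have [[x' ->] [y' ->]] := (apiK x, apiK y).
by rewrite -apiM -!apiZ -apiM pzscalerAr.
Qed.

HB.instance Definition _ := PzRing_isPzAlgebra.Build R aquot
  (@scalerA R aquot) (@scale1r R aquot) (@scalerDr R aquot)
  (fun v a b => scalerDl v a b) aquot_scaleAl aquot_scaleAr.

End QuotientAlgebra.

Section FreeAlgebra.
Variables (k : fieldType) (X : choiceType).

(* The free associative unital k-algebra on X. *)
Definition free_alg := {malg k[{fmonom X}]}.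

HB.instance Definition _ := GRing.NzRing.on free_alg.
HB.instance Definition _ := GRing.Lmodule.on free_alg.

Fact free_alg_scaleAl (c : k) (x y : free_alg) : c *: (x * y) = (c *: x) * y.
Proof. exact: fgscaleAl. Qed.

Fact free_alg_scaleAr (c : k) (x y : free_alg) : c *: (x * y) = x * (c *: y).
Proof.
have cent (g : {malg k[{fmonom X}]}) : g * c%:MP = c *: g.
  rewrite malgM_def malgZ_def fgmulgU.
  by apply/eq_bigr=> /= m _; rewrite mulm1 mulrC.
rewrite free_alg_scaleAl -[c *: x]cent -[c *: y]mul_malgC.
by rewrite mulrA.
Qed.

HB.instance Definition _ := PzRing_isPzAlgebra.Build k free_alg
  (@scalerA k free_alg) (@scale1r k free_alg) (@scalerDr k free_alg)
  (fun v a b => scalerDl v a b) free_alg_scaleAl free_alg_scaleAr.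

Definition fgen (x : X) : free_alg := << fmu x >>.

End FreeAlgebra.

Section Tensor.
Variables (k : fieldType) (M N : lmodType k).

Definition free_mod := {malg k[(M * N)%type]}.

Variant tens_rel : free_mod -> Prop :=
| tens_relDl x x' y : tens_rel (<< (x + x', y) >> - (<< (x, y) >> + << (x', y) >>))
| tens_relDr x y y' : tens_rel (<< (x, y + y') >> - (<< (x, y) >> + << (x, y') >>))
| tens_relZl c x y : tens_rel (<< (c *: x, y) >> - c *: << (x, y) >>)
| tens_relZr c x y : tens_rel (<< (x, c *: y) >> - c *: << (x, y) >>).

Definition tens := lquot tens_rel.

HB.instance Definition _ := GRing.Lmodule.on tens.

Definition tpure (x : M) (y : N) : tens := lpi tens_rel << (x, y) >>.

(* For bilinear f, the linear map on M (x) N induced by f, see [tlift_pure] and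
   [tlift_linear]. It is the meaning of Sweedler's notation: the sum of the
   f h_(1) h_(2) is [tlift f (comul h)]. *)
Definition tlift (W : lmodType k) (f : M -> N -> W) (t : tens) : W :=
  \sum_(m <- msupp (lrepr t)) (lrepr t)@_m *: f m.1 m.2.

Definition bilinear_map (W : lmodType k) (f : M -> N -> W) : Prop :=
  (forall c x x' y, f (c *: x + x') y = c *: f x y + f x' y) /\
  (forall c x y y', f x (c *: y + y') = c *: f x y + f x y').

Let ext (W : lmodType k) (f : M -> N -> W) (g : free_mod) : W :=
  \sum_(m <- msupp g) g@_m *: f m.1 m.2.

Let extw (W : lmodType k) (f : M -> N -> W) (d : {fset (M * N)%type}) (g : free_mod) :
  (msupp g `<=` d)%fset -> ext f g = \sum_(m <- d) g@_m *: f m.1 m.2.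
Proof.
move=> le_gd; rewrite /ext (big_fset_incl _ le_gd) // => m _ mN.
by rewrite mcoeff_outdom // scale0r.
Qed.

Let ext_linear (W : lmodType k) (f : M -> N -> W) c g g' :
  ext f (c *: g + g') = c *: ext f g + ext f g'.
Proof.
set d := (msupp g `|` msupp g' `|` msupp (c *: g + g'))%fset.
have le1 : (msupp g `<=` d)%fset by rewrite /d -fsetUA fsubsetUl.
have le2 : (msupp g' `<=` d)%fset.
  by rewrite /d -fsetUA; apply/fsubsetU/orP; right; rewrite fsubsetUl.
have le3 : (msupp (c *: g + g') `<=` d)%fset by rewrite /d fsubsetUr.
rewrite (extw f le1) (extw f le2) (extw f le3) scaler_sumr -big_split /=.
by apply: eq_bigr => m _; rewrite mcoeffD mcoeffZ scalerDl scalerA.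
Qed.

Let extU (W : lmodType k) (f : M -> N -> W) m : ext f << m >> = f m.1 m.2.
Proof. by rewrite (extw f (msuppU_le (x := 1))) big_seq_fset1 mcoeffUU scale1r. Qed.

Let ext0 (W : lmodType k) (f : M -> N -> W) : ext f 0 = 0.
Proof. by rewrite /ext msupp0 big_seq_fset0. Qed.

Let extD (W : lmodType k) (f : M -> N -> W) g g' : ext f (g + g') = ext f g + ext f g'.
Proof. by rewrite -[g]scale1r ext_linear !scale1r. Qed.

Let extZ (W : lmodType k) (f : M -> N -> W) c g : ext f (c *: g) = c *: ext f g.
Proof. by rewrite -[c *: g]addr0 ext_linear ext0 addr0. Qed.

Let extB (W : lmodType k) (f : M -> N -> W) g g' : ext f (g - g') = ext f g - ext f g'.
Proof. by rewrite extD -[- g']scaleN1r extZ scaleN1r. Qed.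

Let ext_rel (W : lmodType k) (f : M -> N -> W) g :
  bilinear_map f -> lin_span tens_rel g -> ext f g = 0.
Proof.
move=> [fl fr]; have fDl x x' y : f (x + x') y = f x y + f x' y.
  by rewrite -[x]scale1r fl !scale1r.
have fDr x y y' : f x (y + y') = f x y + f x y'.
  by rewrite -[y]scale1r fr !scale1r.
have f0l y : f 0 y = 0 by apply: (addrI (f 0 y)); rewrite -fDl !addr0.
have f0r x : f x 0 = 0 by apply: (addrI (f x 0)); rewrite -fDr !addr0.
elim=> [|c v w Sv _ IH]; first exact: ext0.
rewrite ext_linear IH addr0; suff -> : ext f v = 0 by rewrite scaler0.
case: Sv => {v} [x x' y|x y y'|d x y|d x y];
  rewrite extB ?extD ?extZ !extU /=; apply/eqP; rewrite subr_eq0; apply/eqP.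
- exact: fDl.
- exact: fDr.
- by rewrite -[d *: x]addr0 fl f0l addr0.
- by rewrite -[d *: y]addr0 fr f0r addr0.
Qed.

Let tlift_pi (W : lmodType k) (f : M -> N -> W) g :
  bilinear_map f -> tlift f (lpi tens_rel g) = ext f g.
Proof.
move=> bf; apply/eqP; rewrite -subr_eq0 -extB; apply/eqP/ext_rel => //.
by apply/lpi_eqP; rewrite lreprK.
Qed.

Lemma tlift_pure (W : lmodType k) (f : M -> N -> W) x y :
  bilinear_map f -> tlift f (tpure x y) = f x y.
Proof. by move=> bf; rewrite tlift_pi // extU. Qed.

Lemma tlift_linear (W : lmodType k) (f : M -> N -> W) c t t' :
  bilinear_map f -> tlift f (c *: t + t') = c *: tlift f t + tlift f t'.
Proof.
by move=> bf; rewrite -[t]lreprK -[t']lreprK -lpiZ -lpiD !tlift_pi // ext_linear.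
Qed.

Lemma tpure_bilinear : bilinear_map tpure.
Proof.
have rel u v : tens_rel (u - v) -> lpi tens_rel u = lpi tens_rel v.
  by move=> uv; apply/lpi_eqP; exact: lin_span_gen.
split=> [c x x' y|c x y y'].
  rewrite /tpure (rel _ _ (tens_relDl _ _ _)) lpiD (rel _ _ (tens_relZl _ _ _)).
  by rewrite lpiZ.
rewrite /tpure (rel _ _ (tens_relDr _ _ _)) lpiD (rel _ _ (tens_relZr _ _ _)).
by rewrite lpiZ.
Qed.

End Tensor.

Section Hopf.
Variables (k : fieldType) (H : pzAlgType k).

Definition hpure (x y : H) : tens H H := tpure x y.

(* (x (x) y) (x' (x) y') = x x' (x) y y' *)
Definition tmul (t u : tens H H) : tens H H :=
  tlift (fun x y : H => tlift (fun x' y' : H => hpure (x * x') (y * y')) u) t.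

Lemma tmul_pure x y x' y' :
  tmul (hpure x y) (hpure x' y') = hpure (x * x') (y * y').
Proof.
have bilin (a b : H) : bilinear_map (fun c d : H => hpure (a * c) (b * d)).
  split=> [c u v w|c u v w].
    by rewrite mulrDr -pzscalerAr /hpure (tpure_bilinear _ _).1.
  by rewrite mulrDr -pzscalerAr /hpure (tpure_bilinear _ _).2.
have sum_lin (r : k) (f g h : H -> H -> tens H H) (u : tens H H) :
    (forall v w, f v w = r *: g v w + h v w) ->
    tlift f u = r *: tlift g u + tlift h u.
  move=> E; rewrite /tlift scaler_sumr -big_split /=.
  by apply: eq_bigr => m _; rewrite E scalerDr !scalerA mulrC.
rewrite /tmul [hpure x y]/hpure tlift_pure; first by rewrite [hpure x' y']/hpure tlift_pure.
split=> [c u v w|c u v w]; apply: sum_lin => // a b.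
  by rewrite mulrDl -pzscalerAl /hpure (tpure_bilinear _ _).1.
by rewrite mulrDl -pzscalerAl /hpure (tpure_bilinear _ _).2.
Qed.

Record hopfAlgebra := HopfAlgebra {
  comul : {linear H -> tens H H};
  counit : {linear H -> k^o};
  antipode : {linear H -> H};
  comul1 : comul 1 = hpure 1 1;
  comulM : forall g h, comul (g * h) = tmul (comul g) (comul h);
  counit1 : counit 1 = 1;
  counitM : forall g h, counit (g * h) = counit g * counit h;
  coassoc : forall h,
    tlift (fun x y : H => tlift (fun x1 x2 : H => tpure x1 (hpure x2 y)) (comul x))
          (comul h) =
    tlift (fun x y : H => tlift (fun y1 y2 : H => tpure x (hpure y1 y2)) (comul y))
          (comul h);
  counitl : forall h, tlift (fun x y : H => counit x *: y) (comul h) = h;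
  counitr : forall h, tlift (fun x y : H => counit y *: x) (comul h) = h;
  antipodel : forall h,
    tlift (fun x y : H => antipode x * y) (comul h) = counit h *: (1 : H);
  antipoder : forall h,
    tlift (fun x y : H => x * antipode y) (comul h) = counit h *: (1 : H)
}.

Definition Ad_l (D : hopfAlgebra) (h a : H) : H :=
  tlift (fun x y : H => x * a * antipode D y) (comul D h).

Definition Ad_r (D : hopfAlgebra) (h a : H) : H :=
  tlift (fun x y : H => antipode D x * a * y) (comul D h).

Definition normal_subalg (D : hopfAlgebra) (B : H -> Prop) : Prop :=
  (forall h a, B a -> B (Ad_l D h a)) /\ (forall h a, B a -> B (Ad_r D h a)).

End Hopf.

(* A (reduced, crystallographic) root system spanning the Euclidean space
   (V, form), with a choice of simple roots. Since the reflections that preserve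
   the roots are taken with respect to form, form is W-invariant. *)
Record rootSystem (R : archiRealFieldType) (V : vectType R) := RootSystem {
  form : V -> V -> R;
  formDZl : forall c u v w, form (c *: u + v) w = c * form u w + form v w;
  formC : forall u v, form u v = form v u;
  form_gt0 : forall v, v != 0 -> 0 < form v v;
  coroot := fun a : V => (2 / form a a) *: a;
  roots : seq V;
  roots_neq0 : 0 \notin roots;
  roots_span : (<<roots>> = fullv)%VS;
  roots_refl : {in roots &, forall a b, b - form b (coroot a) *: a \in roots};
  roots_int : {in roots &, forall a b, form b (coroot a) \is a Num.int};
  roots_reduced : {in roots, forall a c, c *: a \in roots -> c = 1 \/ c = -1};
  simple : (\dim {:V}).-tuple V;
  simple_roots : {subset simple <= roots};
  simple_basis : basis_of fullv simple;
  simple_sign : {in roots, forall b,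
    (forall i, coord simple i b \is a Num.nat) \/
    (forall i, - coord simple i b \is a Num.nat)}
}.

(* The field Q(q). *)
Definition Qq : fieldType := {fraction {poly rat}}.
Definition q : Qq := tofrac 'X.

(* P / q^n in A = Z[q, q^-1], and its image under q |-> z *)
Definition laurent (P : {poly int}) (n : nat) : Qq :=
  tofrac (map_poly intr P) / q ^+ n.
Definition laurent_at (k : fieldType) (z : k) (P : {poly int}) (n : nat) : k :=
  (map_poly intr P).[z] / z ^+ n.

Definition inA (x : Qq) : Prop := exists P n, x = laurent P n.

Section QuantumGroup.
Variables (R : archiRealFieldType) (V : vectType R) (Phi : rootSystem V).

Local Notation I := 'I_(\dim {:V}).

Definition indecomposable : Prop :=
  (exists a, a \in roots Phi) /\
  forall P : pred V,
    (exists2 a, a \in roots Phi & P a) ->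
    (exists2 b, b \in roots Phi & ~~ P b) ->
    exists a b, [/\ a \in roots Phi, b \in roots Phi, P a, ~~ P b
                  & form Phi a b != 0].

Definition short_root (a : V) : Prop :=
  a \in roots Phi /\ {in roots Phi, forall b, form Phi a a <= form Phi b b}.

Definition normalized : Prop := forall a, short_root a -> form Phi a a = 2.

Definition sroot (i : I) : V := tnth (simple Phi) i.

Definition cartan (i j : I) : R := form Phi (sroot j) (coroot Phi (sroot i)).

Definition type_G2 : Prop :=
  \dim {:V} = 2%N /\ exists i j, cartan i j = -3 /\ cartan j i = -1.

(* For an indecomposable normalized Phi the numbers (alpha, beta) and
   (alpha, alpha) / 2 are integers, so that floor only changes their type. *)
Definition iform (i j : I) : int := Num.floor (form Phi (sroot i) (sroot j)).
Definition qs (i : I) : Qq :=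
  q ^ Num.floor (form Phi (sroot i) (sroot i) / 2).

Definition qint (i : I) (n : nat) : Qq :=
  (qs i ^+ n - qs i ^- n) / (qs i - (qs i)^-1).
Definition qfact (i : I) (n : nat) : Qq := \prod_(1 <= m < n.+1) qint i m.
Definition qbin (i : I) (n s : nat) : Qq :=
  qfact i n / (qfact i s * qfact i (n - s)).

Inductive Ugen := gE of I | gF of I | gK of I | gKinv of I.

HB.instance Definition _ := gen_eqMixin Ugen.
HB.instance Definition _ := gen_choiceMixin Ugen.

Local Notation fE i := (fgen Qq (gE i)).
Local Notation fF i := (fgen Qq (gF i)).
Local Notation fK i := (fgen Qq (gK i)).
Local Notation fKinv i := (fgen Qq (gKinv i)).

(* 1 - (beta, alpha^vee), for the simple roots alpha, beta of index i, j *)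
Definition serre_deg (i j : I) : nat := `|1 - Num.floor (cartan i j)|%N.

Definition serre (X : I -> free_alg Qq Ugen) (i j : I) : free_alg Qq Ugen :=
  \sum_(s < (serre_deg i j).+1)
     ((-1) ^+ s * qbin i (serre_deg i j) s) *:
       (X i ^+ (serre_deg i j - s) * X j * X i ^+ s).

(* An element r of this set stands for the relation r = 0. *)
Variant Uq_rel : free_alg Qq Ugen -> Prop :=
| Uq_KKinv i : Uq_rel (fK i * fKinv i - 1)
| Uq_KinvK i : Uq_rel (fKinv i * fK i - 1)
| Uq_KK i j : Uq_rel (fK i * fK j - fK j * fK i)
| Uq_KE i j : Uq_rel (fK i * fE j * fKinv i - q ^ iform i j *: fE j)
| Uq_KF i j : Uq_rel (fK i * fF j * fKinv i - q ^ (- iform i j) *: fF j)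
| Uq_EF i j : Uq_rel (fE i * fF j - fF j * fE i -
    ((i == j)%:R / (qs i - (qs i)^-1)) *: (fK i - fKinv i))
| Uq_serreE i j : i != j -> Uq_rel (serre (fun i => fE i) i j)
| Uq_serreF i j : i != j -> Uq_rel (serre (fun i => fF i) i j).

Definition Uq := aquot Uq_rel.

HB.instance Definition _ := PzAlgebra.on Uq.
HB.instance Definition _ := GRing.Lmodule.on Uq.

Definition UqE i : Uq := api Uq_rel (fE i).
Definition UqF i : Uq := api Uq_rel (fF i).
Definition UqK i : Uq := api Uq_rel (fK i).
Definition UqKinv i : Uq := api Uq_rel (fKinv i).

Definition is_Uq_hopf (D : hopfAlgebra Uq) : Prop :=
  forall i,
  [/\ comul D (UqE i) = hpure (UqE i) 1 + hpure (UqK i) (UqE i),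
      comul D (UqF i) = hpure (UqF i) (UqKinv i) + hpure 1 (UqF i)
    & comul D (UqK i) = hpure (UqK i) (UqK i)] /\
  [/\ counit D (UqE i) = 0, counit D (UqF i) = 0 & counit D (UqK i) = 1] /\
  [/\ antipode D (UqE i) = - (UqKinv i * UqE i),
      antipode D (UqF i) = - (UqF i * UqK i)
    & antipode D (UqK i) = UqKinv i].

Definition UqEdiv i n : Uq := (qfact i n)^-1 *: UqE i ^+ n.
Definition UqFdiv i n : Uq := (qfact i n)^-1 *: UqF i ^+ n.

Variant UA_gen : Uq -> Prop :=
| UA_genK i : UA_gen (UqK i)
| UA_genKinv i : UA_gen (UqKinv i)
| UA_genE i n : UA_gen (UqEdiv i n)
| UA_genF i n : UA_gen (UqFdiv i n).

Definition inUA : {pred Uq} := fun x => `[< gen_subalg inA UA_gen x >].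

Record UA := MkUA { UAval :> Uq; _ : UAval \in inUA }.

HB.instance Definition _ := [isSub for UAval].
HB.instance Definition _ := [Choice of UA by <:].
HB.instance Definition _ := GRing.SubChoice_isSubPzRing.Build Uq inUA UA
  (gen_subalg_subring inA UA_gen).

Definition UAgen x (gx : UA_gen x) : UA :=
  MkUA (asboolT (gen_subalg_in inA gx)).

Section Specialization.
Variables (k : fieldType) (z : k).

(* U_A (x)_A k is constructed by extension of scalars: it is the k-algebra
   generated by symbols for the x in U_A, the symbol of x standing for x (x) 1,
   subject to the relations that make x |-> x (x) 1 a ring morphism that is
   semilinear over the morphism A -> k, q |-> z. *)
Variant UAk_rel : free_alg k UA -> Prop :=
| UAk_1 : UAk_rel (fgen k 1 - 1)
| UAk_M x y : UAk_rel (fgen k (x * y) - fgen k x * fgen k y)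
| UAk_D x y : UAk_rel (fgen k (x + y) - (fgen k x + fgen k y))
| UAk_Z P n (x y : UA) : UAval y = laurent P n *: UAval x ->
    UAk_rel (fgen k y - laurent_at z P n *: fgen k x).

Definition UAk := aquot UAk_rel.

HB.instance Definition _ := PzAlgebra.on UAk.
HB.instance Definition _ := GRing.Lmodule.on UAk.

Definition UAk_in (x : UA) : UAk := api UAk_rel (fgen k x).

Variables (l : nat).

Variant Uz_rel : UAk -> Prop :=
| Uz_Kl i : Uz_rel (UAk_in (UAgen (UA_genK i)) ^+ l - 1).

Definition Uz := aquot Uz_rel.

HB.instance Definition _ := PzAlgebra.on Uz.
HB.instance Definition _ := GRing.Lmodule.on Uz.

Definition Uz_in (x : UA) : Uz := api Uz_rel (UAk_in x).

(* The Hopf structure D on U_zeta is the one induced by D0 on U_q: the structure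
   maps of D0 restrict to U_A and D is obtained from them by base change. *)
Definition induced_hopf (D0 : hopfAlgebra Uq) (D : hopfAlgebra Uz) : Prop :=
  [/\ forall (x : UA) (s : seq (UA * UA)),
        comul D0 (UAval x) = \sum_(t <- s) hpure (UAval t.1) (UAval t.2) ->
        comul D (Uz_in x) = \sum_(t <- s) hpure (Uz_in t.1) (Uz_in t.2),
      forall (x : UA) P n,
        counit D0 (UAval x) = laurent P n ->
        counit D (Uz_in x) = laurent_at z P n
    & forall x y : UA,
        antipode D0 (UAval x) = UAval y ->
        antipode D (Uz_in x) = Uz_in y].

Definition UzK i : Uz := Uz_in (UAgen (UA_genK i)).
Definition UzEdiv i n : Uz := Uz_in (UAgen (UA_genE i n)).
Definition UzFdiv i n : Uz := Uz_in (UAgen (UA_genF i n)).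

(* E_alpha and F_alpha are the divided powers with exponent 1. *)
Variant UzG_gen (p r : nat) : Uz -> Prop :=
| UzG_E i : UzG_gen p r (UzEdiv i 1)
| UzG_Ediv i m : (m < r)%N -> UzG_gen p r (UzEdiv i (p ^ m * l))
| UzG_F i : UzG_gen p r (UzFdiv i 1)
| UzG_Fdiv i m : (m < r)%N -> UzG_gen p r (UzFdiv i (p ^ m * l))
| UzG_K i : UzG_gen p r (UzK i).

(* U_zeta(G_r) *)
Definition UzG (p r : nat) : Uz -> Prop :=
  gen_subalg (fun _ : k => True) (UzG_gen p r).

End Specialization.
End QuantumGroup.

(* p is the characteristic of k, with p = 0 in characteristic zero. *)
Definition has_characteristic (k : fieldType) (p : nat) : Prop :=
  forall n : nat, (n%:R == 0 :> k) = (p %| n)%N.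

(* Main.v *)
Require Import Defs.
From HB Require Import structures.
From mathcomp Require Import all_boot all_order all_algebra.
From mathcomp Require Import generic_quotient ring_quotient finmap.
From mathcomp Require Import boolp.
From mathcomp Require Import monalg ring lra zify.
Require Import Defs.

Set Implicit Arguments.
Unset Strict Implicit.
Unset Printing Implicit Defensive.

Import GRing.Theory Num.Theory.
Local Open Scope ring_scope.

(** Write N for U_zeta(G_r). Since Ad_l is an algebra action, it suffices to see
    that N is stable under the K_i^+-1 and under all divided powers X^(n), where X
    is some E_i or F_i; and since U_zeta is a module algebra under Ad_l, it
    suffices to evaluate Ad_l(X^(n)) on generators of N ([Ad_l_mul],
    [Ad_stableM]). Both E_i and F_i satisfy Delta X = X (x) g + h (x) X with g and
    h in the torus, so that Ad_l(X) is a skew derivation; in particular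
    nilpotency degrees of Ad_l(X) add up in products ([skew_ad_nilM]).

    Over Q(q), every generator of U_q becomes nilpotent under Ad_l(X) once it is
    multiplied by a suitable torus element: E_j and F_j K_j (j <> i), F_i and
    E_i K_i^-1 are killed by the power C + 1 of Ad_l(X), where C is 0, 2 or minus
    a Cartan integer ([twisted_nilpotent]). For generators of the same sign this
    is the quantum Serre relation. Hence Ad_l(X^(n)) kills the m-th power of such
    an element when n > C m. Dividing by quantum factorials and specializing, it
    kills the generator X_j^(m) of N up to a factor from the torus, which lies in
    N because K_j^l = 1. On K_j itself, Ad_l(X^(n)) acts by a product of n factors
    1 - x w^t with w a primitive l-th root of unity, and this is 0 for n >= l.

    In the remaining cases, n < l or n <= C m, all the divided powers X^(a) with
    a <= n lie in N, and then Ad_l(X^(n)) preserves N for trivial reasons. For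
    n < l, and for n <= C when l = 1, this holds because the quantum factorial of n
    is invertible. For n <= C m with m = p^t l it holds because C < p, so that
    n < p^(t+1) l, and X^(n) is then a unit times a product of generators of N: at
    zeta the Gaussian binomial of n over p^t l is, up to a unit, the leading digit
    of n ([gauss_lead_digit], [N_SB_small]). The bounds on C, and the fact that q_i
    specializes to a root of unity of order l, come from the possible lengths of
    roots and from the characterization of G2 by the occurrence of 3
    ([cartan_data]).

    The right adjoint action reduces to the left one: the antipode S satisfies
    S(Ad_l(h) a) = Ad_r(S h) (S a) ([antipode_Ad_l]) and maps both U_zeta and N
    onto themselves.

    All identities are proved in U_q and transported to U_zeta along the relation
    [reduces]; U_A is stable under comultiplication and antipode because its
    generators are. *)

(** * Tensors and Hopf algebras *)

Lemma linear_f0 (R : pzRingType) (U V : lmodType R) (f : U -> V) : linear f -> f 0 = 0.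
Proof. by move=> lf; have := lf (-1) 0 0; rewrite scaler0 addr0 scaleN1r addNr. Qed.

Lemma linear_fZ (R : pzRingType) (U V : lmodType R) (f : U -> V) c x :
  linear f -> f (c *: x) = c *: f x.
Proof. by move=> lf; have := lf c x 0; rewrite (linear_f0 lf) !addr0. Qed.

Lemma linear_fD (R : pzRingType) (U V : lmodType R) (f : U -> V) x y :
  linear f -> f (x + y) = f x + f y.
Proof. by move=> lf; have := lf 1 x y; rewrite !scale1r. Qed.

Section TensorTheory.
Variables (k : fieldType) (M N : lmodType k).

Lemma tens_sum (t : tens M N) :
  exists s : seq (M * N), t = \sum_(m <- s) tpure m.1 m.2.
Proof.
suff [s Es] : exists s : seq (M * N),
    lpi (@tens_rel k M N) (lrepr t) = \sum_(m <- s) tpure m.1 m.2.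
  by exists s; rewrite -Es lreprK.
rewrite [lrepr t]monalgE; move: (lrepr t) => g.
elim: (enum_fset (msupp g)) => [|m s [s' IH]].
  by exists [::]; rewrite !big_nil /lpi raddf0.
exists ((g@_m *: m.1, m.2) :: s'); rewrite !big_cons lpiD IH; congr (_ + _).
have -> : << g@_m *g m >> = g@_m *: << m >> :> {malg k[(M * N)%type]}.
  by apply/malgP => x; rewrite mcoeffZ !mcoeffU mulr_natr.
rewrite lpiZ -[_ *: m.1]addr0 (tpure_bilinear M N).1 /= -/(tpure _ _).
have -> : tpure 0 m.2 = 0 :> tens M N.
  apply: (addrI (tpure 0 m.2)); rewrite addr0.
  by rewrite -[X in X + _]scale1r -(tpure_bilinear M N).1 scaler0 addr0.
by rewrite addr0; case: m.
Qed.

Lemma tlift_ext (W : lmodType k) (f g : M -> N -> W) t :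
  (forall x y, f x y = g x y) -> tlift f t = tlift g t.
Proof. by move=> fg; apply: eq_bigr => m _; rewrite fg. Qed.

Lemma tlift_comp (W W' : lmodType k) (L : W -> W') (f : M -> N -> W) t :
  linear L -> L (tlift f t) = tlift (fun x y => L (f x y)) t.
Proof.
move=> linL; pose Lm := GRing.isLinear.Build _ _ _ _ L linL.
pose L' : {linear W -> W'} := HB.pack L Lm.
rewrite -[L]/(L' : W -> W') /tlift linear_sum; apply: eq_bigr => m _.
exact: linearZ.
Qed.

Lemma tlift_linf (W : lmodType k) (c : k) (f g : M -> N -> W) t :
  tlift (fun x y => c *: f x y + g x y) t = c *: tlift f t + tlift g t.
Proof.
rewrite /tlift scaler_sumr -big_split /=; apply: eq_bigr => m _.
by rewrite scalerDr !scalerA mulrC.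
Qed.

Lemma tlift_linZ (W : lmodType k) (c : k) (f : M -> N -> W) t :
  tlift (fun x y => c *: f x y) t = c *: tlift f t.
Proof.
by rewrite /tlift scaler_sumr; apply: eq_bigr => m _; rewrite !scalerA mulrC.
Qed.

Section Lift.
Variables (W : lmodType k) (f : M -> N -> W).
Hypothesis bf : bilinear_map f.

Lemma tlift_is_linear : linear (tlift f).
Proof. by move=> c t u; apply: tlift_linear. Qed.

Lemma tlift0 : tlift f 0 = 0.
Proof.
have := tlift_linear (-1) 0 0 bf; rewrite scaler0 addr0 scaleN1r => ->.
by rewrite addNr.
Qed.

Lemma tliftD t u : tlift f (t + u) = tlift f t + tlift f u.
Proof. by rewrite -[t]scale1r tlift_linear // !scale1r. Qed.

Lemma tliftZ c t : tlift f (c *: t) = c *: tlift f t.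
Proof. by rewrite -[c *: t]addr0 tlift_linear // tlift0 addr0. Qed.

Lemma tlift_sum (I : Type) (s : seq I) (F : I -> tens M N) :
  tlift f (\sum_(i <- s) F i) = \sum_(i <- s) tlift f (F i).
Proof.
by elim: s => [|i s IH]; rewrite ?big_nil ?tlift0 // !big_cons tliftD IH.
Qed.

Lemma tlift_sum_pure (I : Type) (s : seq I) (F : I -> M) (G : I -> N) :
  tlift f (\sum_(i <- s) tpure (F i) (G i)) = \sum_(i <- s) f (F i) (G i).
Proof.
by rewrite tlift_sum; apply: eq_bigr => i _; rewrite tlift_pure.
Qed.
End Lift.

End TensorTheory.

Section PzAlg.
Variables (k : fieldType) (H : pzAlgType k).

Lemma pzalgM_scale (c d : k) (x y : H) : (c *: x) * (d *: y) = (c * d) *: (x * y).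
Proof. by rewrite -pzscalerAl -pzscalerAr scalerA. Qed.

Lemma qcommute_expr (x y : H) c n :
  y * x = c *: (x * y) -> y * x ^+ n = c ^+ n *: (x ^+ n * y).
Proof.
move=> yx; elim: n => [|n IH]; first by rewrite !expr0 scale1r mulr1 mul1r.
by rewrite !exprS mulrA yx -pzscalerAl -mulrA IH -pzscalerAr scalerA mulrA.
Qed.

Lemma qcommute_exprl (x y : H) c n :
  y * x = c *: (x * y) -> y ^+ n * x = c ^+ n *: (x * y ^+ n).
Proof.
move=> yx; elim: n => [|n IH]; first by rewrite !expr0 scale1r mulr1 mul1r.
by rewrite !exprSr -mulrA yx -pzscalerAr mulrA IH -pzscalerAl scalerA -mulrA mulrC.
Qed.

Lemma linear_mull (a : H) : linear (fun x : H => a * x).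
Proof. by move=> c x y; rewrite mulrDr pzscalerAr. Qed.

Lemma hpureDl (x x' y : H) : hpure (x + x') y = hpure x y + hpure x' y.
Proof. by rewrite -[x]scale1r /hpure (tpure_bilinear _ _).1 !scale1r. Qed.

Lemma hpureDr (x y y' : H) : hpure x (y + y') = hpure x y + hpure x y'.
Proof. by rewrite -[y]scale1r /hpure (tpure_bilinear _ _).2 !scale1r. Qed.

Lemma hpure0l (y : H) : hpure 0 y = 0.
Proof. by apply: (addrI (hpure 0 y)); rewrite -hpureDl !addr0. Qed.

Lemma hpure0r (y : H) : hpure y 0 = 0.
Proof. by apply: (addrI (hpure y 0)); rewrite -hpureDr !addr0. Qed.

Lemma hpureZl c (x y : H) : hpure (c *: x) y = c *: hpure x y.
Proof.
by rewrite -[c *: x]addr0 /hpure (tpure_bilinear _ _).1 -!/(hpure _ _) hpure0l addr0.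
Qed.

Lemma hpureZr c (x y : H) : hpure x (c *: y) = c *: hpure x y.
Proof.
by rewrite -[c *: y]addr0 /hpure (tpure_bilinear _ _).2 -!/(hpure _ _) hpure0r addr0.
Qed.

Lemma tens_sumH (t : tens H H) :
  exists s : seq (H * H), t = \sum_(m <- s) hpure m.1 m.2.
Proof. exact: tens_sum. Qed.

Lemma tmul_inner_bilinear (x y : H) :
  bilinear_map (fun x' y' : H => hpure (x * x') (y * y')).
Proof.
split=> [c u u' v|c v u u'].
  by rewrite (linear_mull x) hpureDl hpureZl.
by rewrite (linear_mull y) hpureDr hpureZr.
Qed.

Lemma tmul_outer_bilinear (u : tens H H) :
  bilinear_map (fun x y : H => tlift (fun x' y' : H => hpure (x * x') (y * y')) u).
Proof.
split=> [c x x' y|c x y y']; rewrite -tlift_linf; apply: tlift_ext => v w.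
  by rewrite mulrDl -pzscalerAl hpureDl hpureZl.
by rewrite mulrDl -pzscalerAl hpureDr hpureZr.
Qed.

Lemma tmul_linearl u : linear (fun t : tens H H => tmul t u).
Proof. by move=> c t t'; apply/tlift_linear/tmul_outer_bilinear. Qed.

Lemma tmul_linearr t : linear (@tmul k H t).
Proof.
move=> c u u'; rewrite /tmul -tlift_linf; apply: tlift_ext => x y.
by apply/tlift_linear/tmul_inner_bilinear.
Qed.

Lemma tmulDl (t t' u : tens H H) : tmul (t + t') u = tmul t u + tmul t' u.
Proof. by have := tmul_linearl u 1 t t'; rewrite !scale1r. Qed.

Lemma tmulDr (t u u' : tens H H) : tmul t (u + u') = tmul t u + tmul t u'.
Proof. by have := tmul_linearr t 1 u u'; rewrite !scale1r. Qed.

Lemma tmul0l (u : tens H H) : tmul 0 u = 0.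
Proof. by apply: (addrI (tmul 0 u)); rewrite -tmulDl !addr0. Qed.

Lemma tmul0r (u : tens H H) : tmul u 0 = 0.
Proof. by apply: (addrI (tmul u 0)); rewrite -tmulDr !addr0. Qed.

Lemma tmulZr c (t u : tens H H) : tmul t (c *: u) = c *: tmul t u.
Proof. by have := tmul_linearr t c u 0; rewrite tmul0r !addr0. Qed.

Lemma tmul_suml (I : Type) (s : seq I) (F : I -> tens H H) u :
  tmul (\sum_(i <- s) F i) u = \sum_(i <- s) tmul (F i) u.
Proof.
by elim: s => [|i s IH]; rewrite ?big_nil ?tmul0l // !big_cons tmulDl IH.
Qed.

Lemma tmul_sumr (I : Type) (s : seq I) (F : I -> tens H H) u :
  tmul u (\sum_(i <- s) F i) = \sum_(i <- s) tmul u (F i).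
Proof.
by elim: s => [|i s IH]; rewrite ?big_nil ?tmul0r // !big_cons tmulDr IH.
Qed.

Lemma tmulA (t u v : tens H H) : tmul t (tmul u v) = tmul (tmul t u) v.
Proof.
have [st ->] := tens_sumH t; rewrite !tmul_suml; apply: eq_bigr => a _.
have [su ->] := tens_sumH u; rewrite tmul_suml !tmul_sumr tmul_suml.
apply: eq_bigr => b _; have [sv ->] := tens_sumH v; rewrite !tmul_sumr.
by apply: eq_bigr => c _; rewrite !tmul_pure !mulrA.
Qed.

Lemma tmul1l (t : tens H H) : tmul (hpure 1 1) t = t.
Proof.
have [s ->] := tens_sumH t; rewrite tmul_sumr; apply: eq_bigr => a _.
by rewrite tmul_pure !mul1r.
Qed.

End PzAlg.

Section HopfTheory.
Variables (k : fieldType) (H : pzAlgType k) (D : hopfAlgebra H).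

Let S : H -> H := antipode D.
Let eps : H -> k := counit D.

Definition trilinear (W : lmodType k) (f : H -> H -> H -> W) : Prop :=
  [/\ forall y z, linear (fun x => f x y z), forall x z, linear (fun y => f x y z)
    & forall x y, linear (f x y)].

(** Coassociativity, an identity of tensors, composed with the linear map that the
    trilinear map f induces on them. *)
Lemma coassoc_lift (W : lmodType k) (f : H -> H -> H -> W) h : trilinear f ->
  tlift (fun x y => tlift (fun x1 x2 => f x1 x2 y) (comul D x)) (comul D h) =
  tlift (fun x y => tlift (fun y1 y2 => f x y1 y2) (comul D y)) (comul D h).
Proof.
move=> [f1 f2 f3].
have bfx x : bilinear_map (f x) by split=> [c u v y|c y u v]; [apply: f2|apply: f3].
pose F (x : H) (t : tens H H) := tlift (f x) t.
have bF : bilinear_map F.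
  split=> [c u v t|c x t u]; last exact/tlift_linear/bfx.
  by rewrite /F -tlift_linf; apply: tlift_ext => y z; apply: f1.
have linF := tlift_is_linear bF.
pose L x y : tens H (tens H H) :=
  tlift (fun x1 x2 : H => tpure x1 (hpure x2 y)) (comul D x).
pose R x y : tens H (tens H H) :=
  tlift (fun y1 y2 : H => tpure x (hpure y1 y2)) (comul D y).
have FL x y : tlift F (L x y) = tlift (fun x1 x2 => f x1 x2 y) (comul D x).
  rewrite /L (tlift_comp _ _ linF); apply: tlift_ext => u v.
  by rewrite tlift_pure // /F /hpure tlift_pure.
have FR x y : tlift F (R x y) = tlift (f x) (comul D y).
  rewrite /R (tlift_comp _ _ linF); apply: tlift_ext => u v.
  by rewrite tlift_pure // /F /hpure tlift_pure.
transitivity (tlift F (tlift L (comul D h))).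
  by rewrite (tlift_comp _ _ linF); apply: tlift_ext => x y; rewrite FL.
rewrite [tlift L _](coassoc D h) -/R (tlift_comp _ _ linF).
by apply: tlift_ext => x y; rewrite FR.
Qed.

Lemma antipode_linear : linear (antipode D). Proof. by move=> c x y; rewrite linearP. Qed.

Lemma bilinear_mapI (W : lmodType k) (f : H -> H -> W) :
  (forall y, linear (fun x : H => f x y)) -> (forall x, linear (f x)) -> bilinear_map f.
Proof. by move=> h1 h2; split=> [c x x' y|c x y y']; [apply: h1|apply: h2]. Qed.

Ltac lin := let c := fresh "c" in let x := fresh "x" in let y := fresh "y" in
  move=> c x y; rewrite /S ?(antipode_linear, mulrDr, mulrDl);
  rewrite -?(pzscalerAr, pzscalerAl) ?(antipode_linear, mulrDr, mulrDl);
  rewrite -?(pzscalerAr, pzscalerAl) //.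

Lemma antipode1 : S 1 = 1.
Proof.
have := antipodel D 1; rewrite comul1 /hpure tlift_pure.
  by rewrite counit1 scale1r mulr1.
by apply: bilinear_mapI => ?; lin.
Qed.

Lemma antipodel_in (a b h : H) :
  tlift (fun x y : H => a * (S x * y) * b) (comul D h) = eps h *: (a * b).
Proof.
have L : linear (fun x : H => a * x * b) by lin.
by rewrite -(tlift_comp _ _ L) antipodel -pzscalerAr mulr1 -pzscalerAl.
Qed.

Lemma antipoder_in (a b h : H) :
  tlift (fun x y : H => a * (x * S y) * b) (comul D h) = eps h *: (a * b).
Proof.
have L : linear (fun x : H => a * x * b) by lin.
by rewrite -(tlift_comp _ _ L) antipoder -pzscalerAr mulr1 -pzscalerAl.
Qed.

Lemma counitl_in (W : lmodType k) (L : H -> W) h : linear L ->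
  tlift (fun x y : H => eps x *: L y) (comul D h) = L h.
Proof.
move=> lL; rewrite -[in RHS](counitl D h) (tlift_comp _ _ lL); apply: tlift_ext => x y.
by rewrite linear_fZ.
Qed.

Lemma counitr_in (W : lmodType k) (L : H -> W) h : linear L ->
  tlift (fun x y : H => eps y *: L x) (comul D h) = L h.
Proof.
move=> lL; rewrite -[in RHS](counitr D h) (tlift_comp _ _ lL); apply: tlift_ext => x y.
by rewrite linear_fZ.
Qed.

Lemma tlift_swap (W : lmodType k) (f : H -> H -> H -> H -> W) (t u : tens H H) :
  tlift (fun x y : H => tlift (f x y) t) u =
  tlift (fun a b : H => tlift (fun x y : H => f x y a b) u) t.
Proof.
rewrite /tlift; under eq_bigr do rewrite scaler_sumr.
rewrite exchange_big /=; apply: eq_bigr => m _; rewrite scaler_sumr.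
by apply: eq_bigr => n _; rewrite !scalerA mulrC.
Qed.

Lemma tlift_tmul (W : lmodType k) (f : H -> H -> W) (t u : tens H H) :
  bilinear_map f ->
  tlift f (tmul t u) =
  tlift (fun x y : H => tlift (fun x' y' : H => f (x * x') (y * y')) u) t.
Proof.
move=> bf; have lf := tlift_is_linear bf.
rewrite /tmul (tlift_comp _ _ lf); apply: tlift_ext => x y.
rewrite (tlift_comp _ _ lf); apply: tlift_ext => x' y'.
exact: tlift_pure.
Qed.

(** Both sides are convolution inverses of the multiplication. The first two steps
    insert g_(2) S(g_(3)) and h_(2) S(h_(3)), after which S(g_(1) h_(1)) cancels
    against g_(2) h_(2). *)
Lemma antipodeM g h : S (g * h) = S h * S g.
Proof.
pose T := fun (x : H) (f : H -> H -> H) => tlift f (comul D x).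
have step1 : S (g * h) =
    T g (fun g1 g2 : H => T g1 (fun x y : H => S (x * h) * (y * S g2))).
  rewrite -[LHS](@counitr_in _ (fun x : H => S (x * h))); last by lin.
  rewrite /T (@coassoc_lift _ (fun x y z : H => S (x * h) * (y * S z))); last first.
    by split=> ? ?; lin.
  apply: tlift_ext => x y; rewrite -[S _ in LHS]mulr1 -antipoder_in.
  by apply: tlift_ext => u v; rewrite mulr1.
have step2 x y z : S (x * h) * (y * S z) =
    T h (fun h1 h2 : H => T h1 (fun u v : H => S (x * u) * (y * v) * (S h2 * S z))).
  rewrite -[LHS](@counitr_in _ (fun u : H => S (x * u) * (y * S z))); last by lin.
  rewrite /T (@coassoc_lift _ (fun u v w : H => S (x * u) * (y * v) * (S w * S z))); last first.
    by split=> ? ?; lin.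
  apply: tlift_ext => u v; rewrite mulrA -antipoder_in.
  by apply: tlift_ext => a b; rewrite !mulrA.
rewrite step1 -(@counitl_in _ (fun z : H => S h * S z)) ; last by lin.
apply: tlift_ext => g1 g2.
transitivity (T h (fun h1 h2 : H =>
   T g1 (fun x y : H => T h1 (fun u v : H => S (x * u) * (y * v) * (S h2 * S g2))))).
  rewrite /T [RHS]tlift_swap; apply: tlift_ext => x y; exact: step2.
rewrite -(@counitl_in _ (fun z : H => S z * S g2)); last by lin.
rewrite -tlift_linZ; apply: tlift_ext => h1 h2.
have bf : bilinear_map (fun a b : H => S a * b * (S h2 * S g2)).
  by apply: bilinear_mapI => ?; lin.
rewrite /T -(@tlift_tmul _ (fun a b : H => S a * b * (S h2 * S g2)) _ _ bf) -comulM.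
rewrite scalerA -counitM -[RHS]/(eps (g1 * h1) *: _) -[S h2 * S g2 in RHS]mul1r -antipodel_in.
by apply: tlift_ext => a b; rewrite mul1r.
Qed.

Lemma Ad_lM g h a : Ad_l D (g * h) a = Ad_l D g (Ad_l D h a).
Proof.
rewrite /Ad_l comulM tlift_tmul; last by apply: bilinear_mapI => ?; lin.
apply: tlift_ext => x y.
have L : linear (fun z : H => x * z * S y) by lin.
rewrite -/S [RHS](tlift_comp _ _ L); apply: tlift_ext => x' y'.
by rewrite antipodeM !mulrA.
Qed.

Lemma Ad_rM g h a : Ad_r D (g * h) a = Ad_r D h (Ad_r D g a).
Proof.
rewrite /Ad_r comulM tlift_tmul; last by apply: bilinear_mapI => ?; lin.
rewrite tlift_swap; apply: tlift_ext => x y.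
have L : linear (fun z : H => S x * z * y) by lin.
rewrite -/S [RHS](tlift_comp _ _ L); apply: tlift_ext => x' y'.
by rewrite antipodeM !mulrA.
Qed.

Lemma Ad_l_bilinear a : bilinear_map (fun x y : H => x * a * S y).
Proof. by apply: bilinear_mapI => ?; lin. Qed.

Lemma Ad_r_bilinear a : bilinear_map (fun x y : H => S x * a * y).
Proof. by apply: bilinear_mapI => ?; lin. Qed.

Lemma Ad_l_linearl a : linear (fun h : H => Ad_l D h a).
Proof. by move=> c g h; rewrite /Ad_l linearP tlift_linear //; exact: Ad_l_bilinear. Qed.

Lemma Ad_r_linearl a : linear (fun h : H => Ad_r D h a).
Proof. by move=> c g h; rewrite /Ad_r linearP tlift_linear //; exact: Ad_r_bilinear. Qed.

Lemma Ad_l_linear h : linear (Ad_l D h).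
Proof.
by move=> c a b; rewrite /Ad_l -tlift_linf; apply: tlift_ext => x y;
  rewrite mulrDr mulrDl -pzscalerAr -pzscalerAl.
Qed.

Lemma Ad_r_linear h : linear (Ad_r D h).
Proof.
by move=> c a b; rewrite /Ad_r -tlift_linf; apply: tlift_ext => x y;
  rewrite mulrDr mulrDl -pzscalerAr -pzscalerAl.
Qed.

Lemma Ad_l_unit a : Ad_l D 1 a = a.
Proof.
rewrite /Ad_l comul1 /hpure tlift_pure; last exact: Ad_l_bilinear.
by rewrite -/(S 1) antipode1 mul1r mulr1.
Qed.

Lemma Ad_r_unit a : Ad_r D 1 a = a.
Proof.
rewrite /Ad_r comul1 /hpure tlift_pure; last exact: Ad_r_bilinear.
by rewrite -/(S 1) antipode1 mul1r mulr1.
Qed.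

Lemma Ad_l1 h : Ad_l D h 1 = eps h *: (1 : H).
Proof. by rewrite -[RHS]antipoder; apply: tlift_ext => x y; rewrite mulr1. Qed.

Lemma antipode_mul_Ad_l h b :
  tlift (fun x y : H => S x * Ad_l D y b) (comul D h) = b * S h.
Proof.
transitivity (tlift (fun x y : H => tlift (fun y1 y2 : H => S x * (y1 * b * S y2)) (comul D y))
   (comul D h)).
  apply: tlift_ext => x y; have L : linear (fun z : H => S x * z) by lin.
  by rewrite /Ad_l (tlift_comp _ _ L).
rewrite -(@coassoc_lift _ (fun x y z : H => S x * (y * b * S z))); last first.
  by split=> ? ?; lin.
rewrite -[RHS](@counitl_in _ (fun z : H => b * S z)); last by lin.
apply: tlift_ext => x y; rewrite -[b * S y in RHS]mul1r -antipodel_in.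
by apply: tlift_ext => u v; rewrite mul1r !mulrA.
Qed.

(** H is a module algebra over itself: in h_(1) a S(h_(2)) h_(3) b S(h_(4)) the two
    middle factors cancel. *)
Lemma Ad_l_mul h a b :
  Ad_l D h (a * b) = tlift (fun x y : H => Ad_l D x a * Ad_l D y b) (comul D h).
Proof.
transitivity (tlift (fun x y : H => tlift (fun x1 x2 : H => x1 * a * S x2 * Ad_l D y b)
    (comul D x)) (comul D h)); last first.
  apply: tlift_ext => x y; have L : linear (fun z : H => z * Ad_l D y b) by lin.
  by rewrite [in RHS]/Ad_l (tlift_comp _ _ L).
rewrite (@coassoc_lift _ (fun x y z : H => x * a * S y * Ad_l D z b)); last first.
  split=> ? ?; [by lin|by lin|].
  by move=> c u v; rewrite Ad_l_linearl mulrDr -pzscalerAr.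
apply: tlift_ext => x y.
have L : linear (fun z : H => x * a * z) by lin.
rewrite -[RHS](@tlift_ext _ _ _ _ (fun y1 y2 : H => x * a * (S y1 * Ad_l D y2 b))).
  by rewrite -(tlift_comp _ _ L) antipode_mul_Ad_l !mulrA.
by move=> u v; rewrite !mulrA.
Qed.

End HopfTheory.

(** * Gaussian binomials *)

Section GaussianBinomials.
Variable F : fieldType.

(** Defined by the q-Pascal rule, hence for every w, in particular for the roots of
    unity at which the quotients of quantum factorials are undefined. *)
Fixpoint gauss (w : F) (n m : nat) : F :=
  match n, m with
  | _, 0 => 1
  | 0, _.+1 => 0
  | n'.+1, m'.+1 => gauss w n' m' + w ^+ m * gauss w n' m
  end.

Lemma gauss0r w n : gauss w n 0 = 1. Proof. by case: n. Qed.

Lemma gaussS w n m : gauss w n.+1 m.+1 = gauss w n m + w ^+ m.+1 * gauss w n m.+1.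
Proof. by []. Qed.

Lemma gauss_small w n m : (n < m)%N -> gauss w n m = 0.
Proof.
elim: n m => [|n IH] [|m] //= nm; rewrite !IH ?mulr0 ?addr0 //; exact: ltnW.
Qed.

Variable u : F.

Definition qnum n : F := (u ^+ n - u ^- n) / (u - u^-1).
Definition qnum_fact n : F := \prod_(1 <= m < n.+1) qnum m.

Lemma qnum_fact0 : qnum_fact 0 = 1. Proof. by rewrite /qnum_fact big_geq. Qed.

Lemma qnum_factS n : qnum_fact n.+1 = qnum_fact n * qnum n.+1.
Proof. by rewrite /qnum_fact big_nat_recr. Qed.

Hypothesis u0 : u != 0.

Lemma qnumD a b : qnum (a + b) = u ^- b * qnum a + u ^+ a * qnum b.
Proof.
rewrite /qnum !mulrA -mulrDl; congr (_ / _).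
rewrite !mulrBr -exprD -!exprVn exprD [u^-1 ^+ (_ + _)]exprD.
move: (u^-1 ^+ a) (u^-1 ^+ b) => x y; ring.
Qed.

(** The power of u converts from the Gaussian binomials in u^2 to the balanced ones. *)
Lemma gauss_fact a b :
  gauss (u ^+ 2) (a + b) a * (qnum_fact a * qnum_fact b) =
  u ^+ (a * b) * qnum_fact (a + b).
Proof.
have [n] := ubnP (a + b); elim: n a b => // n IH [|a] b.
  by rewrite mul0n add0n gauss0r qnum_fact0 !mul1r.
case: b => [|b] lt_n.
  rewrite addn0 muln0 expr0 qnum_fact0 mulr1.
  suff -> : gauss (u ^+ 2) a.+1 a.+1 = 1 by [].
  by elim: a {lt_n} => [|a IHa]; rewrite gaussS [X in _ * X]gauss_small // mulr0 addr0.
rewrite addSn gaussS mulrDl.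
have -> : gauss (u ^+ 2) (a + b.+1) a * (qnum_fact a.+1 * qnum_fact b.+1) =
    qnum a.+1 * (u ^+ (a * b.+1) * qnum_fact (a + b.+1)).
  by rewrite -IH ?qnum_factS; [ring | rewrite -ltnS].
have -> : u ^+ 2 ^+ a.+1 * gauss (u ^+ 2) (a + b.+1) a.+1 *
      (qnum_fact a.+1 * qnum_fact b.+1) =
    u ^+ 2 ^+ a.+1 * qnum b.+1 * (u ^+ (a.+1 * b) * qnum_fact (a + b.+1)).
  have -> : (a + b.+1 = a.+1 + b)%N by rewrite addnS.
  by rewrite -IH ?[qnum_fact b.+1]qnum_factS; [ring | rewrite -ltnS -addnS].
rewrite qnum_factS -addSn qnumD -exprM.
have -> : u ^+ (a.+1 * b.+1) = u ^+ (a * b.+1) * u ^+ b.+1.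
  by rewrite -exprD mulSn addnC.
have -> : u ^+ (a.+1 * b) = u ^+ (a * b) * u ^+ b by rewrite -exprD mulSn addnC.
have -> : u ^+ (a * b.+1) = u ^+ (a * b) * u ^+ a by rewrite -exprD mulnS addnC.
have -> : u ^+ (2 * a.+1) = u ^+ a.+1 * u ^+ a.+1 by rewrite -exprD mul2n addnn.
have : u ^+ b * u ^- b = 1 by rewrite divff // expf_neq0.
rewrite !exprS invfM => E.
have E2 : u * u^-1 = 1 by rewrite divff.
move: (u ^- b) (u^-1) E E2 => ub ui E E2.
transitivity (qnum_fact (a + b.+1) * (u ^+ (a * b) * u ^+ a) *
   (qnum a.+1 * ((u * ui) * (u ^+ b * ub)) + u * u ^+ a * qnum b.+1 * (u * u ^+ b))).
  by rewrite E E2; ring.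
ring.
Qed.

End GaussianBinomials.

(** * Skew primitive elements *)

Section SkewPrimitive.
Variables (F : fieldType) (H : pzAlgType F) (D : hopfAlgebra H).

Lemma antipode_grouplike (g gi : H) :
  comul D g = hpure g g -> counit D g = 1 -> g * gi = 1 -> antipode D g = gi.
Proof.
move=> dg eg ggi; have := antipodel D g; rewrite dg eg scale1r.
rewrite /hpure tlift_pure => [E|]; last first.
  by apply: bilinear_mapI => ?; [move=> c x y; rewrite linearP mulrDl pzscalerAl|exact: linear_mull].
by rewrite -[LHS]mulr1 -ggi mulrA E mul1r.
Qed.

Lemma comul_grouplike_inv (g gi : H) :
  comul D g = hpure g g -> g * gi = 1 -> gi * g = 1 -> comul D gi = hpure gi gi.
Proof.
move=> dg ggi gig; have := comulM D g gi; rewrite ggi comul1 dg => E.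
by rewrite -[LHS]tmul1l -{1 2}gig -tmul_pure -tmulA -E tmul_pure !mulr1.
Qed.

Lemma counit_grouplike_inv (g gi : H) :
  counit D g = 1 -> g * gi = 1 -> counit D gi = 1.
Proof.
move=> eg ggi; have := counitM D g gi; rewrite ggi counit1 eg => ->.
by rewrite [RHS](mul1r (counit D gi : F)).
Qed.

Variables (X g gi h hi : H) (al be : F).
Hypotheses (ggi : g * gi = 1) (gig : gi * g = 1) (hhi : h * hi = 1) (hih : hi * h = 1).
Hypothesis gh : g * h = h * g.
Hypotheses (dX : comul D X = hpure X g + hpure h X).
Hypotheses (dg : comul D g = hpure g g) (dh : comul D h = hpure h h).
Hypotheses (eX : counit D X = 0) (eg : counit D g = 1) (eh : counit D h = 1).
Hypotheses (al0 : al != 0) (be0 : be != 0).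
Hypotheses (hX : h * X = al *: (X * h)) (gX : g * X = be *: (X * g)).

Local Notation S := (antipode D).

Lemma antipode_skew : S X = - (hi * X * gi).
Proof.
have := antipodel D X; rewrite dX eX scale0r.
have bf : bilinear_map (fun x y : H => antipode D x * y).
  by apply: bilinear_mapI => ?; [move=> c x y; rewrite linearP mulrDl pzscalerAl|exact: linear_mull].
rewrite tliftD // /hpure !tlift_pure // (antipode_grouplike dh eh hhi) => E.
rewrite -[S X]mulr1 -ggi mulrA; move/eqP: E; rewrite addr_eq0 => /eqP ->.
by rewrite mulNr.
Qed.

(** The left adjoint action of an element X with Delta X = X (x) g + h (x) X, where
    gi and hi are the inverses of g and h. *)
Definition skew_ad (y : H) : H := (X * y - h * y * hi * X) * gi.

Lemma Ad_l_skew y : Ad_l D X y = skew_ad y.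
Proof.
have bf := Ad_l_bilinear D y.
rewrite /Ad_l dX tliftD // /hpure !tlift_pure // (antipode_grouplike dg eg ggi).
by rewrite antipode_skew /skew_ad mulrBl mulrN !mulrA.
Qed.

Lemma Ad_l_skewX n y : Ad_l D (X ^+ n) y = iter n skew_ad y.
Proof.
elim: n y => [|n IH] y.
  by rewrite expr0 Ad_l_unit.
by rewrite exprS Ad_lM IH Ad_l_skew iterS.
Qed.

Lemma Ad_r_grouplike (x xi y : H) :
  comul D x = hpure x x -> counit D x = 1 -> x * xi = 1 -> Ad_r D x y = xi * y * x.
Proof.
move=> dx ex xxi; rewrite /Ad_r dx /hpure tlift_pure; last exact: (Ad_r_bilinear D y).
by rewrite (antipode_grouplike dx ex xxi).
Qed.

Lemma Ad_l_grouplike (x xi y : H) :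
  comul D x = hpure x x -> counit D x = 1 -> x * xi = 1 -> Ad_l D x y = x * y * xi.
Proof.
move=> dx ex xxi; rewrite /Ad_l dx /hpure tlift_pure; last exact: (Ad_l_bilinear D y).
by rewrite (antipode_grouplike dx ex xxi).
Qed.

Lemma antipode_Ad_l_grouplike (x xi y : H) :
  comul D x = hpure x x -> counit D x = 1 -> x * xi = 1 -> xi * x = 1 ->
  S (Ad_l D x y) = Ad_r D (S x) (S y).
Proof.
move=> dx ex xxi xix; have dxi := comul_grouplike_inv dx xxi xix.
have exi := counit_grouplike_inv ex xxi.
rewrite (Ad_l_grouplike _ dx ex xxi) (antipode_grouplike dx ex xxi).
rewrite (Ad_r_grouplike _ dxi exi xix) !antipodeM.
by rewrite (antipode_grouplike dx ex xxi) (antipode_grouplike dxi exi xix) mulrA.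
Qed.

Lemma antipode_Ad_l_skew y : S (Ad_l D X y) = Ad_r D (S X) (S y).
Proof.
have dgi := comul_grouplike_inv dg ggi gig; have dhi := comul_grouplike_inv dh hhi hih.
have egi := counit_grouplike_inv eg ggi; have ehi := counit_grouplike_inv eh hhi.
rewrite Ad_l_skew /skew_ad antipode_skew -[- (hi * X * gi)]scaleN1r (linear_fZ _ _ (Ad_r_linearl D (S y))).
rewrite !Ad_rM (Ad_r_grouplike _ dgi egi gig) (Ad_r_grouplike _ dhi ehi hih).
have -> z : Ad_r D X z = - (hi * X * gi) * z * g + hi * z * X.
  have bf := Ad_r_bilinear D z.
  rewrite /Ad_r dX tliftD // /hpure !tlift_pure // (antipode_grouplike dh eh hhi).
  by rewrite antipode_skew.
rewrite antipodeM raddfB /= !antipodeM (antipode_grouplike dgi egi gig).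
rewrite (antipode_grouplike dhi ehi hih) (antipode_grouplike dh eh hhi).
rewrite antipode_skew scaleN1r; move: (S y) => z.
rewrite !mulrBr !mulrDr !mulrDl !(mulrN, mulNr) !mulrA opprD !opprK addrC.
congr (_ - _); last by rewrite -[g * hi * h]mulrA hih mulr1.
by rewrite -[RHS]mulrA ggi mulr1.
Qed.

Lemma skew_ad_linear : linear skew_ad.
Proof.
move=> c x y; rewrite /skew_ad pzscalerAl -mulrDl; congr (_ * gi).
rewrite !mulrDr !mulrDl -!pzscalerAr -!pzscalerAl scalerBr opprD.
exact: addrACA.
Qed.

Lemma skew_ad0 : skew_ad 0 = 0. Proof. exact: linear_f0 skew_ad_linear. Qed.

Lemma skew_ad_iterZ n c y : iter n skew_ad (c *: y) = c *: iter n skew_ad y.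
Proof. by elim: n => //= n ->; rewrite linear_fZ //; exact: skew_ad_linear. Qed.

Lemma skew_ad_iter0 n : iter n skew_ad 0 = 0.
Proof. by elim: n => //= n ->; exact: skew_ad0. Qed.

Lemma skew_adM y z :
  skew_ad (y * z) = skew_ad y * (g * z * gi) + h * y * hi * skew_ad z.
Proof.
have E a : a * gi * (g * z * gi) = a * z * gi.
  by rewrite !mulrA -[a * gi * g]mulrA gig mulr1.
rewrite /skew_ad E [h * y * hi * (_ * gi)]mulrA -mulrDl; congr (_ * gi).
rewrite mulrBl mulrBr !mulrA -[h * y * hi * h]mulrA hih mulr1.
by rewrite addrA subrK.
Qed.

Lemma conj_skew_ad (x xi : H) (lam : F) y : x * xi = 1 -> xi * x = 1 -> lam != 0 ->
  x * X = lam *: (X * x) -> x * g = g * x -> x * h = h * x ->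
  skew_ad (x * y * xi) = lam^-1 *: (x * skew_ad y * xi).
Proof.
move=> xxi xix lam0 xX xg xh; pose c z := x * z * xi.
have cM a b : c (a * b) = c a * c b.
  by rewrite /c !mulrA -[x * a * xi * x]mulrA xix mulr1.
have c_fix a ai : a * ai = 1 -> ai * a = 1 -> x * a = a * x -> c a = a /\ c ai = ai.
  move=> aai aia xa; have ca : c a = a by rewrite /c xa -mulrA xxi mulr1.
  split=> //; rewrite -[LHS]mul1r -aia -[LHS]mulrA -[a in LHS]ca -cM aai.
  by rewrite /c mulr1 xxi mulr1.
have [[_ cgi] [ch chi]] := (c_fix _ _ ggi gig xg, c_fix _ _ hhi hih xh).
have cX : c X = lam *: X by rewrite /c xX -pzscalerAl -mulrA xxi mulr1.
rewrite -/(c y) -/(c (skew_ad y)) {2}/skew_ad cM cgi.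
have -> : c (X * y - h * y * hi * X) = c (X * y) - c (h * y * hi * X).
  by rewrite /c mulrBr mulrBl.
rewrite !cM ch chi cX -pzscalerAl -pzscalerAr -scalerBr -pzscalerAl scalerA.
by rewrite mulVf // scale1r.
Qed.

Lemma skew_ad_iter_conj n (x xi : H) (lam : F) y : x * xi = 1 -> xi * x = 1 -> lam != 0 ->
  x * X = lam *: (X * x) -> x * g = g * x -> x * h = h * x ->
  iter n skew_ad y = 0 -> iter n skew_ad (x * y * xi) = 0.
Proof.
move=> xxi xix lam0 xX xg xh; elim: n y => [|n IH] y.
  by move=> /= ->; rewrite mulr0 mul0r.
rewrite !iterSr (@conj_skew_ad _ _ lam) // skew_ad_iterZ => /IH ->.
by rewrite scaler0.
Qed.

(** A skew derivation satisfies a Leibniz rule up to the conjugations by g and h,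
    which commute with it up to a scalar; hence nilpotency degrees add up. *)
Lemma skew_ad_nilM a b y z :
  iter a skew_ad y = 0 -> iter b skew_ad z = 0 ->
  iter (a + b).-1 skew_ad (y * z) = 0.
Proof.
have [n] := ubnP (a + b); elim: n a b y z => // n IH [|a] b y z lt_n.
  by move=> /= -> _; rewrite mul0r skew_ad_iter0.
case: b lt_n => [|b] lt_n; first by move=> _ /= ->; rewrite mulr0 skew_ad_iter0.
move=> Hy Hz; rewrite addSn addnS -[LHS]/(iter (a + b).+1 skew_ad (y * z)) iterSr skew_adM.
have iterD c u v : iter c skew_ad (u + v) = iter c skew_ad u + iter c skew_ad v.
  by elim: c => //= c ->; rewrite linear_fD //; exact: skew_ad_linear.
rewrite iterD.
have -> : iter (a + b) skew_ad (skew_ad y * (g * z * gi)) = 0.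
  rewrite -[(a + b)%N]/((a + b).+1.-1) -addnS; apply: IH.
  - by rewrite -ltnS.
  - by rewrite -iterSr.
  - by apply: (@skew_ad_iter_conj _ _ _ be).
have -> : iter (a + b) skew_ad (h * y * hi * skew_ad z) = 0.
  rewrite -[(a + b)%N]/((a + b).+1.-1) -addSn; apply: IH.
  - by rewrite -ltnS -addnS.
  - by apply: (@skew_ad_iter_conj _ _ _ al).
  - by rewrite -iterSr.
by rewrite addr0.
Qed.

Lemma skew_ad1 : skew_ad 1 = 0.
Proof. by rewrite /skew_ad mulr1 mulr1 hhi mul1r subrr mul0r. Qed.

Lemma skew_ad_nilX c y m :
  iter c.+1 skew_ad y = 0 -> iter (c * m).+1 skew_ad (y ^+ m) = 0.
Proof.
move=> Hy; elim: m => [|m IH]; first by rewrite muln0 /= expr0 skew_ad1.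
by have := skew_ad_nilM Hy IH; rewrite addSn addnS /= -mulnS exprS.
Qed.

(** The summands of Delta X commute up to u^2, whence the q-binomial theorem. *)
Lemma skew_comulX u n : u != 0 -> al / be = u ^+ 2 ->
  comul D (X ^+ n) =
  \sum_(m < n.+1) gauss (u ^+ 2) n m *: hpure (X ^+ m * h ^+ (n - m)) (g ^+ m * X ^+ (n - m)).
Proof.
move=> u0 albe; elim: n => [|n IH].
  by rewrite big_ord1 expr0 comul1 !expr0 !mulr1 gauss0r scale1r.
have hXm m : h * X ^+ m = al ^+ m *: (X ^+ m * h) by exact: qcommute_expr.
have gXm m : X * g ^+ m = be^-1 ^+ m *: (g ^+ m * X).
  by apply: qcommute_expr; rewrite gX scalerA mulVf // scale1r.
rewrite exprS comulM dX IH tmulDl !tmul_sumr.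
pose T m := hpure (X ^+ m * h ^+ (n.+1 - m)) (g ^+ m * X ^+ (n.+1 - m)).
transitivity (\sum_(m < n.+1) gauss (u ^+ 2) n m *: T m.+1 +
    \sum_(m < n.+2) (u ^+ 2 ^+ m * gauss (u ^+ 2) n m) *: T m).
  congr (_ + _).
    by apply: eq_bigr => m _; rewrite tmulZr tmul_pure !mulrA -!exprS.
  rewrite [RHS]big_ord_recr /= gauss_small // mulr0 scale0r addr0.
  apply: eq_bigr => m _; rewrite tmulZr tmul_pure !mulrA hXm gXm.
  rewrite -!pzscalerAl hpureZl hpureZr !scalerA -!mulrA.
  have E : (n.+1 - m)%N = (n - m).+1 by rewrite subSn // -ltnS.
  rewrite /T E [h ^+ _.+1]exprS [X ^+ _.+1]exprS; congr (_ *: _).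
  by rewrite -albe exprMn [RHS]mulrC mulrA.
rewrite [X in _ + X]big_ord_recl [RHS]big_ord_recl !gauss0r expr0 mulr1 addrCA.
congr (_ + _); rewrite -big_split /=; apply: eq_bigr => m _.
by rewrite -scalerDl.
Qed.

End SkewPrimitive.

(** * Gaussian binomials at roots of unity *)

Section GaussianBinomialsAtRootsOfUnity.
Variables (k : fieldType).

Definition qpoch (w : k) n : {poly k} := \prod_(j < n) (1 + w ^+ j *: 'X).

(** The q-binomial theorem. In the induction the factor j = 0 is split off; the scale
    s absorbs the shift of the remaining exponents. *)
Lemma coef_qpoch w n m : (qpoch w n)`_m = w ^+ 'C(m, 2) * gauss w n m.
Proof.
suff E (s : k) : (\prod_(j < n) (1 + (s * w ^+ j) *: 'X))`_m =
    s ^+ m * (w ^+ 'C(m, 2) * gauss w n m).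
  rewrite -[RHS]mul1r -(expr1n _ m) -E.
  suff -> : qpoch w n = \prod_(j < n) (1 + (1 * w ^+ j) *: 'X) by [].
  by apply: eq_bigr => j _; rewrite mul1r.
elim: n m s => [|n IH] m s.
  rewrite big_ord0 coef1; case: m => [|m]; first by rewrite !mulr1.
  by rewrite !mulr0.
rewrite big_ord_recl expr0 mulr1 mulrDl mul1r -scalerAl coefD coefZ coefXM.
have -> : \prod_(j < n) (1 + (s * w ^+ bump 0 j) *: 'X) =
    \prod_(j < n) (1 + ((s * w) * w ^+ j) *: 'X).
  by apply: eq_bigr => j _; rewrite /bump add1n exprS mulrA.
rewrite !IH; case: m => [|m]; first by rewrite /= mulr0 addr0 !gauss0r.
rewrite gaussS /= binS bin1 exprD !exprMn !exprS; ring.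
Qed.

Lemma qpoch_period w n c M : w ^+ M = 1 -> qpoch w (c * M + n) = qpoch w M ^+ c * qpoch w n.
Proof.
move=> wM; elim: c => [|c IH]; first by rewrite mul0n add0n expr0 mul1r.
rewrite mulSn -addnA {1}/qpoch big_split_ord /= exprS -mulrA -IH; congr (_ * _).
by apply: eq_bigr => j _; rewrite exprD wM mul1r.
Qed.

(** The factors are w^j (X + w^-j), and the X + w^-j multiply up to X^l + 1 as l is
    odd; comparing constant terms shows that the w^j multiply up to 1. *)
Lemma qpoch_prim_root (w : k) l : l.-primitive_root w -> odd l -> qpoch w l = 1 + 'X^l.
Proof.
move=> prim_w odd_l; have l_gt0 := prim_order_gt0 prim_w.
have w0 : w != 0.
  apply/eqP => w0; have := prim_expr_order prim_w; rewrite w0.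
  by rewrite expr0n (negPf (lt0n_neq0 l_gt0)) => /esym/eqP; rewrite oner_eq0.
have prim_wi : l.-primitive_root (w^-1).
  have -> : w^-1 = w ^+ l.-1.
    by apply: (mulfI w0); rewrite divff // -exprS prednK // prim_expr_order.
  by rewrite prim_root_exp_coprime // coprimePn.
have E : \prod_(0 <= j < l) ('X + (w^-1 ^+ j)%:P) = 'X^l + 1 :> {poly k}.
  have := congr1 (fun q => q \Po - 'X) (factor_Xn_sub_1 prim_wi).
  rewrite rmorph_prod /= comp_polyB rmorphXn /= comp_polyX comp_polyC exprNn -signr_odd odd_l.
  rewrite expr1 mulN1r -opprD => /(congr1 -%R); rewrite opprK => <-.
  have -> : \prod_(0 <= j < l) (('X - (w^-1 ^+ j)%:P) \Po - 'X) =
      (-1) ^+ l * \prod_(0 <= j < l) ('X + (w^-1 ^+ j)%:P).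
    rewrite !big_mkord -[in X in (-1) ^+ X](card_ord l) -prodrN.
    apply: eq_bigr => j _.
    by rewrite comp_polyB comp_polyX comp_polyC opprD.
  by rewrite -signr_odd odd_l mulN1r opprK.
have F : qpoch w l = (\prod_(j < l) w ^+ j) *: ('X^l + 1).
  rewrite -E big_mkord -scaler_prod; apply: eq_bigr => j _.
  rewrite scalerDr addrC; congr (_ + _).
  by rewrite -mul_polyC -rmorphM /= exprVn divff // expf_neq0.
have : (qpoch w l)`_0 = 1 by rewrite coef_qpoch gauss0r !mulr1.
rewrite F coefZ coefD coefXn coef1 eq_sym (negPf (lt0n_neq0 l_gt0)) add0r mulr1.
by move=> ->; rewrite scale1r addrC.
Qed.

(** The case of Lucas' theorem that isolates the leading digit c of c M + a: by the
    hypothesis on [qpoch], passing from n to n + M multiplies the generating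
    function by 1 + X^M. *)
Lemma gauss_lead_digit w M c a : (a < M)%N -> w ^+ M = 1 -> qpoch w M = 1 + 'X^M ->
  w ^+ 'C(M, 2) * gauss w (c * M + a) M = c%:R.
Proof.
move=> aM wM qM; rewrite -coef_qpoch; elim: c => [|c IH].
  by rewrite mul0n add0n coef_qpoch gauss_small // mulr0.
rewrite qpoch_period // exprS -mulrA -qpoch_period // qM mulrDl mul1r coefD IH.
by rewrite coefXnM ltnn subnn coef_qpoch gauss0r !mulr1 -natr1.
Qed.

Lemma qpoch_prim_root_pchar (w : k) l p t : l.-primitive_root w -> odd l ->
  (0 < t -> p \in [pchar k])%N -> qpoch w (l * p ^ t) = 1 + 'X^(l * p ^ t).
Proof.
move=> prim_w odd_l pk.
have wl : w ^+ l = 1 by exact: prim_expr_order.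
have := qpoch_period 0 (p ^ t) wl; rewrite addn0 [X in _ * X]/qpoch big_ord0 mulr1.
rewrite mulnC => ->; rewrite qpoch_prim_root // exprM.
case: t pk => [|t] pk; first by rewrite !expr1.
rewrite exprDn_pchar ?expr1n //.
have pP : p \in [pchar {poly k}] by rewrite pchar_poly; apply: pk.
by rewrite (eq_pnat _ (pcharf_eq pP)) pnatX pnat_id ?(pcharf_prime pP).
Qed.

Lemma gauss_neq0 (w : k) l p t c a : l.-primitive_root w -> odd l ->
  (0 < t -> p \in [pchar k])%N -> (a < l * p ^ t)%N -> c%:R != 0 :> k ->
  gauss w (c * (l * p ^ t) + a) (l * p ^ t) != 0.
Proof.
move=> prim_w odd_l pk lt_a c0.
have wM : w ^+ (l * p ^ t) = 1 by rewrite exprM (prim_expr_order prim_w) expr1n.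
have := gauss_lead_digit c lt_a wM (qpoch_prim_root_pchar prim_w odd_l pk).
by move=> E; apply: contraNneq c0 => G0; rewrite -E G0 mulr0.
Qed.

End GaussianBinomialsAtRootsOfUnity.

(** * The specialization of the integral form *)

Lemma q_neq0 : q != 0.
Proof. by rewrite /q tofrac_eq0 polyX_eq0. Qed.

Section LaurentSpecialization.
Variables (k : fieldType) (z : k).
Hypothesis z0 : z != 0.

(** The ring morphism from Z[q, q^-1] to k is kept as a relation, so that no normal
    form of Laurent polynomials has to be chosen. *)
Definition specializes (x : Qq) (c : k) : Prop :=
  exists P n, x = laurent P n /\ c = laurent_at z P n.

Lemma laurent_addn P n m : laurent P n = laurent (P * 'X^m) (n + m).
Proof.
rewrite /laurent rmorphM /= map_polyXn rmorphM /= rmorphXn /= -/q.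
by rewrite exprD invfM mulrACA divff ?mulr1 // expf_neq0 // q_neq0.
Qed.

Lemma laurent_at_addn P n m : laurent_at z P n = laurent_at z (P * 'X^m) (n + m).
Proof.
rewrite /laurent_at rmorphM /= map_polyXn hornerM hornerXn.
by rewrite exprD invfM mulrACA divff ?mulr1 // expf_neq0.
Qed.

Lemma specializesD x y c d :
  specializes x c -> specializes y d -> specializes (x + y) (c + d).
Proof.
move=> [P [n [-> ->]]] [Q [m [-> ->]]].
exists (P * 'X^m + Q * 'X^n), (n + m)%N; split.
  rewrite (laurent_addn P n m) (laurent_addn Q m n) [(m + n)%N]addnC.
  by rewrite /laurent -mulrDl -!rmorphD.
rewrite (laurent_at_addn P n m) (laurent_at_addn Q m n) [(m + n)%N]addnC.
by rewrite /laurent_at -mulrDl rmorphD /= hornerD.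
Qed.

Lemma specializesM x y c d :
  specializes x c -> specializes y d -> specializes (x * y) (c * d).
Proof.
move=> [P [n [-> ->]]] [Q [m [-> ->]]]; exists (P * Q), (n + m)%N; split.
  by rewrite /laurent mulrACA -invfM -exprD -!rmorphM.
by rewrite /laurent_at mulrACA -invfM -exprD rmorphM /= hornerM.
Qed.

Lemma specializes1 : specializes 1 1.
Proof.
exists 1, 0%N; rewrite /laurent /laurent_at !rmorph1 hornerC !expr0.
by rewrite !invr1 !mulr1.
Qed.

Lemma specializesN1 : specializes (-1) (-1).
Proof.
exists (-1), 0%N; rewrite /laurent /laurent_at !rmorphN1 /= hornerN hornerC !expr0.
by rewrite !invr1 !mulr1.
Qed.

Lemma specializes_q : specializes q z.
Proof.
exists 'X, 0%N; rewrite /laurent /laurent_at !map_polyX hornerX !expr0.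
by rewrite !invr1 !mulr1.
Qed.

Lemma specializes_qV : specializes q^-1 z^-1.
Proof.
by exists 1, 1%N; rewrite /laurent /laurent_at !rmorph1 hornerC !expr1 !mul1r.
Qed.

Lemma specializesX x c n : specializes x c -> specializes (x ^+ n) (c ^+ n).
Proof.
move=> xc; elim: n => [|n IH]; rewrite ?expr0 ?exprS; first exact: specializes1.
exact: specializesM.
Qed.

Lemma specializesB x y c d :
  specializes x c -> specializes y d -> specializes (x - y) (c - d).
Proof.
move=> xc yd; apply: specializesD => //; rewrite -mulN1r -[- d]mulN1r.
by apply: specializesM => //; exact: specializesN1.
Qed.

Lemma inA_specializes x : inA x -> exists c, specializes x c.
Proof. by move=> [P [n ->]]; exists (laurent_at z P n), P, n. Qed.

End LaurentSpecialization.

Section FreeAlgebraInduction.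
Variables (K : fieldType) (X : choiceType).

Definition lin_closed (M : lmodType K) (Q : M -> Prop) : Prop :=
  Q 0 /\ forall c x y, Q x -> Q y -> Q (c *: x + y).

Lemma free_alg_word x (s : seq X) :
  << FMonom (x :: s) >> = fgen K x * << FMonom s >> :> free_alg K X.
Proof.
rewrite /fgen [RHS]malgM_def fgmulUU mulr1; congr (<< _ >>).
by apply: val_inj; rewrite -[RHS]/(fmonom_val _) fmM fmuE.
Qed.

Lemma free_alg_word0 : << FMonom [::] >> = 1 :> free_alg K X.
Proof. by congr (<< _ >>); apply: val_inj; rewrite -[RHS]/(fmonom_val _) fm1. Qed.

Lemma free_alg_ind (Q : free_alg K X -> Prop) : lin_closed Q ->
  (forall s, Q << FMonom s >>) -> forall y, Q y.
Proof.
move=> [Q0 Qlin] Qword y; rewrite [y]monalgE.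
elim: (enum_fset (msupp y)) => [|m s IH]; first by rewrite big_nil.
rewrite big_cons.
have -> : << y@_m *g m >> = y@_m *: << m >> :> free_alg K X.
  by apply/malgP => t; rewrite mcoeffZ !mcoeffU mulr_natr.
by apply: Qlin => //; case: m => m; exact: Qword.
Qed.

End FreeAlgebraInduction.

Section Specialization.
Variables (R : archiRealFieldType) (V : vectType R) (Phi : rootSystem V).
Variables (k : fieldType) (z : k) (l : nat).
Hypothesis z0 : z != 0.

Local Notation Uq := (Uq Phi).
Local Notation UA := (UA Phi).
Local Notation Uz := (Uz Phi z l).
Local Notation Uz_in := (@Uz_in R V Phi k z l).

Lemma UAval_inj : injective (@UAval R V Phi).
Proof. exact: val_inj. Qed.

Lemma UAvalM (x y : UA) : UAval (x * y) = UAval x * UAval y.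
Proof. exact: (rmorphM (val : UA -> Uq)). Qed.
Lemma UAvalD (x y : UA) : UAval (x + y) = UAval x + UAval y.
Proof. exact: (raddfD (val : UA -> Uq)). Qed.
Lemma UAval1 : UAval (1 : UA) = 1.
Proof. exact: (rmorph1 (val : UA -> Uq)). Qed.

Lemma api_rel (K : pzRingType) (A : pzAlgType K) (S : A -> Prop) x y :
  S (x - y) -> api S x = api S y.
Proof.
move=> Sxy; apply/lpi_eqP/lin_span_gen; exists 1, 1, (x - y).
by split=> //; rewrite mul1r mulr1.
Qed.

Lemma apiD (K : pzRingType) (A : pzAlgType K) (S : A -> Prop) x y :
  api S (x + y) = api S x + api S y.
Proof. exact: lpiD. Qed.

Lemma apiB (K : pzRingType) (A : pzAlgType K) (S : A -> Prop) x y :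
  api S (x - y) = api S x - api S y.
Proof. exact: lpiB. Qed.

Lemma Uz_inM x y : Uz_in (x * y) = Uz_in x * Uz_in y.
Proof.
by rewrite /Defs.Uz_in -apiM /UAk_in -apiM; congr api; apply/api_rel; exact: UAk_M.
Qed.

Lemma Uz_inD x y : Uz_in (x + y) = Uz_in x + Uz_in y.
Proof.
by rewrite /Defs.Uz_in -apiD /UAk_in -apiD; congr api; apply/api_rel; exact: UAk_D.
Qed.

Lemma Uz_in1 : Uz_in 1 = 1.
Proof.
rewrite /Defs.Uz_in; have -> : UAk_in z (1 : UA) = 1 by apply/api_rel; exact: UAk_1.
by [].
Qed.

Lemma Uz_inZ P n x y : UAval y = laurent P n *: UAval x ->
  Uz_in y = laurent_at z P n *: Uz_in x.
Proof.
move=> E; rewrite /Defs.Uz_in -apiZ /UAk_in -apiZ; congr api; apply/api_rel.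
exact: UAk_Z.
Qed.

(** The map from U_A to U_zeta is kept as a relation on U_q, so that identities of
    U_q are transported without membership proofs. *)
Definition reduces (u : Uq) (x : Uz) : Prop :=
  exists a : UA, UAval a = u /\ Uz_in a = x.

Lemma reduces_inj u x y : reduces u x -> reduces u y -> x = y.
Proof. by move=> [a [<- <-]] [b [/UAval_inj <- <-]]. Qed.

Lemma reduces_in a : reduces (UAval a) (Uz_in a).
Proof. by exists a. Qed.

Lemma reduces1 : reduces 1 1.
Proof. by exists 1; rewrite UAval1 Uz_in1. Qed.

Lemma reducesM u v x y : reduces u x -> reduces v y -> reduces (u * v) (x * y).
Proof. by move=> [a [<- <-]] [b [<- <-]]; exists (a * b); rewrite UAvalM Uz_inM. Qed.

Lemma reducesD u v x y : reduces u x -> reduces v y -> reduces (u + v) (x + y).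
Proof. by move=> [a [<- <-]] [b [<- <-]]; exists (a + b); rewrite UAvalD Uz_inD. Qed.

Lemma reducesZ c d u x : specializes z c d -> reduces u x -> reduces (c *: u) (d *: x).
Proof.
move=> [P [n [-> ->]]] [a [<- <-]].
have Ha : laurent P n *: UAval a \in inUA (Phi := Phi).
  apply/asboolP/gen_subalgZ; first by exists P, n.
  by apply/asboolP; case: a.
by exists (MkUA Ha); split=> //; apply: Uz_inZ.
Qed.

(** The symbols of the elements of U_A multiply as these elements do, so that
    they span U_zeta over k. *)
Lemma Uz_span_ind (Q : Uz -> Prop) : lin_closed Q -> (forall a : UA, Q (Uz_in a)) ->
  forall x, Q x.
Proof.
move=> [Q0 Qlin] Qin x.
have [y ->] := apiK x; have [{}y ->] := apiK y; move: y => y {x}.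
pattern y; apply: free_alg_ind => [|s {y}].
  split=> [|c x y' Qx Qy]; first by rewrite /api /lpi !raddf0.
  by rewrite !apiD !apiZ; exact: Qlin.
suff [a ->] : exists a, api (UAk_rel z) (<< FMonom s >> : free_alg k UA) = UAk_in z a.
  exact: Qin.
elim: s => [|x s [a IH]].
  exists 1; rewrite free_alg_word0 /UAk_in; apply/esym/api_rel; exact: UAk_1.
exists (x * a); rewrite free_alg_word apiM IH /UAk_in -apiM; apply/esym/api_rel.
exact: UAk_M.
Qed.

End Specialization.

(** * Nilpotency of the adjoint action on twisted generators *)

Section QuantumSerre.
Variables (F : fieldType) (A : pzAlgType F) (X Y : A) (w t : F).

Fixpoint qcomm_iter n : A :=
  if n is n'.+1 then X * qcomm_iter n' - (w ^+ n' * t) *: (qcomm_iter n' * X) else Y.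

(** Left and right multiplication by X commute, so that the iterated q-commutator is
    a product of commuting factors and expands by the q-binomial theorem. *)
Lemma qcomm_iterE n : qcomm_iter n =
  \sum_(s < n.+1) ((- t) ^+ s * (qpoch w n)`_s) *: (X ^+ (n - s) * Y * X ^+ s).
Proof.
elim: n => [|n IH].
  by rewrite big_ord1 /qpoch big_ord0 coef1 !expr0 !mulr1 mul1r scale1r.
have coefS s : (qpoch w n.+1)`_s.+1 = (qpoch w n)`_s.+1 + w ^+ n * (qpoch w n)`_s.
  by rewrite /qpoch big_ord_recr /= mulrDr mulr1 coefD -scalerAr coefZ coefMX.
have coef0 m : (qpoch w m)`_0 = 1 by rewrite coef_qpoch gauss0r !mulr1.
rewrite /= IH mulr_sumr mulr_suml scaler_sumr.
have -> : \sum_(s < n.+1) X * (((- t) ^+ s * (qpoch w n)`_s) *: (X ^+ (n - s) * Y * X ^+ s))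
    = \sum_(s < n.+2) ((- t) ^+ s * (qpoch w n)`_s) *: (X ^+ (n.+1 - s) * Y * X ^+ s).
  rewrite [RHS]big_ord_recr /= [(qpoch w n)`_n.+1]coef_qpoch gauss_small //.
  rewrite !mulr0 scale0r addr0; apply: eq_bigr => s _.
  by rewrite -pzscalerAr !mulrA -exprS -subSn // -ltnS.
rewrite big_ord_recl [RHS]big_ord_recl !coef0 -addrA; congr (_ + _).
rewrite -sumrN -big_split /=; apply: eq_bigr => s _.
rewrite coefS -pzscalerAl !scalerA -!mulrA -exprSr -scaleNr subSS /bump add1n -scalerDl.
by congr (_ *: _); rewrite exprS; ring.
Qed.
End QuantumSerre.

Section QuantumRelations.
Variables (k : fieldType) (A : pzAlgType k) (I : eqType).
Variables (v : I -> k) (na : I -> I -> nat).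

Definition sku (b : bool) i : k := if b then v i else (v i)^-1.

Definition wt (b : bool) i j : k :=
  if i == j then sku b i ^+ 2 else (sku b i)^-1 ^+ na i j.

Variables (X : bool -> I -> A) (K Kinv : I -> A).

(** The defining relations of U_q, with X true = E, X false = F, v i = q_i and
    na i j = - <alpha_j, alpha_i^vee>. *)
Record quantum_relations : Prop := QuantumRelations {
  qr_v_neq0 : forall i, v i != 0;
  qr_v_free : forall i n, (0 < n)%N -> v i ^+ n != 1;
  qr_wtC : forall i j, wt true i j = wt true j i;
  qr_KK : forall i, K i * Kinv i = 1;
  qr_VK : forall i, Kinv i * K i = 1;
  qr_KC : forall i j, K i * K j = K j * K i;
  qr_KX : forall b i j, K i * X b j * Kinv i = wt b i j *: X b j;
  qr_EF : forall i j, X true i * X false j - X false j * X true i =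
    ((i == j)%:R / (v i - (v i)^-1)) *: (K i - Kinv i);
  qr_serre : forall b i j, i != j -> let N := (na i j).+1 in
    \sum_(s < N.+1) ((-1) ^+ s *
       (qnum_fact (v i) N / (qnum_fact (v i) s * qnum_fact (v i) (N - s)))) *:
     (X b i ^+ (N - s) * X b j * X b i ^+ s) = 0
}.

Hypothesis QR : quantum_relations.

Lemma sku_neq0 b i : sku b i != 0.
Proof. by case: b; rewrite /sku ?invr_eq0 (qr_v_neq0 QR). Qed.

Lemma wt_neq0 b i j : wt b i j != 0.
Proof. by rewrite /wt; case: ifP => _; rewrite expf_neq0 ?invr_eq0 // sku_neq0. Qed.

Lemma wt_negb b i j : wt (~~ b) i j = (wt b i j)^-1.
Proof. by rewrite /wt /sku; case: ifP => _; case: b => /=; rewrite ?invrK exprVn ?invrK. Qed.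

Lemma wtC b i j : wt b i j = wt b j i.
Proof. by case: b; rewrite -1?[false]/(~~ true) ?wt_negb (qr_wtC QR). Qed.

Lemma K_KV i j : K i * Kinv j = Kinv j * K i.
Proof.
by rewrite -[LHS]mul1r -(qr_VK QR j) -!mulrA [K j * _]mulrA -(qr_KC QR) -!mulrA
  (qr_KK QR) mulr1.
Qed.

Lemma K_X b i j : K i * X b j = wt b i j *: (X b j * K i).
Proof. by rewrite pzscalerAl -(qr_KX QR) -[RHS]mulrA (qr_VK QR) mulr1. Qed.

Lemma X_K b i j : X b j * K i = (wt b i j)^-1 *: (K i * X b j).
Proof. by rewrite K_X scalerA mulVf ?wt_neq0 // scale1r. Qed.

Lemma KV_X b i j : Kinv i * X b j = (wt b i j)^-1 *: (X b j * Kinv i).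
Proof.
rewrite -[LHS]mulr1 -(qr_KK QR i) mulrA -[_ * X b j * _]mulrA X_K -pzscalerAr.
by rewrite mulrA (qr_VK QR) mul1r -pzscalerAl.
Qed.

Lemma E_F i j : i != j -> X true i * X false j = X false j * X true i.
Proof.
move=> ij; have := qr_EF QR i j; rewrite (negPf ij) mul0r scale0r => /eqP.
by rewrite subr_eq0 => /eqP.
Qed.

(** E and F are treated at once: Delta X = X (x) g + h (x) X for the elements g and h
    defined here together with their inverses. *)
Definition skg (b : bool) i : A := if b then 1 else Kinv i.
Definition skgV (b : bool) i : A := if b then 1 else K i.
Definition skh (b : bool) i : A := if b then K i else 1.
Definition skhV (b : bool) i : A := if b then Kinv i else 1.

Lemma skgg b i : skg b i * skgV b i = 1.
Proof. by rewrite /skg /skgV; case: b; rewrite ?mulr1 ?(qr_VK QR). Qed.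
Lemma skgVg b i : skgV b i * skg b i = 1.
Proof. by rewrite /skg /skgV; case: b; rewrite ?mulr1 ?(qr_KK QR). Qed.
Lemma skhh b i : skh b i * skhV b i = 1.
Proof. by rewrite /skh /skhV; case: b; rewrite ?mulr1 ?(qr_KK QR). Qed.
Lemma skhVh b i : skhV b i * skh b i = 1.
Proof. by rewrite /skh /skhV; case: b; rewrite ?mulr1 ?(qr_VK QR). Qed.
Lemma skgh b i : skg b i * skh b i = skh b i * skg b i.
Proof. by rewrite /skh /skg; case: b; rewrite ?mulr1 ?mul1r. Qed.

Definition skal (b : bool) i : k := if b then wt true i i else 1.
Definition skbe (b : bool) i : k := if b then 1 else (wt false i i)^-1.

Lemma skal_neq0 b i : skal b i != 0.
Proof. by case: b; rewrite ?wt_neq0 ?oner_eq0. Qed.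
Lemma skbe_neq0 b i : skbe b i != 0.
Proof. by case: b; rewrite /skbe ?oner_eq0 // invr_eq0 wt_neq0. Qed.

Lemma skhX b i : skh b i * X b i = skal b i *: (X b i * skh b i).
Proof. by rewrite /skh /skal; case: b; rewrite ?K_X // scale1r mul1r mulr1. Qed.
Lemma skgX b i : skg b i * X b i = skbe b i *: (X b i * skg b i).
Proof. by rewrite /skg /skbe; case: b; rewrite ?KV_X // scale1r mul1r mulr1. Qed.

Lemma sk_ratio b i : skal b i / skbe b i = sku b i ^+ 2.
Proof.
rewrite /skal /skbe /wt eqxx; case: b; first by rewrite invr1 mulr1.
by rewrite invrK mul1r.
Qed.

Definition Uq_ad b i : A -> A := skew_ad (X b i) (skgV b i) (skh b i) (skhV b i).

Lemma Uq_adE i y : Uq_ad true i y = X true i * y - K i * y * Kinv i * X true i.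
Proof. by rewrite /Uq_ad /skew_ad /= mulr1. Qed.

Lemma Uq_adF i y : Uq_ad false i y = (X false i * y - y * X false i) * K i.
Proof. by rewrite /Uq_ad /skew_ad /= mul1r mulr1. Qed.

Lemma qnum_sku b i n : qnum (v i) n = qnum (sku b i) n.
Proof.
rewrite /qnum /sku; case: b => //.
rewrite exprVn !invrK -[X in _ = X / _]opprB -[X in _ = _ / X]opprB.
by rewrite invrN mulrNN.
Qed.

Lemma qnum_fact_sku b i n : qnum_fact (v i) n = qnum_fact (sku b i) n.
Proof. by apply: eq_bigr => m _; exact: qnum_sku. Qed.

Lemma qnum_neq0 i n : (0 < n)%N -> qnum (v i) n != 0.
Proof.
have E1 m : (0 < m)%N -> v i ^+ m - v i ^- m != 0.
  move=> m0; rewrite subr_eq0; apply/eqP => E1.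
  have := congr1 (fun x => x * v i ^+ m) E1.
  rewrite mulVf ?expf_neq0 ?(qr_v_neq0 QR) // -exprD => /eqP.
  by apply/negP/(qr_v_free QR); rewrite addn_gt0 m0.
move=> n0; rewrite /qnum mulf_neq0 ?E1 // invr_eq0.
by have := E1 1%N isT; rewrite !expr1.
Qed.

Lemma qnum_fact_neq0 i n : qnum_fact (v i) n != 0.
Proof.
elim: n => [|n IH]; first by rewrite qnum_fact0 oner_eq0.
by rewrite qnum_factS mulf_neq0 // qnum_neq0.
Qed.

(** The factor by which a generator is twisted to become locally nilpotent under
    the adjoint action of the generators of index i. *)
Definition twist (b : bool) i j : A :=
  if b then (if i == j then Kinv j else 1) else (if i == j then 1 else K j).

Definition nil_deg (b b' : bool) i j : nat :=
  if b == b' then (if i == j then 0 else na i j) else (if i == j then 2 else 0).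

Lemma Uq_ad_linear b i : linear (Uq_ad b i).
Proof. exact: skew_ad_linear. Qed.

Definition weight i (c : k) (y : A) : Prop := K i * y * Kinv i = c *: y.

Lemma weightM i c c' y z : weight i c y -> weight i c' z -> weight i (c * c') (y * z).
Proof.
rewrite /weight => Hy Hz.
have -> : K i * (y * z) * Kinv i = (K i * y * Kinv i) * (K i * z * Kinv i).
  by rewrite !mulrA -[_ * Kinv i * K i]mulrA (qr_VK QR) mulr1.
by rewrite Hy Hz pzalgM_scale.
Qed.

Lemma weight_X i b j : weight i (wt b i j) (X b j).
Proof. exact: qr_KX. Qed.

Lemma weight_K i j : weight i 1 (K j).
Proof. by rewrite /weight scale1r (qr_KC QR) -mulrA (qr_KK QR) mulr1. Qed.

Lemma weight_KV i j : weight i 1 (Kinv j).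
Proof. by rewrite /weight scale1r K_KV -mulrA (qr_KK QR) mulr1. Qed.

Lemma weightB i c y z : weight i c y -> weight i c z -> weight i c (y - z).
Proof. by rewrite /weight mulrBr mulrBl scalerBr => -> ->. Qed.

Lemma weightZ i c a y : weight i c y -> weight i c (a *: y).
Proof. by rewrite /weight -pzscalerAr -pzscalerAl => ->; rewrite !scalerA mulrC. Qed.

Lemma Uq_adE_weight i c y : weight i c y ->
  Uq_ad true i y = X true i * y - c *: (y * X true i).
Proof. by move=> Hy; rewrite Uq_adE Hy pzscalerAl. Qed.

Lemma ad_same_diag b i : Uq_ad b i (X b i * twist b i i) = 0.
Proof.
rewrite /twist eqxx; case: b; last by rewrite Uq_adF mulr1 subrr mul0r.
have W : weight i (wt true i i) (X true i * Kinv i).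
  by rewrite -[wt _ _ _]mulr1; apply: weightM; [exact: weight_X|exact: weight_KV].
rewrite (Uq_adE_weight W) -[X true i * Kinv i * _]mulrA KV_X -pzscalerAr scalerA.
by rewrite divff ?wt_neq0 // scale1r subrr.
Qed.

Lemma ad_opp_off b i j : i != j -> Uq_ad b i (X (~~ b) j * twist (~~ b) i j) = 0.
Proof.
move=> ij; rewrite /twist (negPf ij); case: b => /=; last first.
  by rewrite Uq_adF mulr1 E_F ?subrr ?mul0r // eq_sym.
have W : weight i (wt false i j) (X false j * K j).
  by rewrite -[wt _ _ _]mulr1; apply: weightM; [exact: weight_X|exact: weight_K].
rewrite (Uq_adE_weight W) -[X false j * K j * _]mulrA K_X -pzscalerAr scalerA.
rewrite -[false]/(~~ true) wt_negb wtC mulVf ?wt_neq0 // scale1r /=.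
by rewrite !mulrA E_F // subrr.
Qed.

Lemma ad_opp_diag b i : iter 3 (Uq_ad b i) (X (~~ b) i * twist (~~ b) i i) = 0.
Proof.
set s := (v i - (v i)^-1)^-1; set H := K i - Kinv i; set W := wt true i i.
have EF : X true i * X false i = X false i * X true i + s *: H.
  by apply/eqP; rewrite addrC -subr_eq (qr_EF QR) eqxx mul1r.
have W0 : W != 0 by exact: wt_neq0.
have WF : wt false i i = W^-1 by rewrite -[false]/(~~ true) wt_negb.
(* one application gives a multiple of the Casimir element up to the torus, two
   give a multiple of the element of the same sign that is annihilated *)
suff [c Hc] : exists c, iter 2 (Uq_ad b i) (X (~~ b) i * twist (~~ b) i i) =
    c *: (X b i * twist b i i).
  by rewrite iterS Hc linear_fZ ?ad_same_diag ?scaler0 //; exact: Uq_ad_linear.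
rewrite /twist !eqxx; set G := X false i * X true i in EF.
have HX c : H * X c i = wt c i i *: (X c i * K i) - (wt c i i)^-1 *: (X c i * Kinv i).
  by rewrite mulrBl K_X KV_X.
have XH c : X c i * H = X c i * K i - X c i * Kinv i by rewrite mulrBr.
case: b => /=.
  rewrite mulr1 (Uq_adE_weight (weight_X i false i)) EF WF -/G.
  have WG : weight i 1 G.
    by rewrite -(mulVf W0) -{1}WF; apply: weightM; exact: weight_X.
  have WH : weight i 1 H by apply: weightB; [exact: weight_K|exact: weight_KV].
  have EG : X true i * G - G * X true i = s *: (H * X true i).
    by rewrite /G mulrA EF -/G mulrDl addrC addKr pzscalerAl.
  have adD := fun x y => @linear_fD _ _ _ _ x y (@Uq_ad_linear true i).
  have adZ := fun c x => @linear_fZ _ _ _ _ c x (@Uq_ad_linear true i).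
  rewrite -scaleNr !adD !adZ (Uq_adE_weight WG) (Uq_adE_weight WH) !scale1r EG.
  exists (s * (W^-1 ^+ 2 - 1)); rewrite -scalerDr [H * _ + _]addrC subrK HX XH -/W.
  rewrite scaleNr scalerA [W^-1 * s]mulrC -scalerA -scalerBr -scalerA; congr (_ *: _).
  rewrite scalerBr !scalerA mulVf // scale1r opprB addrC addrA subrK.
  by rewrite expr2 scalerBl scale1r.
have FG : X false i * G - G * X false i = - (s *: (X false i * H)).
  rewrite /G -!mulrA EF -/G mulrDr opprD addNKr -pzscalerAr; congr (- _).
have adD := fun x y => @linear_fD _ _ _ _ x y (@Uq_ad_linear false i).
have adZ := fun c x => @linear_fZ _ _ _ _ c x (@Uq_ad_linear false i).
have -> : Uq_ad false i (X true i * Kinv i) = G - W *: (G + s *: H).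
  rewrite Uq_adF -EF -[X true i * Kinv i * _]mulrA KV_X WF invrK -pzscalerAr.
  by rewrite mulrBl -pzscalerAl -!mulrA (qr_VK QR) !mulr1.
rewrite -scaleNr !adD !adZ adD adZ !Uq_adF FG HX XH WF invrK.
have : X false i * Kinv i * K i = X false i by rewrite -mulrA (qr_VK QR) mulr1.
rewrite mulr1; move: (X false i * K i) (X false i * Kinv i) => x y yK.
exists (s * (1 - W ^+ 2)); rewrite [in X in _ + X]mulNr [in X in _ + X]mulrBl.
rewrite -[in X in _ + X]pzscalerAl [in X in _ + X]scalerBr addKr scaleNr scalerN opprK.
rewrite mulNr -pzscalerAl scalerA [W * s]mulrC -scalerA -scalerN -scalerDr -scalerA.
congr (_ *: _); rewrite pzscalerAl -mulNr -mulrDl scalerBr !scalerA divff // scale1r.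
by rewrite opprB addrA subrK -expr2 mulrBl -pzscalerAl yK scalerBl scale1r.
Qed.

Lemma adE_word i j n : i != j ->
  iter n (Uq_ad true i) (X true j) =
  qcomm_iter (X true i) (X true j) (sku true i ^+ 2) (wt true i j) n.
Proof.
move=> ij; set w := sku true i ^+ 2; set t := wt true i j.
have W m : weight i (w ^+ m * t) (qcomm_iter (X true i) (X true j) w t m).
  elim: m => [|m IH] /=; first by rewrite expr0 mul1r; exact: weight_X.
  have Wi : weight i w (X true i) by have := weight_X i true i; rewrite /wt eqxx.
  apply: weightB; first by rewrite exprS -mulrA; apply: weightM.
  by apply: weightZ; rewrite exprS -mulrA mulrC; apply: weightM.
by elim: n => // n IH; rewrite iterS IH (Uq_adE_weight (W n)).
Qed.

(** Unlike for E, each application of F leaves a torus factor K_i on the right. *)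
Lemma adF_word i j n : i != j ->
  iter n (Uq_ad false i) (X false j * K j) =
  qcomm_iter (X false i) (X false j) (sku false i ^+ 2) (wt false i j) n * (K j * K i ^+ n).
Proof.
move=> ij; set w := sku false i ^+ 2; set t := wt false i j.
elim: n => [|n IH]; first by rewrite expr0 mulr1.
rewrite iterS IH Uq_adF /=; set Z := qcomm_iter _ _ _ _ n.
have KXn m : K i ^+ m * X false i = w ^+ m *: (X false i * K i ^+ m).
  by apply: qcommute_exprl; rewrite K_X /wt eqxx.
have -> : Z * (K j * K i ^+ n) * X false i = (w ^+ n * t) *: (Z * X false i * (K j * K i ^+ n)).
  rewrite -!mulrA KXn -!pzscalerAr [K j * (X false i * _)]mulrA K_X wtC -/t.
  by rewrite -!pzscalerAl -!pzscalerAr scalerA !mulrA.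
by rewrite mulrA pzscalerAl -mulrBl -!mulrA -exprSr.
Qed.

(** At this length the coefficients of the expansion are those of the quantum Serre
    relation. *)
Lemma qcomm_serre b i j : i != j ->
  qcomm_iter (X b i) (X b j) (sku b i ^+ 2) (wt b i j) (na i j).+1 = 0.
Proof.
move=> ij; rewrite qcomm_iterE -[RHS](qr_serre QR b ij).
apply: eq_bigr => s _; congr (_ *: _); rewrite [(- wt b i j) ^+ s]exprNn -mulrA; congr (_ * _).
have sN : (s <= (na i j).+1)%N by rewrite -ltnS.
rewrite coef_qpoch {1}/wt (negPf ij) !(qnum_fact_sku b).
set u := sku b i; set N := (na i j).+1.
have u0 : u != 0 by exact: sku_neq0.
have nz m : qnum_fact u m != 0 by rewrite -qnum_fact_sku qnum_fact_neq0.
have G := gauss_fact u0 s (N - s); rewrite subnKC // in G.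
apply: (@mulIf _ (qnum_fact u s * qnum_fact u (N - s))); first by rewrite mulf_neq0.
rewrite -!mulrA mulVf ?mulf_neq0 // mulr1 G !mulrA -[RHS]mul1r; congr (_ * _).
have -> : (u^-1 ^+ na i j) ^+ s = u ^- (na i j * s) by rewrite -exprM exprVn.
rewrite -exprM -mulrA -exprD.
have -> : (2 * 'C(s, 2) + s * (N - s) = na i j * s)%N.
  rewrite -mul_bin_diag bin1 -mulnDr mulnC /N.
  by case: (nat_of_ord s) sN => [|s'] sN; rewrite ?muln0 // subSS /= subnKC.
by rewrite mulVf // expf_neq0.
Qed.

Lemma ad_K b i j n :
  iter n (Uq_ad b i) (K j) =
  (\prod_(t < n) (1 - wt b j i * (sku b i ^+ 2) ^+ t)) *: (X b i ^+ n * K j * skgV b i ^+ n).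
Proof.
elim: n => [|n IH]; first by rewrite big_ord0 !expr0 mul1r mulr1 scale1r.
rewrite iterS IH linear_fZ; last exact: Uq_ad_linear.
rewrite big_ord_recr -[in RHS]scalerA; congr (_ *: _).
set w := sku b i ^+ 2.
have wE : wt b i i = w by rewrite /wt eqxx.
case: b {IH} w wE => w wE.
  rewrite /= !expr1n !mulr1.
  have W : weight i (w ^+ n) (X true i ^+ n * K j).
    elim: n => [|n IH]; first by rewrite !expr0 mul1r; exact: weight_K.
    by rewrite !exprS -mulrA -wE; apply: weightM; [exact: weight_X|rewrite wE].
  rewrite (Uq_adE_weight W) -[X true i ^+ n * K j * _]mulrA K_X -pzscalerAr scalerA.
  by rewrite !mulrA -exprSr -exprS [w ^+ n * _]mulrC scalerBl scale1r.
rewrite Uq_adF /=.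
have KXn m : K i ^+ m * X false i = w ^+ m *: (X false i * K i ^+ m).
  by apply: qcommute_exprl; rewrite K_X wE.
rewrite -[X false i ^+ n * K j * _ * X false i]mulrA KXn -pzscalerAr.
rewrite -[X false i ^+ n * K j * (X false i * _)]mulrA [K j * (X false i * _)]mulrA K_X.
rewrite -!pzscalerAl -!pzscalerAr scalerA !mulrA -exprSr -exprS [w ^+ n * _]mulrC.
by rewrite -[X in X - _]scale1r -scalerBl -pzscalerAl -!mulrA -exprSr.
Qed.

(** For equal signs and i <> j this is the Serre relation. For opposite signs and
    i = j the twisted generator is one end of a three-dimensional module, whose other
    end is the twisted generator of the opposite sign. *)
Lemma twisted_nilpotent b b' i j :
  iter (nil_deg b b' i j).+1 (Uq_ad b i) (X b' j * twist b' i j) = 0.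
Proof.
have Eb : b != b' -> b' = ~~ b by case: (b); case: (b').
rewrite /nil_deg; case: (eqVneq b b') Eb => [<- _|_ /(_ isT) ->]; case: (eqVneq i j) => [<-|ij].
- exact: ad_same_diag.
- case: b => /=.
    by rewrite -iterS /twist (negPf ij) mulr1 adE_word // qcomm_serre.
  by rewrite -iterS /twist (negPf ij) adF_word // qcomm_serre // mul0r.
- exact: ad_opp_diag.
- exact: ad_opp_off.
Qed.

Lemma qcommute_exp (x y : A) c : y * x = c *: (x * y) -> forall m,
  exists e, (x * y) ^+ m = c ^+ e *: (x ^+ m * y ^+ m).
Proof.
move=> yx; elim=> [|m [e IH]].
  by exists 0%N; rewrite !expr0 scale1r mulr1.
exists (e + m)%N; rewrite exprS IH -pzscalerAr -mulrA [y * (_ * _)]mulrA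
  (qcommute_expr _ yx).
by rewrite -!pzscalerAl -pzscalerAr scalerA -exprD !exprS !mulrA.
Qed.

Lemma X_twist b' i j : exists2 c, c != 0 &
  twist b' i j * X b' j = c *: (X b' j * twist b' i j).
Proof.
have W : exists2 c : k, c != 0 & 1 * X b' j = c *: (X b' j * 1).
  by exists 1; rewrite ?oner_eq0 // scale1r mulr1 mul1r.
rewrite /twist; case: b' W => W; case: ifP => _ //.
  by exists (wt true j j)^-1; rewrite ?KV_X // invr_eq0 wt_neq0.
by exists (wt false j j); rewrite ?K_X // wt_neq0.
Qed.

End QuantumRelations.

(** * Hopf structure on divided powers *)

Section GenSubalg.
Variables (k : fieldType) (B : pzAlgType k) (C : k -> Prop) (S : B -> Prop).
Local Notation G := (gen_subalg C S).

Lemma gen_subalg0 : G 0.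
Proof. by rewrite -(subrr 1); apply: gen_subalgB; exact: gen_subalg1. Qed.

Lemma gen_subalgD x y : G x -> G y -> G (x + y).
Proof.
move=> Gx Gy; rewrite -[y]opprK; apply: gen_subalgB => //.
by rewrite -[- y]sub0r; apply: gen_subalgB => //; exact: gen_subalg0.
Qed.

Lemma gen_subalgX x n : G x -> G (x ^+ n).
Proof.
move=> Gx; elim: n => [|n IH]; rewrite ?expr0 ?exprS; first exact: gen_subalg1.
exact: gen_subalgM.
Qed.

Lemma gen_subalg_sum (J : Type) (s : seq J) (f : J -> B) :
  (forall j, G (f j)) -> G (\sum_(j <- s) f j).
Proof.
move=> Gf; elim: s => [|j s IH]; rewrite ?big_nil ?big_cons; first exact: gen_subalg0.
exact: gen_subalgD.
Qed.
End GenSubalg.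

Section QuantumHopf.
Variables (k : fieldType) (A : pzAlgType k) (I : eqType).
Variables (v : I -> k) (na : I -> I -> nat).
Variables (X : bool -> I -> A) (K Kinv : I -> A) (D : hopfAlgebra A).
Hypothesis QR : quantum_relations v na X K Kinv.

Local Notation skg := (skg Kinv).
Local Notation skgV := (skgV K).
Local Notation skh := (skh K).
Local Notation skhV := (skhV Kinv).
Local Notation S := (antipode D).

Definition quantum_hopf : Prop := forall i,
  [/\ forall b, comul D (X b i) = hpure (X b i) (skg b i) + hpure (skh b i) (X b i),
      forall b, counit D (X b i) = 0,
      comul D (K i) = hpure (K i) (K i) & counit D (K i) = 1].

Hypothesis QH : quantum_hopf.

Lemma comul_K i : comul D (K i) = hpure (K i) (K i). Proof. by case: (QH i). Qed.
Lemma counit_K i : counit D (K i) = 1. Proof. by case: (QH i). Qed.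
Lemma comul_KV i : comul D (Kinv i) = hpure (Kinv i) (Kinv i).
Proof. by apply: comul_grouplike_inv (comul_K i) _ _; rewrite ?(qr_KK QR) ?(qr_VK QR). Qed.
Lemma counit_KV i : counit D (Kinv i) = 1.
Proof. by apply: counit_grouplike_inv (counit_K i) (qr_KK QR i). Qed.
Lemma antipode_K i : S (K i) = Kinv i.
Proof. by apply: antipode_grouplike (comul_K i) (counit_K i) (qr_KK QR i). Qed.
Lemma antipode_KV i : S (Kinv i) = K i.
Proof. by apply: antipode_grouplike (comul_KV i) (counit_KV i) (qr_VK QR i). Qed.

Lemma comul_skg b i : comul D (skg b i) = hpure (skg b i) (skg b i).
Proof. by case: b; rewrite /= ?comul1 ?comul_KV. Qed.
Lemma comul_skh b i : comul D (skh b i) = hpure (skh b i) (skh b i).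
Proof. by case: b; rewrite /= ?comul1 ?comul_K. Qed.
Lemma counit_skg b i : counit D (skg b i) = 1.
Proof. by case: b; rewrite /= ?counit1 ?counit_KV. Qed.
Lemma counit_skh b i : counit D (skh b i) = 1.
Proof. by case: b; rewrite /= ?counit1 ?counit_K. Qed.

Lemma Ad_l_UqX b i n y : Ad_l D (X b i ^+ n) y = iter n (Uq_ad X K Kinv b i) y.
Proof.
have [dX eX _ _] := QH i.
apply: (Ad_l_skewX (skgg QR b i) (skhh QR b i) (dX b) (comul_skg b i)
  (comul_skh b i) (eX b) (counit_skg b i) (counit_skh b i)).
Qed.

Lemma antipode_UqX b i : S (X b i) = - (skhV b i * X b i * skgV b i).
Proof.
have [dX eX _ _] := QH i.
by apply: (antipode_skew (skgg QR b i) (skhh QR b i) (dX b)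
  (comul_skh b i) (eX b) (counit_skh b i)).
Qed.

Lemma antipode_Ad_l_UqX b i y : S (Ad_l D (X b i) y) = Ad_r D (S (X b i)) (S y).
Proof.
have [dX eX _ _] := QH i.
apply: (antipode_Ad_l_skew (skgg QR b i) (skgVg QR b i) (skhh QR b i) (skhVh QR b i)
  (dX b) (comul_skg b i) (comul_skh b i) (eX b) (counit_skg b i) (counit_skh b i)).
Qed.

Definition divpow b i n : A := (qnum_fact (v i) n)^-1 *: X b i ^+ n.

Lemma divpow0 b i : divpow b i 0 = 1.
Proof. by rewrite /divpow qnum_fact0 invr1 scale1r expr0. Qed.

Lemma divpowM b i m n : divpow b i m * divpow b i n =
  ((v i)^-1 ^+ (m * n) * gauss (v i ^+ 2) (m + n) m) *: divpow b i (m + n).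
Proof.
have nz j := qnum_fact_neq0 QR i j.
rewrite /divpow pzalgM_scale -exprD scalerA; congr (_ *: _).
have /(canRL (mulfK _)) -> := gauss_fact (qr_v_neq0 QR i) m n; last by rewrite mulf_neq0.
rewrite !mulrA -exprMn mulVf ?(qr_v_neq0 QR) // expr1n mul1r mulrAC divff // mul1r.
by rewrite invfM.
Qed.

Lemma comul_divpow b i n : comul D (divpow b i n) =
  \sum_(m < n.+1) (v i)^-1 ^+ (m * (n - m)) *:
     hpure (skh b i ^+ (n - m) * divpow b i m) (skg b i ^+ m * divpow b i (n - m)).
Proof.
have [dX eX _ _] := QH i; have nz j := qnum_fact_neq0 QR i j.
rewrite /divpow linearZ /=.
rewrite (skew_comulX (dX b) (skbe_neq0 QR b i)
  (skhX QR b i) (skgX QR b i) n (sku_neq0 QR b i) (sk_ratio v na b i)).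
rewrite scaler_sumr; apply: eq_bigr => m _.
have mn : (m <= n)%N by rewrite -ltnS.
have hX a e : skh b i ^+ e * X b i ^+ a = skal v na b i ^+ (a * e) *: (X b i ^+ a * skh b i ^+ e).
  by rewrite exprM; apply/qcommute_exprl/qcommute_expr/(skhX QR).
rewrite -pzscalerAr -[in RHS]pzscalerAr hX !hpureZl hpureZr !scalerA; congr (_ *: _).
have G := gauss_fact (sku_neq0 QR b i) m (n - m); rewrite subnKC // in G.
rewrite -!(qnum_fact_sku _ b) in G.
move/(canRL (mulfK (mulf_neq0 (nz m) (nz (n - m)%N)))): G => ->.
have : sku v b i ^+ (m * (n - m)) = (v i)^-1 ^+ (m * (n - m)) * skal v na b i ^+ (m * (n - m)).
  rewrite -exprMn; congr (_ ^+ _); rewrite /sku /skal /wt eqxx; case: b {dX eX hX} => /=.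
    by rewrite expr2 mulrA mulVf ?(qr_v_neq0 QR) // mul1r.
  by rewrite mulr1.
move=> ->; move: (_ ^+ _) (skal _ _ _ _ ^+ _) => a c.
by field; rewrite !nz.
Qed.

Lemma antipode_divpow b i n : exists e, exists2 c, c = (v i) ^+ e \/ c = (v i)^-1 ^+ e &
  S (divpow b i n) = ((-1) ^+ n * c) *: (skhV b i ^+ n * divpow b i n * skgV b i ^+ n).
Proof.
have antX m : S (X b i ^+ m) = S (X b i) ^+ m.
  by elim: m => [|m IH]; rewrite ?antipode1 // exprS antipodeM IH exprSr.
have negX (x : A) m : (- x) ^+ m = (-1) ^+ m *: x ^+ m.
  elim: m => [|m IH]; first by rewrite !expr0 scale1r.
  by rewrite !exprS IH -pzscalerAr [- x * _]mulNr -[- (x * _)]scaleN1r scalerA mulrC.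
have [c Hc [e He]] : exists2 c, c = v i ^+ 2 \/ c = (v i)^-1 ^+ 2 & exists e,
    (skhV b i * X b i * skgV b i) ^+ n = c ^+ e *: (skhV b i ^+ n * X b i ^+ n * skgV b i ^+ n).
  case: (b) => /=.
    have := X_K QR true i i; have := KV_X QR true i i; rewrite /wt eqxx => E1 _.
    exists (v i ^+ 2); first by left.
    have E2 : X true i * Kinv i = v i ^+ 2 *: (Kinv i * X true i).
      by rewrite E1 scalerA divff ?scale1r // expf_neq0 // (qr_v_neq0 QR).
    have [e He] := qcommute_exp E2 n.
    by exists e; rewrite mulr1 He expr1n mulr1.
  have := K_X QR false i i; rewrite /wt eqxx => E1.
  exists ((v i)^-1 ^+ 2); first by right.
  have [e He] := qcommute_exp E1 n.
  by exists e; rewrite mul1r He expr1n mul1r.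
exists (2 * e)%N, (c ^+ e).
  by case: Hc => ->; [left|right]; rewrite -exprM.
rewrite /divpow linearZ /= antX antipode_UqX negX He !scalerA -pzscalerAr -pzscalerAl scalerA.
by congr (_ *: _); rewrite [RHS]mulrC mulrA.
Qed.

End QuantumHopf.

(** * Specialization of Hopf algebras *)

Section Reduction.
Variables (F k : fieldType) (A : pzAlgType F) (B : pzAlgType k).
Variables (spec : F -> k -> Prop) (red : A -> B -> Prop) (gens : A -> Prop).

(** B is the specialization, along a ring morphism with graph spec, of the
    subring of A generated by gens over the domain of that morphism; red is the
    graph of the specialization map. *)
Record specialization : Prop := Specialization {
  spec1 : spec 1 1;
  specB : forall x y c d, spec x c -> spec y d -> spec (x - y) (c - d);
  specM : forall x y c d, spec x c -> spec y d -> spec (x * y) (c * d);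
  red_fun : forall u x y, red u x -> red u y -> x = y;
  red1 : red 1 1;
  redD : forall u u' x x', red u x -> red u' x' -> red (u + u') (x + x');
  redM : forall u u' x x', red u x -> red u' x' -> red (u * u') (x * x');
  redZ : forall c d u x, spec c d -> red u x -> red (c *: u) (d *: x);
  red_gens : forall u, gens u -> exists x, red u x;
  red_ind : forall Q : A -> Prop, Q 1 ->
    (forall u u', Q u -> Q u' -> Q (u - u')) ->
    (forall u u', Q u -> Q u' -> Q (u * u')) ->
    (forall c d u, spec c d -> Q u -> Q (c *: u)) ->
    (forall u, gens u -> Q u) -> forall u x, red u x -> Q u;
  red_span : forall Q : B -> Prop, lin_closed Q ->
    (forall u x, red u x -> Q x) -> forall x, Q x
}.

Hypothesis SP : specialization.

Lemma specX x c n : spec x c -> spec (x ^+ n) (c ^+ n).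
Proof.
move=> xc; elim: n => [|n IH]; rewrite ?expr0 ?exprS; first exact: (spec1 SP).
exact: (specM SP).
Qed.

Lemma spec0 : spec 0 0.
Proof. by have := specB SP (spec1 SP) (spec1 SP); rewrite !subrr. Qed.

Lemma specN1 : spec (-1) (-1).
Proof. by have := specB SP spec0 (spec1 SP); rewrite !sub0r. Qed.

Lemma specD x y c d : spec x c -> spec y d -> spec (x + y) (c + d).
Proof.
move=> xc yd; rewrite -[y]opprK -[d]opprK; apply: (specB SP) => //.
by rewrite -[- y]sub0r -[- d]sub0r; apply: (specB SP) => //; exact: spec0.
Qed.

Lemma spec_gauss x c n m : spec x c -> spec (gauss x n m) (gauss c n m).
Proof.
move=> xc; elim: n m => [|n IH] [|m] /=; try exact: (spec1 SP); first exact: spec0.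
by apply: specD => //; apply: (specM SP) => //; exact: (specX _ xc).
Qed.

Lemma red0 : red 0 0.
Proof. by have := redZ SP spec0 (red1 SP); rewrite !scale0r. Qed.

Lemma redX u x n : red u x -> red (u ^+ n) (x ^+ n).
Proof.
move=> ux; elim: n => [|n IH]; rewrite ?expr0 ?exprS; first exact: (red1 SP).
exact: (redM SP).
Qed.

Lemma redB u u' x x' : red u x -> red u' x' -> red (u - u') (x - x').
Proof.
move=> ux ux'; rewrite -[- u']scaleN1r -[- x']scaleN1r; apply: (redD SP) => //.
by apply: (redZ SP) => //; exact: specN1.
Qed.

(** Integral tensors come with an explicit decomposition because the coproduct of
    U_zeta is prescribed in terms of such decompositions only. *)
Definition red2 (T : tens A A) (T' : tens B B) : Prop :=
  exists s : seq ((A * B) * (A * B)),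
    [/\ forall t, List.In t s -> red t.1.1 t.1.2 /\ red t.2.1 t.2.2,
      T = \sum_(t <- s) hpure t.1.1 t.2.1 & T' = \sum_(t <- s) hpure t.1.2 t.2.2].

Lemma red2_pure u x u' x' : red u x -> red u' x' -> red2 (hpure u u') (hpure x x').
Proof.
move=> ux ux'; exists [:: ((u, x), (u', x'))]; rewrite !big_seq1; split=> // t.
by case=> // <-.
Qed.

Lemma red2D T U T' U' : red2 T T' -> red2 U U' -> red2 (T + U) (T' + U').
Proof.
move=> [s [Hs -> ->]] [s' [Hs' -> ->]]; exists (s ++ s'); rewrite !big_cat; split=> // t.
by move=> /(List.in_app_or s s') []; [exact: Hs | exact: Hs'].
Qed.

Lemma red20 : red2 0 0.
Proof. by exists [::]; rewrite !big_nil; split. Qed.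

Lemma red2Z c d T T' : spec c d -> red2 T T' -> red2 (c *: T) (d *: T').
Proof.
move=> cd [s [+ -> ->]]; elim: s => [|t s IH] Hs.
  by rewrite !big_nil !scaler0; exact: red20.
rewrite !big_cons !scalerDr -!hpureZl; apply: red2D; last by apply: IH => t' ?; apply: Hs; right.
by have [? ?] := Hs t (or_introl erefl); apply: red2_pure => //; exact: (redZ SP).
Qed.

Lemma red2_sum (n : nat) (G : 'I_n -> tens A A) (G' : 'I_n -> tens B B) :
  (forall i, red2 (G i) (G' i)) -> red2 (\sum_(i < n) G i) (\sum_(i < n) G' i).
Proof.
elim: n G G' => [|n IH] G G' GG; first by rewrite !big_ord0; exact: red20.
by rewrite !big_ord_recl; apply: red2D => //; exact: IH.
Qed.

Lemma red2M T U T' U' : red2 T T' -> red2 U U' -> red2 (tmul T U) (tmul T' U').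
Proof.
move=> [s [+ -> ->]] HU; elim: s => [|t s IH] Hs.
  by rewrite !big_nil !tmul0l; exact: red20.
rewrite !big_cons !tmulDl; apply: red2D; last by apply: IH => t' ?; apply: Hs; right.
have [r1 r2] := Hs t (or_introl erefl) => {IH Hs}.
case: HU => [s' [+ -> ->]]; elim: s' => [|t' s' IH] Hs.
  by rewrite !big_nil !tmul0r; exact: red20.
rewrite !big_cons !tmulDr; apply: red2D; last by apply: IH => ? ?; apply: Hs; right.
have [r3 r4] := Hs t' (or_introl erefl); rewrite !tmul_pure.
by apply: red2_pure; exact: (redM SP).
Qed.

Variables (DA : hopfAlgebra A) (DB : hopfAlgebra B).

Record hopf_specialization : Prop := HopfSpecialization {
  red_comul : forall u x T, red u x -> red2 (comul DA u) T -> comul DB x = T;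
  red_antipode : forall u x y, red u x -> red (antipode DA u) y -> antipode DB x = y;
  comul_gens : forall u, gens u -> exists T, red2 (comul DA u) T;
  antipode_gens : forall u, gens u -> exists x, red (antipode DA u) x
}.

Hypothesis HS : hopf_specialization.

Lemma red2_comul u x : red u x -> red2 (comul DA u) (comul DB x).
Proof.
move=> ux; suff [T uT] : exists T, red2 (comul DA u) T.
  by rewrite (red_comul HS ux uT).
move: u x ux; apply: (red_ind SP) => [|u1 u2 [T1 H1] [T2 H2]|u1 u2 [T1 H1] [T2 H2]|c d u1 cd [T H]|].
- by exists (hpure 1 1); rewrite comul1; apply: red2_pure; exact: (red1 SP).
- exists (T1 + -1 *: T2); rewrite linearB /= -[- comul _ _]scaleN1r.
  by apply: red2D => //; apply: red2Z => //; exact: specN1.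
- by exists (tmul T1 T2); rewrite comulM; exact: red2M.
- by exists (d *: T); rewrite linearZ; exact: red2Z.
- exact: (comul_gens HS).
Qed.

Lemma red_antipodeE u x : red u x -> red (antipode DA u) (antipode DB x).
Proof.
move=> ux; suff [y uy] : exists y, red (antipode DA u) y.
  by rewrite (red_antipode HS ux uy).
move: u x ux; apply: (red_ind SP) => [|u1 u2 [x1 H1] [x2 H2]|u1 u2 [x1 H1] [x2 H2]|c d u1 cd [y H]|].
- by exists 1; rewrite antipode1; exact: (red1 SP).
- by exists (x1 - x2); rewrite linearB; exact: redB.
- by exists (x2 * x1); rewrite antipodeM; exact: (redM SP).
- by exists (d *: y); rewrite linearZ; exact: (redZ SP).
- exact: (antipode_gens HS).
Qed.

Lemma red_Ad_l u x a y : red u x -> red a y -> red (Ad_l DA u a) (Ad_l DB x y).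
Proof.
move=> ux ay; have [s [Hs EA EB]] := red2_comul ux.
rewrite /Ad_l EA EB !tlift_sum_pure; [|exact: Ad_l_bilinear..].
elim: s Hs {EA EB} => [|t s IH] Hs; first by rewrite !big_nil; exact: red0.
rewrite !big_cons; apply: (redD SP); last by apply: IH => t' ?; apply: Hs; right.
have [r1 r2] := Hs t (or_introl erefl).
by apply: (redM SP); [exact: (redM SP)|exact: red_antipodeE].
Qed.

Lemma red_Ad_r u x a y : red u x -> red a y -> red (Ad_r DA u a) (Ad_r DB x y).
Proof.
move=> ux ay; have [s [Hs EA EB]] := red2_comul ux.
rewrite /Ad_r EA EB !tlift_sum_pure; [|exact: Ad_r_bilinear..].
elim: s Hs {EA EB} => [|t s IH] Hs; first by rewrite !big_nil; exact: red0.
rewrite !big_cons; apply: (redD SP); last by apply: IH => t' ?; apply: Hs; right.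
have [r1 r2] := Hs t (or_introl erefl).
by apply: (redM SP) => //; apply: (redM SP) => //; exact: red_antipodeE.
Qed.

End Reduction.

(** * Normality of the Frobenius-Lusztig kernels *)

Section FrobeniusKernels.
Variables (F k : fieldType) (A : pzAlgType F) (B : pzAlgType k) (I : eqType).
Variables (v : I -> F) (na : I -> I -> nat).
Variables (X : bool -> I -> A) (K Kinv : I -> A).
Hypothesis QR : quantum_relations v na X K Kinv.
Variables (DA : hopfAlgebra A) (DB : hopfAlgebra B).
Hypothesis QH : quantum_hopf X K Kinv DA.

Local Notation divp := (divpow v X).

Variant int_gen : A -> Prop :=
| int_K i : int_gen (K i)
| int_KV i : int_gen (Kinv i)
| int_div b i n : int_gen (divp b i n).

Variables (spec : F -> k -> Prop) (red : A -> B -> Prop).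
Hypothesis SP : specialization spec red int_gen.
Hypothesis red_comul : forall u x T, red u x -> red2 red (comul DA u) T -> comul DB x = T.
Hypothesis red_antipode :
  forall u x y, red u x -> red (antipode DA u) y -> antipode DB x = y.

Variables (vz : I -> k) (KB KVB : I -> B) (SB : bool -> I -> nat -> B).
Hypothesis spec_v : forall i, spec (v i) (vz i).
Hypothesis spec_vV : forall i, spec (v i)^-1 (vz i)^-1.
Hypothesis red_K : forall i, red (K i) (KB i).
Hypothesis red_KV : forall i, red (Kinv i) (KVB i).
Hypothesis red_div : forall b i n, red (divp b i n) (SB b i n).

Lemma skg_red b i : red (skg Kinv b i) (skg KVB b i).
Proof. by case: b; [exact: (red1 SP)|exact: red_KV]. Qed.
Lemma skgV_red b i : red (skgV K b i) (skgV KB b i).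
Proof. by case: b; [exact: (red1 SP)|exact: red_K]. Qed.
Lemma skh_red b i : red (skh K b i) (skh KB b i).
Proof. by case: b; [exact: red_K|exact: (red1 SP)]. Qed.
Lemma skhV_red b i : red (skhV Kinv b i) (skhV KVB b i).
Proof. by case: b; [exact: red_KV|exact: (red1 SP)]. Qed.

Lemma KB_KVB i : KB i * KVB i = 1.
Proof.
by apply: (red_fun SP _ (red1 SP)); rewrite -(qr_KK QR i); exact: (redM SP).
Qed.

Lemma KVB_KB i : KVB i * KB i = 1.
Proof.
by apply: (red_fun SP _ (red1 SP)); rewrite -(qr_VK QR i); exact: (redM SP).
Qed.

Lemma red2_divpow b i n :
  red2 red (comul DA (divp b i n))
    (\sum_(m < n.+1) (vz i)^-1 ^+ (m * (n - m)) *: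
     hpure (skh KB b i ^+ (n - m) * SB b i m) (skg KVB b i ^+ m * SB b i (n - m))).
Proof.
rewrite (comul_divpow QR QH); apply: red2_sum => m.
apply: (red2Z SP); first exact: (specX SP).
by apply: red2_pure; apply: (redM SP) => //; apply: (redX SP);
  [exact: skh_red|exact: skg_red].
Qed.

Lemma antipode_divpow_red b i n : exists2 c, c = vz i \/ c = (vz i)^-1 & exists e,
  red (antipode DA (divp b i n))
   (((-1) ^+ n * c ^+ e) *: (skhV KVB b i ^+ n * SB b i n * skgV KB b i ^+ n)).
Proof.
have [e [c Hc ->]] := antipode_divpow QR QH b i n.
have R : red (skhV Kinv b i ^+ n * divp b i n * skgV K b i ^+ n)
   (skhV KVB b i ^+ n * SB b i n * skgV KB b i ^+ n).
  by apply: (redM SP); [apply: (redM SP) => //|]; apply: (redX SP);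
    [exact: skhV_red|exact: skgV_red].
have sgn : spec ((-1) ^+ n) ((-1) ^+ n) by apply: (specX SP); exact: (specN1 SP).
by case: Hc => ->; [exists (vz i)|exists (vz i)^-1]; [left| |right|] => //; exists e;
  apply: (redZ SP) => //; apply: (specM SP) => //; apply: (specX SP).
Qed.

Lemma int_hopf_specialization : hopf_specialization red int_gen DA DB.
Proof.
split=> // u [i|i|b i n].
- by exists (hpure (KB i) (KB i)); rewrite (comul_K QH); exact: red2_pure.
- by exists (hpure (KVB i) (KVB i)); rewrite (comul_KV QR QH); exact: red2_pure.
- by eexists; exact: red2_divpow.
- by exists (KVB i); rewrite (antipode_K QR QH).
- by exists (KB i); rewrite (antipode_KV QR QH).
- by have [c _ [e He]] := antipode_divpow_red b i n; eexists; exact: He.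
Qed.

Let HS := int_hopf_specialization.

Lemma comul_SB b i n : comul DB (SB b i n) =
  \sum_(m < n.+1) (vz i)^-1 ^+ (m * (n - m)) *:
     hpure (skh KB b i ^+ (n - m) * SB b i m) (skg KVB b i ^+ m * SB b i (n - m)).
Proof. exact: (red_comul (red_div b i n) (red2_divpow b i n)). Qed.

Lemma comul_KB i : comul DB (KB i) = hpure (KB i) (KB i).
Proof. by apply: (red_comul (red_K i)); rewrite (comul_K QH); exact: red2_pure. Qed.

Lemma comul_KVB i : comul DB (KVB i) = hpure (KVB i) (KVB i).
Proof. by apply: (red_comul (red_KV i)); rewrite (comul_KV QR QH); exact: red2_pure. Qed.

Lemma antipode_KB i : antipode DB (KB i) = KVB i.
Proof. by apply: (red_antipode (red_K i)); rewrite (antipode_K QR QH). Qed.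

Lemma antipode_KVB i : antipode DB (KVB i) = KB i.
Proof. by apply: (red_antipode (red_KV i)); rewrite (antipode_KV QR QH). Qed.

Lemma SB0 b i : SB b i 0 = 1.
Proof. by apply: (red_fun SP (red_div b i 0)); rewrite divpow0; exact: (red1 SP). Qed.

Lemma SBM b i m n : SB b i m * SB b i n =
  ((vz i)^-1 ^+ (m * n) * gauss (vz i ^+ 2) (m + n) m) *: SB b i (m + n).
Proof.
apply: (red_fun SP (redM SP (red_div b i m) (red_div b i n))).
rewrite (divpowM QR); apply: (redZ SP) => //.
by apply: (specM SP); [exact: (specX SP)|apply: (spec_gauss SP); exact: (specX SP)].
Qed.

Lemma B_ind (Q : B -> Prop) : lin_closed Q -> Q 1 ->
  (forall x y, Q x -> Q y -> Q (x * y)) ->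
  (forall i, Q (KB i)) -> (forall i, Q (KVB i)) -> (forall b i n, Q (SB b i n)) ->
  forall x, Q x.
Proof.
move=> [Q0 Qlin] Q1 QM QK QKV QS; apply: (red_span SP) => // u x ux.
suff [y uy Qy] : exists2 y, red u y & Q y by rewrite (red_fun SP ux uy).
move: u x ux; apply: (red_ind SP) =>
  [|u u' [y uy Qy] [y' uy' Qy']|u u' [y uy Qy] [y' uy' Qy']|c d u cd [y uy Qy]|u [i|i|b i n]].
- by exists 1; [exact: (red1 SP)|].
- exists (y - y'); first exact: (redB SP).
  by rewrite addrC -scaleN1r; exact: Qlin.
- by exists (y * y'); [exact: (redM SP)|exact: QM].
- by exists (d *: y); [exact: (redZ SP)|rewrite -[_ *: _]addr0; exact: Qlin].
- by exists (KB i).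
- by exists (KVB i).
- by exists (SB b i n).
Qed.

Variables (p l r : nat).
Hypotheses (odd_l : odd l) (prim_w : forall i, l.-primitive_root (vz i ^+ 2)).
Hypothesis vz_l : forall i, vz i ^+ l = 1.
Hypothesis KB_l : forall i, KB i ^+ l = 1.
Hypothesis p_char : (0 < r -> p \in [pchar k])%N.

(** c is so small that no divided power of exponent at most c m, with m one of
    the exponents of the generators of U_zeta(G_r), leaves U_zeta(G_r). *)
Definition small_deg (c : nat) : Prop :=
  ((c < l)%N \/ l = 1%N /\ forall m, (0 < m <= c)%N -> m%:R != 0 :> k) /\ (0 < r -> c < p)%N.

Hypothesis nil_deg_small : forall b b' i j, small_deg (nil_deg na b b' i j).

Variant small_gen : B -> Prop :=
| small_X b i : small_gen (SB b i 1)
| small_Xdiv b i m : (m < r)%N -> small_gen (SB b i (p ^ m * l))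
| small_K i : small_gen (KB i).

Local Notation N := (gen_subalg (fun _ : k => True) small_gen).

Lemma l_gt0 : (0 < l)%N. Proof. by case: l odd_l. Qed.

Lemma vz_neq0 i : vz i != 0.
Proof.
apply/eqP => v0; have := vz_l i; rewrite v0 expr0n (negPf (lt0n_neq0 l_gt0)).
by move=> /esym/eqP; rewrite oner_eq0.
Qed.

Lemma N_lin : lin_closed N.
Proof.
split=> [|c x y Nx Ny]; first exact: gen_subalg0.
by apply: gen_subalgD => //; apply: gen_subalgZ.
Qed.

Lemma N_K i : N (KB i). Proof. by apply: gen_subalg_in; constructor. Qed.

Lemma N_KV i : N (KVB i).
Proof.
have -> : KVB i = KB i ^+ l.-1; last by apply: gen_subalgX; exact: N_K.
by rewrite -[RHS]mul1r -(KVB_KB i) -mulrA -exprS prednK ?l_gt0 // KB_l mulr1.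
Qed.

Lemma N_skg b i : N (skg KVB b i).
Proof. by case: b; [exact: gen_subalg1|exact: N_KV]. Qed.
Lemma N_skgV b i : N (skgV KB b i).
Proof. by case: b; [exact: gen_subalg1|exact: N_K]. Qed.
Lemma N_skh b i : N (skh KB b i).
Proof. by case: b; [exact: N_K|exact: gen_subalg1]. Qed.
Lemma N_skhV b i : N (skhV KVB b i).
Proof. by case: b; [exact: N_KV|exact: gen_subalg1]. Qed.

Lemma N_SB_add b i m n : gauss (vz i ^+ 2) (m + n) m != 0 ->
  N (SB b i m) -> N (SB b i n) -> N (SB b i (m + n)).
Proof.
move=> g0 Nm Nn; set c := (vz i)^-1 ^+ (m * n) * gauss (vz i ^+ 2) (m + n) m.
have c0 : c != 0 by rewrite mulf_neq0 // expf_neq0 // invr_eq0 vz_neq0.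
have -> : SB b i (m + n) = c^-1 *: (SB b i m * SB b i n).
  by rewrite SBM scalerA mulVf // scale1r.
by apply: gen_subalgZ => //; exact: gen_subalgM.
Qed.

Lemma N_SB_chain b i n : (forall m, (0 < m <= n)%N -> gauss (vz i ^+ 2) m 1 != 0) ->
  N (SB b i n).
Proof.
elim: n => [|n IH] Hn; first by rewrite SB0; exact: gen_subalg1.
rewrite -add1n; apply: N_SB_add; first by rewrite add1n; apply: Hn; rewrite leqnn.
  by apply: gen_subalg_in; constructor.
by apply: IH => m /andP [m0 mn]; apply: Hn; rewrite m0 leqW.
Qed.

Lemma gauss1_geom (w : k) n : (w - 1) * gauss w n 1 = w ^+ n - 1.
Proof.
elim: n => [|n IH]; first by rewrite expr0 subrr mulr0.
by rewrite gaussS gauss0r expr1 mulrDr mulr1 mulrCA IH exprS; ring.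
Qed.

(** The quantum factorial of n is invertible for n < l. *)
Lemma N_SB_lt_l b i n : (n < l)%N -> N (SB b i n).
Proof.
move=> nl; apply: N_SB_chain => m /andP [m0 mn].
apply: contraTneq (leq_ltn_trans mn nl) => g0; rewrite -leqNgt.
have := gauss1_geom (vz i ^+ 2) m; rewrite g0 mulr0 => /esym/eqP.
by rewrite subr_eq0 -(prim_order_dvd (prim_w i)) => /dvdn_leq; apply.
Qed.

(** Below l p^t the divided powers are obtained digit by digit: removing one unit of
    the leading digit costs a Gaussian binomial that equals that digit up to a unit. *)
Lemma N_SB_lt b i t n : (t <= r)%N -> (n < l * p ^ t)%N -> N (SB b i n).
Proof.
elim: t n => [|t IH] n tr; first by rewrite muln1; exact: N_SB_lt_l.
have p_pr : prime p by apply: (pcharf_prime (p_char (leq_ltn_trans (leq0n _) tr))).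
have M0 : (0 < l * p ^ t)%N by rewrite muln_gt0 l_gt0 expn_gt0 prime_gt0.
rewrite expnSr mulnA mulnC => nM; rewrite (divn_eq n (l * p ^ t)).
have : (n %/ (l * p ^ t) < p)%N by rewrite ltn_divLR.
have := ltn_pmod n M0; move: (n %/ _)%N (n %% _)%N => c a aM {nM}.
elim: c => [|c IHc] cp; first by rewrite mul0n add0n; exact: (IH _ (ltnW tr) aM).
rewrite mulSn -addnA; apply: N_SB_add; last exact: (IHc (ltnW cp)).
  rewrite addnA -mulSn; apply: (gauss_neq0 (prim_w i) odd_l _ aM).
    by move=> _; apply: p_char; exact: leq_ltn_trans tr.
  rewrite -(dvdn_pcharf (p_char (leq_ltn_trans (leq0n _) tr))).
  by apply/negP => /(dvdn_leq (ltn0Sn _)); rewrite leqNgt cp.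
by rewrite mulnC; apply: gen_subalg_in; constructor.
Qed.

Lemma N_SB_small b i c m n : small_deg c -> m = 1%N \/ (exists2 t, (t < r)%N & m = (p ^ t * l)%N) ->
  (n <= c * m)%N -> N (SB b i n).
Proof.
move=> [c_l c_p] [->|[t tr ->]] nc.
  rewrite muln1 in nc; case: c_l => [cl|[l1 c_nz]].
    by apply: N_SB_lt_l; exact: leq_ltn_trans cl.
  apply: N_SB_chain => j /andP [j0 jn].
  have -> : vz i ^+ 2 = 1 by have := prim_expr_order (prim_w i); rewrite {1}l1 expr1.
  have -> : gauss (1 : k) j 1 = j%:R.
    elim: j {j0 jn} => // j IHj.
    by rewrite gaussS gauss0r expr1n mul1r IHj -natr1 addrC.
  by apply: c_nz; rewrite j0; exact: leq_trans nc.
apply: (N_SB_lt b i tr); apply: leq_ltn_trans nc _.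
have cp : (c < p)%N by apply: c_p; exact: leq_ltn_trans tr.
have M0 : (0 < p ^ t * l)%N by rewrite muln_gt0 l_gt0 expn_gt0 (leq_ltn_trans _ cp).
by rewrite [X in (_ < X)%N]mulnC expnS -mulnA ltn_pmul2r.
Qed.

Lemma antipode_SB b i n : exists2 c, c != 0 &
  antipode DB (SB b i n) = c *: (skhV KVB b i ^+ n * SB b i n * skgV KB b i ^+ n).
Proof.
have [c Hc [e He]] := antipode_divpow_red b i n.
exists ((-1) ^+ n * c ^+ e); last exact: (red_antipode (red_div b i n) He).
rewrite mulf_neq0 ?signr_eq0 // expf_neq0 //.
by case: Hc => ->; rewrite ?invr_eq0 vz_neq0.
Qed.

Lemma N_antipode x : N x -> N (antipode DB x).
Proof.
elim=> {x} [x [b i|b i m mr|i]||x y _ Nx _ Ny|x y _ Nx _ Ny|c x _ _ Nx].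
- have [c _ ->] := antipode_SB b i 1; apply: gen_subalgZ => //.
  by apply: gen_subalgM; [apply: gen_subalgM|]; rewrite ?expr1;
    [exact: N_skhV|apply: gen_subalg_in; constructor|exact: N_skgV].
- have [c _ ->] := antipode_SB b i (p ^ m * l); apply: gen_subalgZ => //.
  by apply: gen_subalgM; [apply: gen_subalgM|];
    [apply: gen_subalgX; exact: N_skhV|apply: gen_subalg_in; constructor|apply: gen_subalgX; exact: N_skgV].
- by rewrite antipode_KB; exact: N_KV.
- by rewrite antipode1; exact: gen_subalg1.
- by rewrite linearB; exact: gen_subalgB.
- by rewrite antipodeM; exact: gen_subalgM.
- by rewrite linearZ; apply: gen_subalgZ.
Qed.

Lemma Ad_l_K i a : Ad_l DB (KB i) a = KB i * a * KVB i.
Proof.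
by rewrite /Ad_l comul_KB /hpure tlift_pure ?antipode_KB //; exact: (Ad_l_bilinear DB).
Qed.

Lemma Ad_l_KV i a : Ad_l DB (KVB i) a = KVB i * a * KB i.
Proof.
by rewrite /Ad_l comul_KVB /hpure tlift_pure ?antipode_KVB //; exact: (Ad_l_bilinear DB).
Qed.

Lemma N_Ad_K i a : N a -> N (Ad_l DB (KB i) a).
Proof.
by move=> Na; rewrite Ad_l_K; apply: gen_subalgM; [apply: gen_subalgM => //; exact: N_K|exact: N_KV].
Qed.

Lemma N_Ad_KV i a : N a -> N (Ad_l DB (KVB i) a).
Proof.
by move=> Na; rewrite Ad_l_KV; apply: gen_subalgM; [apply: gen_subalgM => //; exact: N_KV|exact: N_K].
Qed.

Lemma N_Ad_torus x n a : (forall a, N a -> N (Ad_l DB x a)) -> N a -> N (Ad_l DB (x ^+ n) a).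
Proof.
move=> Nx Na; elim: n => [|n IH]; first by rewrite expr0 Ad_l_unit.
by rewrite exprS Ad_lM; exact: Nx.
Qed.

Lemma N_Ad_skh b i a : N a -> N (Ad_l DB (skh KB b i) a).
Proof. by case: b => Na; rewrite /= ?Ad_l_unit //; exact: N_Ad_K. Qed.

Lemma N_Ad_skg b i a : N a -> N (Ad_l DB (skg KVB b i) a).
Proof. by case: b => Na; rewrite /= ?Ad_l_unit //; exact: N_Ad_KV. Qed.

Section Action.
Variables (b : bool) (i : I).

(** The coproduct of X^(n) involves only X^(a) with a <= n and the torus. *)
Lemma N_Ad_SB_inner n a : (forall m, (m <= n)%N -> N (SB b i m)) -> N a ->
  N (Ad_l DB (SB b i n) a).
Proof.
move=> NS Na; rewrite /Ad_l comul_SB tlift_sum; last exact: (Ad_l_bilinear DB).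
apply: gen_subalg_sum => m; rewrite tliftZ; last exact: (Ad_l_bilinear DB).
apply: gen_subalgZ => //; rewrite /hpure tlift_pure; last exact: (Ad_l_bilinear DB).
have mn : (m <= n)%N by rewrite -ltnS.
apply: gen_subalgM; last apply: N_antipode.
  apply: gen_subalgM => //; apply: gen_subalgM; last exact: NS.
  by apply: gen_subalgX; exact: N_skh.
by apply: gen_subalgM; [apply: gen_subalgX; exact: N_skg|apply/NS/leq_subr].
Qed.

Definition Ad_stable (a : B) : Prop := forall n, N (Ad_l DB (SB b i n) a).

Lemma Ad_stableM x y : Ad_stable x -> Ad_stable y -> Ad_stable (x * y).
Proof.
move=> Sx Sy n; rewrite Ad_l_mul comul_SB.
have bf : bilinear_map (fun u w => Ad_l DB u x * Ad_l DB w y).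
  split=> [c u u' w|c u w w']; rewrite Ad_l_linearl.
    by rewrite mulrDl pzscalerAl.
  by rewrite mulrDr pzscalerAr.
rewrite tlift_sum //; apply: gen_subalg_sum => m; rewrite tliftZ //.
apply: gen_subalgZ => //; rewrite /hpure tlift_pure // !Ad_lM.
apply: gen_subalgM; apply: N_Ad_torus => //; [exact: N_Ad_skh|exact: N_Ad_skg].
Qed.

Lemma Ad_stable_lin : lin_closed Ad_stable.
Proof.
split=> [n|c x y Sx Sy n]; first by rewrite (linear_f0 (Ad_l_linear DB _)); exact: gen_subalg0.
by rewrite (Ad_l_linear DB); apply: N_lin.2.
Qed.

Lemma Ad_stable1 : Ad_stable 1.
Proof. by move=> n; rewrite Ad_l1; apply: gen_subalgZ => //; exact: gen_subalg1. Qed.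

Lemma Ad_stableX x n : Ad_stable x -> Ad_stable (x ^+ n).
Proof.
move=> Sx; elim: n => [|n IH]; rewrite ?expr0 ?exprS; first exact: Ad_stable1.
exact: Ad_stableM.
Qed.

(** The inverse of x is a power of w with exponent below l. *)
Lemma prod_root_eq0 (x w : k) n : l.-primitive_root w -> x ^+ l = 1 -> (l <= n)%N ->
  \prod_(t < n) (1 - x * w ^+ t) = 0.
Proof.
move=> pw xl ln; have x0 : x != 0.
  apply/eqP => x0; move: xl; rewrite x0 expr0n (negPf (lt0n_neq0 l_gt0)).
  by move=> /esym/eqP; rewrite oner_eq0.
have [|t tE] := @prim_rootP _ _ _ pw x^-1; first by rewrite exprVn xl invr1.
rewrite (bigD1 (widen_ord ln t)) //= -tE divff // subrr mul0r //.
Qed.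

Lemma sku_prim b' j : l.-primitive_root (sku vz b' j ^+ 2).
Proof.
case: b'; first exact: prim_w.
rewrite exprVn.
have -> : (vz j ^+ 2)^-1 = (vz j ^+ 2) ^+ l.-1.
  apply: (@mulfI _ (vz j ^+ 2)); first by rewrite expf_neq0 // vz_neq0.
  by rewrite divff ?expf_neq0 ?vz_neq0 // -exprS prednK ?l_gt0 // (prim_expr_order (prim_w j)).
by rewrite prim_root_exp_coprime // coprimePn // l_gt0.
Qed.

Lemma sku_l b' j : sku vz b' j ^+ l = 1.
Proof. by case: b'; rewrite /sku ?exprVn vz_l ?invr1. Qed.

Lemma spec_sku b' j : spec (sku v b' j) (sku vz b' j).
Proof. by case: b'; rewrite /sku. Qed.

Lemma spec_wt b' j j' : spec (wt v na b' j j') (wt vz na b' j j').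
Proof.
rewrite /wt; case: ifP => _; apply: (specX SP); first exact: spec_sku.
by case: b'; rewrite /sku ?invrK.
Qed.

Lemma Ad_SB_K j n : Ad_l DB (SB b i n) (KB j) =
  (\prod_(t < n) (1 - wt vz na b j i * (sku vz b i ^+ 2) ^+ t)) *:
    (SB b i n * KB j * skgV KB b i ^+ n).
Proof.
apply: (red_fun SP (red_Ad_l SP HS (red_div b i n) (red_K j))).
rewrite {1}/divpow (linear_fZ _ _ (Ad_l_linearl DA _)) (Ad_l_UqX QR QH) (ad_K QR).
rewrite scalerA mulrC -scalerA; apply: (redZ SP).
  have : forall m, spec (\prod_(t < m) (1 - wt v na b j i * (sku v b i ^+ 2) ^+ t))
     (\prod_(t < m) (1 - wt vz na b j i * (sku vz b i ^+ 2) ^+ t)).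
    elim=> [|m IH]; rewrite ?big_ord0 ?big_ord_recr /=; first exact: (spec1 SP).
    apply: (specM SP) => //; apply: (specB SP); first exact: (spec1 SP).
    by apply: (specM SP); [exact: spec_wt|do 2 apply: (specX SP); exact: spec_sku].
  exact.
rewrite pzscalerAl pzscalerAl; apply: (redM SP); last by apply: (redX SP); exact: skgV_red.
exact: (redM SP (red_div b i n) (red_K j)).
Qed.

Lemma Ad_stable_K j : Ad_stable (KB j).
Proof.
move=> n; case: (ltnP n l) => nl.
  apply: N_Ad_SB_inner; last exact: N_K.
  by move=> m mn; apply: N_SB_lt_l; exact: leq_ltn_trans nl.
rewrite Ad_SB_K (prod_root_eq0 (sku_prim b i) _ nl); first by rewrite scale0r; exact: gen_subalg0.
by rewrite /wt; case: ifP => _; rewrite exprAC ?exprVn sku_l expr1n ?invr1.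
Qed.

Lemma Ad_SB_twisted b' j m n : (nil_deg na b b' i j * m < n)%N ->
  Ad_l DB (SB b i n) (SB b' j m * twist KB KVB b' i j ^+ m) = 0.
Proof.
move=> mn.
have T : red (twist K Kinv b' i j) (twist KB KVB b' i j).
  by rewrite /twist; case: (b'); case: ifP => _ //; exact: (red1 SP).
apply: (red_fun SP (red_Ad_l SP HS (red_div b i n)
  (redM SP (red_div b' j m) (redX SP m T)))).
suff -> : Ad_l DA (divp b i n) (divp b' j m * twist K Kinv b' i j ^+ m) = 0.
  exact: (red0 SP).
rewrite {1}/divpow (linear_fZ _ _ (Ad_l_linearl DA _)) (Ad_l_UqX QR QH).
have [c c0 Hc] := X_twist QR b' i j.
have [e He] := qcommute_exp Hc m.
have -> : divp b' j m * twist K Kinv b' i j ^+ m =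
   ((qnum_fact (v j) m)^-1 * c ^- e) *: (X b' j * twist K Kinv b' i j) ^+ m.
  by rewrite He scalerA mulfVK ?expf_neq0 // -pzscalerAl.
rewrite /Uq_ad skew_ad_iterZ.
have nilX := skew_ad_nilX (skgg QR b i) (skgVg QR b i) (skhh QR b i) (skhVh QR b i)
  (skgh K Kinv b i) (skal_neq0 QR b i) (skbe_neq0 QR b i) (skhX QR b i) (skgX QR b i)
  m (twisted_nilpotent QR b b' i j).
rewrite -(subnK mn) iterD nilX skew_ad_iter0 !scaler0 //.
Qed.

(** For large n the twisted divided power is killed, and the twist is removed by
    multiplicativity; for small n the acting divided powers all belong to N. *)
Lemma Ad_stable_SB b' j m : m = 1%N \/ (exists2 t, (t < r)%N & m = (p ^ t * l)%N) ->
  Ad_stable (SB b' j m).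
Proof.
move=> Hm.
have Nm : N (SB b' j m).
  by case: Hm => [->|[t tr ->]]; apply: gen_subalg_in; constructor.
have [tw tw1 Stw] : exists2 y, twist KB KVB b' i j * y = 1 & Ad_stable y.
  have SKV j' : Ad_stable (KVB j').
    have -> : KVB j' = KB j' ^+ l.-1; last by apply: Ad_stableX; exact: Ad_stable_K.
    by rewrite -[RHS]mul1r -(KVB_KB j') -mulrA -exprS prednK ?l_gt0 // KB_l mulr1.
  rewrite /twist; case: b' {Nm}; case: ifP => _; [exists (KB j)|exists 1|exists 1|exists (KVB j)];
    rewrite ?mulr1 ?KVB_KB ?KB_KVB //; try exact: Ad_stable1; exact: Ad_stable_K.
have -> : SB b' j m = SB b' j m * twist KB KVB b' i j ^+ m * tw ^+ m.
  rewrite -mulrA; have -> : twist KB KVB b' i j ^+ m * tw ^+ m = 1; last by rewrite mulr1.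
  elim: m {Hm Nm} => [|m IHm]; first by rewrite mulr1.
  by rewrite exprSr [tw ^+ _]exprS mulrA -[_ * twist _ _ _ _ _ * tw]mulrA tw1 mulr1.
apply: Ad_stableM; last exact: Ad_stableX.
move=> n; case: (ltnP (nil_deg na b b' i j * m) n) => mn.
  by rewrite Ad_SB_twisted //; exact: gen_subalg0.
apply: N_Ad_SB_inner => [n' n'n|].
  by apply: N_SB_small Hm (leq_trans n'n mn); exact: nil_deg_small.
apply: gen_subalgM => //; apply: gen_subalgX; rewrite /twist.
by case: (b'); case: ifP => _; [exact: N_KV|exact: gen_subalg1|exact: gen_subalg1|exact: N_K].
Qed.

Lemma N_Ad_SB n a : N a -> N (Ad_l DB (SB b i n) a).
Proof.
move=> Na; suff : Ad_stable a by apply.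
elim: Na => {a} [x [b' j|b' j m mr|j]||x y _ Sx _ Sy|x y _ Sx _ Sy|c x _ _ Sx].
- by apply: Ad_stable_SB; left.
- by apply: Ad_stable_SB; right; exists m.
- exact: Ad_stable_K.
- exact: Ad_stable1.
- by rewrite addrC -scaleN1r; exact: Ad_stable_lin.2.
- exact: Ad_stableM.
- by rewrite -[_ *: _]addr0; apply: Ad_stable_lin.2 => //; exact: Ad_stable_lin.1.
Qed.

End Action.

Lemma N_Ad_l h a : N a -> N (Ad_l DB h a).
Proof.
move: h a; apply: B_ind.
- split=> [a Na|c x y Hx Hy a Na].
    by rewrite (linear_f0 (Ad_l_linearl DB a)); exact: gen_subalg0.
  by rewrite (Ad_l_linearl DB); apply: N_lin.2; [exact: Hx|exact: Hy].
- by move=> a Na; rewrite Ad_l_unit.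
- by move=> x y Hx Hy a Na; rewrite Ad_lM; apply/Hx/Hy.
- by move=> i a; exact: N_Ad_K.
- by move=> i a; exact: N_Ad_KV.
- by move=> b i n a; exact: N_Ad_SB.
Qed.

(** Both sides turn products in h into composites, so that the identity has to be
    checked on generators only. *)
Lemma antipode_Ad_l h a : antipode DB (Ad_l DB h a) = Ad_r DB (antipode DB h) (antipode DB a).
Proof.
move: h; apply: (red_span SP) => [|u x ux].
  split=> [|c x y Hx Hy].
    by rewrite (linear_f0 (Ad_l_linearl DB a)) !raddf0 (linear_f0 (Ad_r_linearl DB _)).
  by rewrite Ad_l_linearl !linearP Ad_r_linearl Hx Hy.
move: a; apply: (red_span SP) => [|u' y uy].
  split=> [|c a a' Ha Ha'].
    by rewrite (linear_f0 (Ad_l_linear DB x)) !raddf0 (linear_f0 (Ad_r_linear DB _)).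
  by rewrite Ad_l_linear !linearP Ad_r_linear Ha Ha'.
have SE := red_antipodeE SP HS.
apply: (red_fun SP (SE _ _ (red_Ad_l SP HS ux uy))).
suff -> : antipode DA (Ad_l DA u u') = Ad_r DA (antipode DA u) (antipode DA u').
  by apply: (red_Ad_r SP HS); exact: SE.
move: u x ux u' {y uy}; apply: (red_ind SP) => [u'|u1 u2 H1 H2 u'|u1 u2 H1 H2 u'|c d u1 _ H1 u'|u [i|i|b i n] u'].
- by rewrite antipode1 Ad_l_unit Ad_r_unit.
- rewrite -[u1 - u2]addrC -scaleN1r (Ad_l_linearl DA) !linearP (Ad_r_linearl DA).
  by rewrite H1 H2.
- by rewrite antipodeM Ad_lM Ad_rM H1 H2.
- rewrite (linear_fZ _ _ (Ad_l_linearl DA _)) !linearZ /=.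
  by rewrite (linear_fZ _ _ (Ad_r_linearl DA _)) H1.
- exact: (antipode_Ad_l_grouplike _ (comul_K QH i) (counit_K QH i) (qr_KK QR i) (qr_VK QR i)).
- exact: (antipode_Ad_l_grouplike _ (comul_KV QR QH i) (counit_KV QR QH i) (qr_VK QR i) (qr_KK QR i)).
rewrite /divpow (linear_fZ _ _ (Ad_l_linearl DA _)) !linearZ /=.
rewrite (linear_fZ _ _ (Ad_r_linearl DA _)); congr (_ *: _).
elim: n u' => [|n IH] u'.
  by rewrite expr0 antipode1 Ad_l_unit Ad_r_unit.
by rewrite exprS antipodeM Ad_lM Ad_rM (antipode_Ad_l_UqX QR QH) IH.
Qed.

(** C is meant to be all of B, or N. *)
Lemma antipode_onto (C : B -> Prop) :
  C 1 -> (forall x y, C x -> C y -> C (x * y)) -> (forall c x, C x -> C (c *: x)) ->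
  forall b i n, C (SB b i n) -> (forall j, C (KB j)) -> (forall j, C (KVB j)) ->
  exists2 y, C y & antipode DB y = SB b i n.
Proof.
move=> C1 CM CZ b i n CS CK CKV.
have CX x m : C x -> C (x ^+ m) by move=> Cx; elim: m => // m; rewrite exprS; exact: CM.
have [c c0 E] := antipode_SB b i n.
have SX x m : antipode DB (x ^+ m) = antipode DB x ^+ m.
  by elim: m => [|m IH]; rewrite ?antipode1 // exprS antipodeM IH exprSr.
exists (c^-1 *: (skgV KB b i ^+ n * SB b i n * skhV KVB b i ^+ n)).
  have CgV : C (skgV KB b i) by case: (b).
  have ChV : C (skhV KVB b i) by case: (b).
  by apply: (CZ); apply: (CM); [apply: (CM)|]; do ?[exact: CX].
have EhV : antipode DB (skhV KVB b i) = skh KB b i.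
  by case: b {CS E} => /=; rewrite ?antipode1 ?antipode_KVB.
have EgV : antipode DB (skgV KB b i) = skg KVB b i.
  by case: b {CS E EhV} => /=; rewrite ?antipode1 ?antipode_KB.
rewrite linearZ /= !antipodeM E !SX EhV EgV -pzscalerAl -pzscalerAr scalerA mulVf // scale1r.
have XV (x y : B) m : x * y = 1 -> y * x = 1 -> x ^+ m * y ^+ m = 1.
  move=> xy yx; rewrite -exprMn_comm ?xy ?expr1n //; by rewrite /GRing.comm xy yx.
rewrite !mulrA XV ?mul1r -?mulrA ?XV ?mulr1 //;
  by case: b {CS E EhV EgV}; rewrite /= ?mulr1 ?KB_KVB ?KVB_KB.
Qed.

Lemma antipode_surj h : exists y, antipode DB y = h.
Proof.
move: h; apply: B_ind.
- split=> [|c _ _ [x <-] [y <-]]; first by exists 0; rewrite raddf0.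
  by exists (c *: x + y); rewrite linearP.
- by exists 1; rewrite antipode1.
- by move=> _ _ [x <-] [y <-]; exists (y * x); rewrite antipodeM.
- by move=> i; exists (KVB i); rewrite antipode_KVB.
- by move=> i; exists (KB i); rewrite antipode_KB.
- by move=> b i n; case: (@antipode_onto (fun _ => True) _ _ _ b i n) => // y _ <-; exists y.
Qed.

Lemma N_antipode_surj a : N a -> exists2 y, N y & antipode DB y = a.
Proof.
have NM x y : N x -> N y -> N (x * y) by exact: gen_subalgM.
have NZ c x : N x -> N (c *: x) by exact: gen_subalgZ.
have N1 : N 1 by exact: gen_subalg1.
elim=> {a} [x [b i|b i m mr|i]||x y _ [x' Nx <-] _ [y' Ny <-]
  |x y _ [x' Nx <-] _ [y' Ny <-]|c x _ _ [x' Nx <-]].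
- by apply: (antipode_onto N1 NM NZ) => [||j]; [apply: gen_subalg_in; constructor|exact: N_K|exact: N_KV].
- by apply: (antipode_onto N1 NM NZ) => [||j]; [apply: gen_subalg_in; constructor|exact: N_K|exact: N_KV].
- by exists (KVB i); [exact: N_KV|rewrite antipode_KVB].
- by exists 1; rewrite ?antipode1.
- by exists (x' - y'); [exact: gen_subalgB|rewrite linearB].
- by exists (y' * x'); [exact: NM|rewrite antipodeM].
- by exists (c *: x'); [exact: NZ|rewrite linearZ].
Qed.

(** The right adjoint action is brought to the left one by writing its arguments as
    values of the antipode. *)
Lemma small_normal : normal_subalg DB N.
Proof.
split=> h a Na; first exact: N_Ad_l.
have [h' <-] := antipode_surj h; have [a' Na' <-] := N_antipode_surj Na.
by rewrite -antipode_Ad_l; apply/N_antipode/N_Ad_l.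
Qed.

End FrobeniusKernels.

(** * Lengths of roots and Cartan integers *)

Section RootSystem.
Import Order.TTheory.
Variables (R : archiRealFieldType) (V : vectType R) (Phi : rootSystem V).
Local Notation "<| u , v |>" := (form Phi u v) (at level 0, format "<| u ,  v |>").
Local Notation roots := (roots Phi).

Lemma formDl u v w : <|u + v, w|> = <|u, w|> + <|v, w|>.
Proof. by rewrite -[u]scale1r formDZl mul1r scale1r. Qed.
Lemma form0l w : <|0, w|> = 0.
Proof. by apply: (addrI <|0, w|>); rewrite -formDl !addr0. Qed.
Lemma formZl c u w : <|c *: u, w|> = c * <|u, w|>.
Proof. by rewrite -[c *: u]addr0 formDZl form0l addr0. Qed.
Lemma formDr u v w : <|w, u + v|> = <|w, u|> + <|w, v|>.
Proof. by rewrite formC formDl (formC Phi u) (formC Phi v). Qed.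
Lemma formZr c u w : <|w, c *: u|> = c * <|w, u|>.
Proof. by rewrite formC formZl (formC Phi u). Qed.
Lemma formNl u w : <|- u, w|> = - <|u, w|>.
Proof. by rewrite -scaleN1r formZl mulN1r. Qed.
Lemma formNr u w : <|w, - u|> = - <|w, u|>.
Proof. by rewrite -scaleN1r formZr mulN1r. Qed.

Lemma root_neq0 a : a \in roots -> a != 0.
Proof. by apply: contraTneq => ->; rewrite (roots_neq0 Phi). Qed.

Lemma root_norm_gt0 a : a \in roots -> 0 < <|a, a|>.
Proof. by move=> /root_neq0; exact: form_gt0. Qed.

Lemma form_coroot a b : <|b, coroot Phi a|> = 2 * <|b, a|> / <|a, a|>.
Proof. by rewrite /coroot formZr mulrAC. Qed.

Lemma root_pairing a b : a \in roots -> b \in roots ->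
  exists m : int, 2 * <|b, a|> = m%:~R * <|a, a|>.
Proof.
move=> ra rb; have /intrP [m Hm] := roots_int ra rb; exists m.
by rewrite -Hm form_coroot divfK // gt_eqF // root_norm_gt0.
Qed.

(** The inequality is strict because roots that are not opposite or equal are not
    proportional. *)
Lemma cauchy_roots a b : a \in roots -> b \in roots -> b != a -> b != - a ->
  <|a, b|> ^+ 2 < <|a, a|> * <|b, b|>.
Proof.
move=> ra rb nba nbNa; have a0 := root_norm_gt0 ra.
pose w := <|a, a|> *: b - <|a, b|> *: a.
have w0 : w != 0.
  apply/eqP => /eqP; rewrite subr_eq0 => /eqP E.
  have Eb : b = (<|a, b|> / <|a, a|>) *: a.
    by rewrite mulrC -scalerA -E scalerA mulVf ?gt_eqF // scale1r.
  have := roots_reduced ra (c := <|a, b|> / <|a, a|>); rewrite -Eb => /(_ rb).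
  case=> c1; move: Eb; rewrite c1 ?scale1r ?scaleN1r => /eqP.
    by rewrite (negPf nba).
  by rewrite (negPf nbNa).
have := form_gt0 Phi w0; rewrite /w formDl !formDr !formNl !formNr !formZl !formZr.
rewrite (formC Phi b a).
move: a0; set x := <|a, a|>; set y := <|a, b|>; set z := <|b, b|> => x0 H.
have : 0 < x * (x * z - y ^+ 2) by lra.
by rewrite pmulr_rgt0 // subr_gt0.
Qed.

Lemma pairing_bounds a b (m n : int) : a \in roots -> b \in roots -> b != a -> b != - a ->
  2 * <|a, b|> = m%:~R * <|a, a|> -> 2 * <|a, b|> = n%:~R * <|b, b|> -> (m * n < 4)%R.
Proof.
move=> ra rb nba nbNa Hm Hn; have C := cauchy_roots ra rb nba nbNa.
have a0 := root_norm_gt0 ra; have b0 := root_norm_gt0 rb.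
rewrite -(ltr_int R) rmorphM /= -(ltr_pM2r (mulr_gt0 a0 b0)).
have -> : m%:~R * n%:~R * (<|a, a|> * <|b, b|>) = (2 * <|a, b|>) ^+ 2.
  by rewrite expr2 {1}Hm Hn; ring.
by rewrite exprMn -[2 ^+ 2]natrX ltr_pM2l.
Qed.

(** The two Cartan integers have the same sign and a product below 4, unless the roots
    are proportional. *)
Lemma norm_ratio a b : a \in roots -> b \in roots -> <|a, b|> != 0 ->
  <|a, a|> <= <|b, b|> ->
  exists2 e : nat, (0 < e <= 3)%N & <|b, b|> = e%:R * <|a, a|>.
Proof.
move=> ra rb ab le_ab; have a0 := root_norm_gt0 ra; have b0 := root_norm_gt0 rb.
case: (eqVneq b a) => [->|nba]; first by exists 1%N; rewrite ?mul1r.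
case: (eqVneq b (- a)) => [->|nbNa].
  by exists 1%N; rewrite // formNl formNr opprK mul1r.
have [m Hm] := root_pairing ra rb; rewrite formC in Hm.
have [n Hn] := root_pairing rb ra.
have mn := pairing_bounds ra rb nba nbNa Hm Hn.
have m0 : m != 0.
  apply: contraNneq ab => m0; move/eqP: Hm; rewrite m0 mul0r mulf_eq0.
  by rewrite pnatr_eq0.
have mE : m%:~R * <|a, a|> = n%:~R * <|b, b|> by rewrite -Hm Hn.
have mn0 : (0 < m * n)%R.
  rewrite -(ltr_int R) rmorphM /= -(pmulr_lgt0 _ b0) -mulrA -mE mulrA -expr2.
  by rewrite mulr_gt0 // exprn_even_gt0 //= intr_eq0.
have nm : `|n| <= `|m|.
  have : `|n%:~R : R| * <|b, b|> = `|m%:~R| * <|a, a|>.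
    by rewrite -{1}(gtr0_norm b0) -[in RHS](gtr0_norm a0) -!normrM mE.
  rewrite -!intr_norm -(ler_int R) => E.
  rewrite -(ler_pM2r b0) E ler_wpM2l //.
have n2 : (`|n| < 2)%N by nia.
have n1 : `|n| = 1 by nia.
have m4 : (0 < `|m| <= 3)%N.
  have [nE|nE] : n = 1 \/ n = -1 by lia.
    by move: mn mn0; rewrite nE; lia.
  by move: mn mn0; rewrite nE; lia.
exists `|m|%N => //.
have : `|n%:~R : R| * <|b, b|> = `|m%:~R| * <|a, a|>.
  by rewrite -{1}(gtr0_norm b0) -[in RHS](gtr0_norm a0) -!normrM mE.
by rewrite -!intr_norm n1 mul1r => ->; rewrite -pmulrn natr_absz.
Qed.

Hypotheses (irr : indecomposable Phi) (norm2 : normalized Phi).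

Lemma short_root_exists : exists2 a, a \in roots & <|a, a|> = 2 /\
  {in roots, forall b, 2 <= <|b, b|>}.
Proof.
have [a0 ra0] := irr.1.
have [a ra Ha] : exists2 a, a \in roots & {in roots, forall b, <|a, a|> <= <|b, b|>}.
  elim: {a0} roots (a0) ra0 => // c s IH a0 _.
  case: s IH => [|c' s] IH; first by exists c; rewrite ?mem_head // => b; rewrite mem_seq1 => /eqP ->.
  have [a sa Ha] := IH c' (mem_head _ _).
  case: (lerP <|c, c|> <|a, a|>) => ca.
    exists c; first exact: mem_head.
    move=> b; rewrite in_cons => /orP [/eqP -> //|/Ha]; exact: le_trans.
  exists a; first by rewrite in_cons sa orbT.
  by move=> b; rewrite in_cons => /orP [/eqP ->|/Ha //]; exact: ltW.
have a2 : <|a, a|> = 2 by apply: norm2; split.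
by exists a => //; split=> // b rb; rewrite -a2; exact: Ha.
Qed.

Inductive reflection_orbit (b : V) : V -> Prop :=
| orbit_refl : reflection_orbit b b
| orbit_step a c : a \in roots -> reflection_orbit b c ->
    reflection_orbit b (c - <|c, coroot Phi a|> *: a).

Lemma orbit_root b c : b \in roots -> reflection_orbit b c -> c \in roots.
Proof. by move=> rb; elim=> // a {}c ra _ rc; exact: roots_refl. Qed.

Lemma orbit_norm b c : reflection_orbit b c -> <|c, c|> = <|b, b|>.
Proof.
elim=> // a {}c ra _ <-; have a0 := root_norm_gt0 ra.
rewrite form_coroot formDl !formDr !(formNl, formNr) !(formZl, formZr) (formC Phi a c).
by move: a0; set x := <|a, a|>; set y := <|c, a|> => a0; field; rewrite gt_eqF.
Qed.

Lemma form_span (s : seq V) u : {in s, forall w, <|w, u|> = 0} ->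
  {in (<<s>>)%VS, forall w, <|w, u|> = 0}.
Proof.
move=> Hs w; rewrite -[s]/(val (in_tuple s)) => /coord_span ->.
elim/big_ind: _ => [|x y Hx Hy|j _]; first exact: form0l.
  by rewrite formDl Hx Hy addr0.
by rewrite formZl Hs ?mulr0 // mem_nth // size_tuple.
Qed.

(** By irreducibility the roots conjugate to b span the whole space. *)
Lemma orbit_not_orthogonal a b : a \in roots -> b \in roots ->
  exists c, [/\ c \in roots, <|c, c|> = <|b, b|> & <|c, a|> != 0].
Proof.
move=> ra rb; pose s := [seq c <- roots | `[< reflection_orbit b c >]].
have s_orb c : c \in s -> reflection_orbit b c by rewrite mem_filter => /andP [/asboolP].
have orb_s c : reflection_orbit b c -> c \in s.
  by move=> oc; rewrite mem_filter (orbit_root rb oc) andbT; apply/asboolP.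
pose W := (<<s>>)%VS.
have W_orth e : e \in roots -> e \notin W -> {in W, forall w, <|w, e|> = 0}.
  move=> re eW; apply: form_span => c /s_orb oc; apply/eqP; apply: contraNT eW => ce.
  have c1 : c - <|c, coroot Phi e|> *: e \in W by apply/memv_span/orb_s; exact: orbit_step.
  have c2 : <|c, coroot Phi e|> *: e \in W.
    have cW : c \in W by apply/memv_span/orb_s.
    by rewrite -(subKr c (_ *: e)) memvB.
  have k0 : <|c, coroot Phi e|> != 0.
    rewrite form_coroot mulf_neq0 ?invr_eq0 ?(gt_eqF (root_norm_gt0 re)) //.
    by rewrite mulf_neq0 ?pnatr_eq0.
  by rewrite -[e]scale1r -(mulVf k0) -scalerA memvZ.
have allW e : e \in roots -> e \in W.
  move=> re; apply: contraT => eW.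
  have [||x [y [rx ry /= xW yW]]] := irr.2 (mem W).
  - by exists b => //=; apply/memv_span/orb_s; exact: orbit_refl.
  - by exists e.
  by rewrite (W_orth y ry yW x xW) eqxx.
have [c cs ca] : exists2 c, c \in s & <|c, a|> != 0.
  apply/hasP; apply: contraT => /hasPn Hs.
  have := @form_span s a _ a (allW a ra).
  move=> H; have := root_norm_gt0 ra; rewrite H ?ltxx // => w /Hs.
  by rewrite negbK => /eqP.
by exists c; split=> //; [exact: orbit_root rb (s_orb c cs)|exact: orbit_norm (s_orb c cs)].
Qed.

Lemma root_norm b : b \in roots ->
  exists2 e : nat, (0 < e <= 3)%N & <|b, b|> = 2 * e%:R.
Proof.
move=> rb; have [a ra [a2 a_min]] := short_root_exists.
have [c [rc cb ca]] := orbit_not_orthogonal ra rb.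
have [||e e3 E] := @norm_ratio a c ra rc.
- by rewrite formC.
- by rewrite a2 a_min.
by exists e => //; rewrite -cb E a2 mulrC.
Qed.

(** The form n^2 - 3nm + 3m^2 is positive definite, being a quarter of
    (2n - 3m)^2 + 3m^2. *)
Lemma int_form_pos (n m : int) : n ^+ 2 - 3 * (n * m) + 3 * m ^+ 2 < 1 -> n = 0 /\ m = 0.
Proof.
move=> H; have sq0 (t : int) : t ^+ 2 < 1 -> t = 0.
  move=> t1; apply/eqP; rewrite -sqrf_eq0; have := sqr_ge0 t.
  by move: t1; move: (t ^+ 2) => u; lia.
have H4 : (2 * n - 3 * m) ^+ 2 + 3 * m ^+ 2 < 4.
  suff -> : (2 * n - 3 * m) ^+ 2 + 3 * m ^+ 2 = 4 * (n ^+ 2 - 3 * (n * m) + 3 * m ^+ 2).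
    by move: H; move: (_ + _) => u; lia.
  by ring.
have m1 : m ^+ 2 <= 1.
  have := sqr_ge0 (2 * n - 3 * m).
  by move: H4; move: (_ ^+ 2) (m ^+ 2) => u u'; lia.
have [mE|[mE|mE]] : m = 0 \/ (m = 1 \/ m = -1).
  case: (lerP 2 `|m|) => m2; last by lia.
  have : 2 ^+ 2 <= `|m| ^+ 2 by rewrite ler_pXn2r ?nnegrE.
  by rewrite real_normK ?num_real // => /le_trans /(_ m1).
- by move: H; rewrite mE !mulr0 subr0 addr0 => /sq0.
- have : (2 * n - 3 * m) ^+ 2 < 1.
    by move: H4; rewrite mE expr1n; move: (_ ^+ 2) => u; lia.
  by move/sq0; rewrite mE; lia.
- have : (2 * n - 3 * m) ^+ 2 < 1.
    by move: H4; rewrite mE sqrrN expr1n; move: (_ ^+ 2) => u; lia.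
  by move/sq0; rewrite mE; lia.
Qed.

Lemma real_form_pos (n m : int) :
  n%:~R ^+ 2 - 3 * (n%:~R * m%:~R) + 3 * m%:~R ^+ 2 < 1 :> R -> n = 0 /\ m = 0.
Proof.
move=> H; apply: int_form_pos; rewrite -(ltr_int R); move: H; congr (_ < _).
rewrite rmorphD /= rmorphB /= [in RHS]rmorphXn /= [(3 * (n * m))%:~R]rmorphM /=.
by rewrite [(n * m)%:~R]rmorphM /= [(3 * m ^+ 2)%:~R]rmorphM /= [(m ^+ 2)%:~R]rmorphXn.
Qed.

(** A short and a long root of norms 2 and 6 that are not orthogonal span the
    space: by integrality, the projection of any root to their plane is either 0
    or at least as long as that root. *)
Lemma G2_plane a g : a \in roots -> g \in roots -> <|a, a|> = 2 -> <|g, g|> = 6 ->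
  <|a, g|> ^+ 2 = 9 -> {in roots, forall b, b \in (<<[:: a; g]>>)%VS}.
Proof.
move=> ra rg a2 g6 ag b rb; set W := (<<_>>)%VS; set e := <|a, g|> in ag.
have inW x y : x *: a + y *: g \in W.
  by rewrite memvD // memvZ // memv_span // !inE eqxx ?orbT.
have plane d : d \in roots -> d \in W \/ (<|d, a|> = 0 /\ <|d, g|> = 0).
  move=> rd; have [n n3 dn] := root_norm rd.
  pose x := <|d, a|>; pose y := <|d, g|>.
  have [m1 Hm1] := root_pairing ra rd; have [m2 Hm2] := root_pairing rd ra.
  have [m3 Hm3] := root_pairing rg rd; have [m4 Hm4] := root_pairing rd rg.
  rewrite formC in Hm2; rewrite formC in Hm4; rewrite -/x -/y ?a2 ?g6 ?dn in Hm1 Hm2 Hm3 Hm4.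
  pose w := d - ((6 * x - e * y) / 3) *: a - ((2 * y - e * x) / 3) *: g.
  case: (eqVneq w 0) => [w0|w0].
    left; have -> : d = ((6 * x - e * y) / 3) *: a + ((2 * y - e * x) / 3) *: g.
      by apply/eqP; rewrite -subr_eq0 opprD addrA -/w w0.
    exact: inW.
  right; have := form_gt0 Phi w0.
  have [s s1 es] : exists2 s : int, s = 1 \/ s = -1 & e = 3 * s%:~R.
    have /eqP : (e - 3) * (e + 3) = 0 by lra.
    rewrite mulf_eq0 => /orP [] /eqP eE; [exists 1; [by left|]|exists (-1); [by right|]]; lra.
  have -> : <|w, w|> = <|d, d|> - (6 * x ^+ 2 - 2 * e * x * y + 2 * y ^+ 2) / 3.
    rewrite /w !(formDl, formDr) !(formNl, formNr) !(formZl, formZr).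
    rewrite (formC Phi a d) (formC Phi g d) (formC Phi g a) -/x -/y -/e a2 g6.
    by case: s1 es => -> ->; rewrite ?mulrN1z ?mulr1z; field.
  rewrite dn => pos.
  suff [m [m' [xE yE xy]]] : exists m m' : int, [/\ x = m%:~R * n%:R, y = 3 * m'%:~R &
      m = 0 /\ m' = 0].
    by move: xE yE; case: xy => -> ->; rewrite /x /y mul0r mulr0.
  have xE : x = m2%:~R * n%:R by apply: (@mulfI _ 2); rewrite ?pnatr_eq0 // Hm2 mulrCA.
  have yE : y = 3 * m3%:~R by lra.
  exists m2, m3; split=> //; pose t := s * m3.
  have s2 : s%:~R * s%:~R = 1 :> R by case: s1 => ->; rewrite -rmorphM.
  have {}pos : 0 < n%:R - x ^+ 2 + 3 * x * t%:~R - 3 * t%:~R ^+ 2.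
    suff E : 2 * n%:R - (6 * x ^+ 2 - 2 * e * x * y + 2 * y ^+ 2) / 3 =
      2 * (n%:R - x ^+ 2 + 3 * x * t%:~R - 3 * t%:~R ^+ 2) by move: pos; rewrite E pmulr_rgt0.
    rewrite es yE /t rmorphM /=; have -> : (s%:~R * m3%:~R) ^+ 2 = m3%:~R ^+ 2 :> R.
      by rewrite exprMn expr2 s2 mul1r.
    by field.
  have m3t : t = 0 -> m3 = 0 by rewrite /t; case: s1 => ->; lia.
  move: n3 xE dn Hm2 Hm4 pos; case: n => [|[|[|[|n]]]] // _ xE _ _ Hm4 pos.
  - have [|m20 t0] := @real_form_pos m2 t; last by split=> //; exact: m3t.
    by move: pos; rewrite xE mulr1; lra.
  - have [j jE] : exists j, m3 = 2 * j.
      have : m3 * 6 = m4 * 4.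
        by apply: (@intr_inj R); rewrite !rmorphM /= -Hm3 Hm4; ring.
      by move=> ?; exists (m4 - m3); lia.
    have [|m20 j0] := @real_form_pos m2 (s * j); last first.
      by split=> //; rewrite jE; move: j0; case: s1 => ->; lia.
    have tE : t%:~R = 2 * (s * j)%:~R :> R by rewrite /t jE mulrCA rmorphM.
    by move: pos; rewrite xE tE; lra.
  - have [|t0 m20] := @real_form_pos t m2; last by split=> //; exact: m3t.
    by move: pos; rewrite xE; lra.
have aW : a \in W by rewrite memv_span // inE eqxx.
have gW : g \in W by rewrite memv_span // !inE eqxx orbT.
have orth d : <|d, a|> = 0 /\ <|d, g|> = 0 -> {in W, forall w, <|w, d|> = 0}.
  move=> [da dg]; apply: form_span => w; rewrite !inE => /orP [] /eqP ->; by rewrite formC.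
apply: contraT => bW; have [||x [y [rx ry /= xW yW]]] := irr.2 (mem W).
- by exists a.
- by exists b.
have [yW'|yo] := plane y ry; first by rewrite yW' in yW.
by rewrite (orth y yo x xW) eqxx.
Qed.

Local Notation I := 'I_(\dim {:V}).
Local Notation al := (sroot Phi).

Lemma sroot_root i : al i \in roots.
Proof. by apply: simple_roots; exact: mem_tnth. Qed.

Lemma coord_sroot i j : coord (simple Phi) i (al j) = (i == j)%:R.
Proof.
have fr : free (simple Phi) by exact: (basis_free (simple_basis Phi)).
by rewrite /sroot (tnth_nth 0) (coord_free j i fr) eq_sym.
Qed.

Lemma sroot_neq i j : i != j -> al j != al i /\ al j != - al i.
Proof.
move=> ij; split; apply/eqP => /(congr1 (coord (simple Phi) j)).
  by rewrite !coord_sroot eqxx eq_sym (negPf ij) => /eqP; rewrite oner_eq0.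
by rewrite linearN /= !coord_sroot eqxx eq_sym (negPf ij) oppr0 => /eqP; rewrite oner_eq0.
Qed.

(** Simple roots form obtuse angles: otherwise a reflection of one in another
    would have coordinates of both signs. *)
Lemma cartan_nat i j : i != j -> exists n : nat, cartan Phi i j = - n%:R.
Proof.
move=> ij; have := simple_sign (roots_refl (sroot_root i) (sroot_root j)).
rewrite -/(cartan Phi i j); case=> H.
  have /natrP [n nE] := H i; exists n; rewrite -nE linearB linearZ /= !coord_sroot.
  by rewrite eqxx (negPf ij) mulr1 sub0r opprK.
have /natrP [n nE] := H j; move: nE; rewrite linearB linearZ /= !coord_sroot.
rewrite eqxx eq_sym (negPf ij) mulr0 subr0 => nE; have := ler0n R n.
by rewrite -nE oppr_ge0 ler10.
Qed.

Lemma sroot_pairing i j : 2 * <|al i, al j|> = cartan Phi i j * <|al i, al i|>.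
Proof.
by rewrite /cartan form_coroot formC divfK // gt_eqF // root_norm_gt0 // sroot_root.
Qed.

Lemma cartan_bound i j : i != j -> exists n m : nat,
  [/\ cartan Phi i j = - n%:R, cartan Phi j i = - m%:R & (n * m < 4)%N].
Proof.
move=> ij; have [n nE] := cartan_nat ij; have [m mE] : exists m : nat, cartan Phi j i = - m%:R.
  by apply: cartan_nat; rewrite eq_sym.
exists n, m; split=> //; have [nji nNji] := sroot_neq ij.
have := @pairing_bounds (al i) (al j) (- n%:Z) (- m%:Z) (sroot_root i)
  (sroot_root j) nji nNji.
rewrite !rmorphN /= -!pmulrn -nE -mE -!sroot_pairing mulrNN.
by rewrite (formC Phi (al j)) => /(_ erefl erefl).
Qed.

Lemma G2_type a g : a \in roots -> g \in roots -> <|a, a|> = 2 -> <|g, g|> = 6 ->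
  <|a, g|> ^+ 2 = 9 -> \dim {:V} = 2%N.
Proof.
move=> ra rg a2 g6 ag; have allW := G2_plane ra rg a2 g6 ag.
have full : (<<[:: a; g]>> = fullv)%VS.
  apply/eqP; rewrite eqEsubv subvf /= -(roots_span Phi); apply/span_subvP => b; exact: allW.
have fr : free [:: a; g].
  rewrite free_cons seq1_free root_neq0 // andbT span_seq1.
  apply/vlineP => -[c aE]; move: a2 ag; rewrite aE formZl !formZr formZl g6.
  by rewrite !exprMn; move=> H1 H2; nra.
by rewrite -full (eqnP fr).
Qed.

Lemma cartan3_G2 i j : cartan Phi i j = - 3 -> type_G2 Phi.
Proof.
move=> c3; have ij : i != j.
  apply/eqP => E; move: c3; rewrite E /cartan form_coroot mulfK ?gt_eqF ?root_norm_gt0 ?sroot_root //.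
  lra.
have [n [m [nE mE nm]]] := cartan_bound ij.
have n3 : n = 3%N by apply/eqP; rewrite -(eqr_nat R) -eqr_opp -nE c3.
have m1 : m = 1%N.
  case: m mE nm => [|[|m]] mE nm //; last by lia.
  have P1 := sroot_pairing i j; have P2 := sroot_pairing j i.
  rewrite c3 in P1; rewrite mE (formC Phi (al j)) mulr0n in P2.
  rewrite oppr0 mul0r in P2; exfalso.
  by have := root_norm_gt0 (sroot_root i); lra.
have cji : cartan Phi j i = - 1 by rewrite mE m1.
have P1 := sroot_pairing i j; have P2 := sroot_pairing j i.
rewrite c3 in P1; rewrite cji (formC Phi (al j)) in P2.
have [e e3 eE] := root_norm (sroot_root i); have [f f3 fE] := root_norm (sroot_root j).
have fe : f = (3 * e)%N.
  by apply/eqP; rewrite -(eqr_nat R) natrM; apply/eqP; move: P1 P2; rewrite eE fE; lra.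
have e1 : e = 1%N by lia.
have N1 : <|al i, al i|> = 2 by rewrite eE e1 mulr1.
have N2 : <|al j, al j|> = 6 by rewrite fE fe e1; lra.
split; last by exists i, j; split.
apply: (G2_type (sroot_root i) (sroot_root j) N1 N2).
have -> : <|al i, al j|> = - 3 by lra.
by lra.
Qed.

Lemma root_simple_coord b : b \in roots -> exists c : I -> int,
  b = \sum_i (c i)%:~R *: al i.
Proof.
move=> rb; have [c cE] : exists c : I -> int, forall i, coord (simple Phi) i b = (c i)%:~R.
  have [H|H] := simple_sign rb.
    have /choice [c cE] : forall i, exists n : nat, coord (simple Phi) i b = n%:R.
      by move=> i; apply/natrP/H.
    by exists (fun i => (c i)%:Z) => i; rewrite cE pmulrn.
  have /choice [c cE] : forall i, exists n : nat, - coord (simple Phi) i b = n%:R.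
    by move=> i; apply/natrP/H.
  by exists (fun i => - (c i)%:Z) => i; rewrite rmorphN /= -pmulrn -cE opprK.
exists c; rewrite {1}(coord_basis (simple_basis Phi) (memvf b)).
by apply: eq_bigr => i _; rewrite cE /sroot (tnth_nth 0).
Qed.

(** The roots lie in a plane by the preceding results; the possible angles between the
    two simple roots are then narrowed down by a discriminant. *)
Lemma long_simple_G2 i : <|al i, al i|> = 6 -> type_G2 Phi.
Proof.
move=> i6; have [a ra [a2 _]] := short_root_exists.
have [g [rg gE ga]] := orbit_not_orthogonal ra (sroot_root i).
rewrite i6 in gE.
have ag : <|a, g|> ^+ 2 = 9.
  have [m Hm] := root_pairing ra rg; have [n Hn] := root_pairing rg ra.
  rewrite a2 in Hm; rewrite gE formC in Hn.
  have nga : g != a by apply/eqP => E; move: gE; rewrite E a2; lra.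
  have ngNa : g != - a by apply/eqP => E; move: gE; rewrite E formNl formNr opprK a2; lra.
  have := @pairing_bounds a g m n ra rg nga ngNa.
  rewrite a2 gE formC => /(_ Hm Hn) mn.
  have mE : m = 3 * n by apply: (@intr_inj R); rewrite rmorphM /= -[3%:~R]/(3 : R); lra.
  have n0 : n != 0.
    by apply: contraNneq ga => n0; move: Hn; rewrite n0 mul0r => Hn; apply/eqP; lra.
  have nn : n = 1 \/ n = -1 by nia.
  have -> : <|g, a|> = n%:~R * 3 by lra.
  by case: nn => ->; rewrite ?mulrN1z ?mulr1z; lra.
have dim2 := G2_type ra rg a2 gE ag.
have [j ij] : exists j, i != j.
  have [j Hj] : exists j : I, (j != i :> nat).
    have h0 : (0 < \dim {:V})%N by rewrite dim2.
    have h1 : (1 < \dim {:V})%N by rewrite dim2.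
    by case: (eqVneq (i : nat) 0%N) => E; [exists (Ordinal h1)|exists (Ordinal h0)];
      rewrite /= ?E // eq_sym.
  by exists j; rewrite eq_sym.
split=> //; have [n [m [nE mE nm]]] := cartan_bound ij.
have [e e3 eE] := root_norm (sroot_root j).
have P1 := sroot_pairing i j; have P2 := sroot_pairing j i.
rewrite nE i6 in P1; rewrite mE (formC Phi (al j)) eE in P2.
have em : (e * m = 3 * n)%N.
  by apply/eqP; rewrite -(eqr_nat R) !natrM; apply/eqP; lra.
have two_simple b : b \in roots -> exists x y : int, b = x%:~R *: al i + y%:~R *: al j.
  move=> /root_simple_coord [c ->]; exists (c i), (c j).
  rewrite (bigD1 i) //= (bigD1 j) 1?eq_sym //= big1 ?addr0 // => h /andP [hi hj].
  have lt2 (t : I) : (t < 2)%N by move: (ltn_ord t); rewrite [X in (_ < X)%N]dim2.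
  move: (lt2 h) (lt2 i) (lt2 j) ij hi hj; rewrite -!val_eqE /=.
  by move: (nat_of_ord h) (nat_of_ord i) (nat_of_ord j) => h' i' j'; lia.
(* the lattice spanned by a and g has discriminant 3 and finite index in the one
   spanned by the simple roots, so that the latter cannot be rectangular *)
have [x [y aE]] := two_simple a ra; have [x' [y' gE']] := two_simple g rg.
have disc : 3 = ((x * y' - x' * y) ^+ 2)%:~R * (6 * (2 * e%:R) - <|al i, al j|> ^+ 2) :> R.
  have -> : 3 = <|a, a|> * <|g, g|> - <|a, g|> ^+ 2 by rewrite a2 gE ag; lra.
  rewrite aE gE' !(formDl, formDr) !(formZl, formZr) (formC Phi (al j) (al i)) i6 eE.
  by rewrite rmorphXn /= rmorphB /= !rmorphM /=; ring.
have [[e1 [m3 n1]]|[n0|[n1 e3']]] : (e = 1 /\ m = 3 /\ n = 1 \/ n = 0 \/ n = 1 /\ e = 3)%N.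
- case: n nm em {nE P1} => [|[|[|[|n]]]] nm em; try lia; by case: e e3 em {eE P2 disc} => [|[|[|[|e]]]]; lia.
- by exists j, i; rewrite nE mE m3 n1.
- exfalso; have f0 : <|al i, al j|> = 0 by rewrite n0 in P1; lra.
  move: disc; rewrite f0 expr0n subr0; move: (_ ^+ 2) => u disc.
  have : 3 = u * (6 * (2 * e%:Z)).
    by apply: (@intr_inj R); rewrite !rmorphM /= -pmulrn; exact: disc.
  by case: e e3 {eE P2 em disc} => [|[|[|[|e]]]]; lia.
exfalso; have f0 : <|al i, al j|> = - 3 by rewrite n1 in P1; lra.
move: disc; rewrite f0 e3'; move: ((_ * _ - _) ^+ 2) => u disc.
have : 3 = u * 27 by apply: (@intr_inj R); rewrite rmorphM /= -[27%:~R]/(27 : R); lra.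
by lia.
Qed.

(** What is used of the classification: up to the exclusion of G2, the numbers d and na
    are at most 2, so that they are prime to l and smaller than p. *)
Lemma cartan_data : exists (d : I -> nat) (na : I -> I -> nat),
  (forall i, (0 < d i <= 3)%N /\ (d i = 3%N -> type_G2 Phi)) /\
  (forall i j, i != j -> (na i j <= 3)%N /\ (na i j = 3%N -> type_G2 Phi)) /\
  (forall i, qs Phi i = q ^+ d i /\ iform Phi i i = (2 * d i)%N) /\
  (forall i j, i != j -> iform Phi i j = - (d i * na i j)%N%:Z /\
      serre_deg Phi i j = (na i j).+1).
Proof.
have /choice [d dP] : forall i, exists e : nat, (0 < e <= 3)%N /\ <|al i, al i|> = 2 * e%:R.
  by move=> i; have [e e3 eE] := root_norm (sroot_root i); exists e.
have /choice [na naP] : forall ij : I * I, exists n : nat,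
    ij.1 != ij.2 -> (n <= 3)%N /\ cartan Phi ij.1 ij.2 = - n%:R.
  move=> [i j]; case: (eqVneq i j) => [->|ij]; first by exists 0%N => /= /eqP.
  have [n [m [nE mE nm]]] := cartan_bound ij; exists n => _; split=> //=.
  case: m mE nm => [|m] mE nm; last by nia.
  have P1 := sroot_pairing i j; have P2 := sroot_pairing j i.
  rewrite nE in P1; rewrite mE (formC Phi (al j)) oppr0 mul0r in P2.
  have : n%:R * <|al i, al i|> = 0 by lra.
  by move/eqP; rewrite mulf_eq0 (gt_eqF (root_norm_gt0 (sroot_root i))) orbF pnatr_eq0 => /eqP ->.
exists d, (fun i j => na (i, j)); split; [|split; [|split]].
- move=> i; have [d3 dE] := dP i; split=> // d3'; apply: (@long_simple_G2 i).
  by rewrite dE d3'; lra.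
- move=> i j ij; have [n3 nE] := naP (i, j) ij; split=> // n3'.
  by apply: (@cartan3_G2 i j); rewrite nE n3'.
- move=> i; have [d3 dE] := dP i; split.
    rewrite /qs dE mulrC mulKf ?pnatr_eq0 // pmulrn intrKfloor //.
  by rewrite /iform dE -natrM pmulrn intrKfloor.
move=> i j ij; have [n3 nE] := naP (i, j) ij; have [d3 dE] := dP i; split.
  rewrite /iform; have -> : <|al i, al j|> = (- (d i * na (i, j))%N%:Z)%:~R.
    have := sroot_pairing i j; rewrite nE dE rmorphN /= -pmulrn natrM /=.
    by move: (d i)%:R (na _)%:R => u w H; lra.
  by rewrite intrKfloor.
rewrite /serre_deg nE /=; have -> : Num.floor (- (na (i, j))%:R : R) = - (na (i, j))%:Z.
  by rewrite pmulrn -rmorphN /= intrKfloor.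
by rewrite opprK -PoszD.
Qed.

End RootSystem.

(** * The quantized enveloping algebra *)

Lemma gen_subalg_mono (k : fieldType) (B : pzAlgType k) (C : k -> Prop) (S S' : B -> Prop) x :
  (forall y, S y -> S' y) -> gen_subalg C S x -> gen_subalg C S' x.
Proof.
move=> SS; elim=> {x} [x Sx||x y _ ? _ ?|x y _ ? _ ?|c x Cc _ ?].
- by apply: gen_subalg_in; exact: SS.
- exact: gen_subalg1.
- exact: gen_subalgB.
- exact: gen_subalgM.
- exact: gen_subalgZ.
Qed.

Lemma apiX (k : pzRingType) (A : pzAlgType k) (S : A -> Prop) x n :
  api S x ^+ n = api S (x ^+ n).
Proof. by elim: n => [|n IH] //; rewrite !exprS IH apiM. Qed.

Lemma api_sum (k : pzRingType) (A : pzAlgType k) (S : A -> Prop) (J : Type) (s : seq J)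
    (G : J -> A) : api S (\sum_(j <- s) G j) = \sum_(j <- s) api S (G j).
Proof.
elim: s => [|j s IH]; first by rewrite !big_nil /api /lpi raddf0.
by rewrite !big_cons apiD IH.
Qed.

Lemma api_rel0 (k : pzRingType) (A : pzAlgType k) (S : A -> Prop) x : S x -> api S x = 0.
Proof.
by move=> Sx; rewrite (@api_rel _ _ S x 0) ?subr0 // /api /lpi raddf0.
Qed.

Lemma api_serre (k : fieldType) (A : pzAlgType k) (S : A -> Prop) (x y : A) n (c : nat -> k) :
  api S (\sum_(s < n.+1) c s *: (x ^+ (n - s) * y * x ^+ s)) =
  \sum_(s < n.+1) c s *: (api S x ^+ (n - s) * api S y * api S x ^+ s).
Proof. by rewrite api_sum; apply: eq_bigr => s _; rewrite apiZ !apiM -!apiX. Qed.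

Lemma api_commutator (k : fieldType) (A : pzAlgType k) (S : A -> Prop) (x y u w : A) (c : k) :
  S (x * y - y * x - c *: (u - w)) ->
  api S x * api S y - api S y * api S x = c *: (api S u - api S w).
Proof. by move=> /api_rel; rewrite apiZ !apiB !apiM. Qed.

Lemma q_expr_neq1 n : (0 < n)%N -> q ^+ n != 1.
Proof.
move=> n0; rewrite /q -rmorphXn -(rmorph1 (@tofrac {poly rat})) /= tofrac_eq.
apply/eqP => /(congr1 (fun p : {poly rat} => size p)).
by rewrite size_polyXn size_poly1; case; case: n n0.
Qed.

Section UqRelations.
Variables (R : archiRealFieldType) (V : vectType R) (Phi : rootSystem V).
Local Notation I := 'I_(\dim {:V}).
Variables (d : I -> nat) (na : I -> I -> nat).
Hypothesis d_gt0 : forall i, (0 < d i)%N.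
Hypothesis qsE : forall i, qs Phi i = q ^+ d i.
Hypothesis iform_diag : forall i, iform Phi i i = (2 * d i)%N.
Hypothesis iform_off : forall i j, i != j -> iform Phi i j = - (d i * na i j)%N%:Z.
Hypothesis serre_degE : forall i j, i != j -> serre_deg Phi i j = (na i j).+1.

Definition UqX (b : bool) (i : I) : Uq Phi := if b then UqE Phi i else UqF Phi i.

Lemma wt_iform b i j :
  wt (qs Phi) na b i j = q ^ (if b then iform Phi i j else - iform Phi i j).
Proof.
rewrite /wt /sku qsE; case: eqVneq => [<-|ij].
  rewrite iform_diag; case: b; first by rewrite -exprM mulnC.
  by rewrite -exprnN exprVn -exprM mulnC.
rewrite iform_off //; case: b; first by rewrite -exprnN exprVn -exprM.
by rewrite opprK invrK -exprM.
Qed.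

Lemma Uq_quantum_relations :
  quantum_relations (qs Phi) na UqX (UqK Phi) (UqKinv Phi).
Proof.
split.
- by move=> i; rewrite qsE expf_neq0 // q_neq0.
- by move=> i n n0; rewrite qsE -exprM q_expr_neq1 // muln_gt0 d_gt0.
- by move=> i j; rewrite !wt_iform /iform formC.
- by move=> i; rewrite -apiM; apply/api_rel; exact: Uq_KKinv.
- by move=> i; rewrite -apiM; apply/api_rel; exact: Uq_KinvK.
- by move=> i j; rewrite -!apiM; apply/api_rel; exact: Uq_KK.
- move=> b i j; rewrite wt_iform /UqX; case: b.
    by have := api_rel (Uq_KE Phi i j); rewrite !apiM apiZ.
  by have := api_rel (Uq_KF Phi i j); rewrite !apiM apiZ.
- move=> i j; exact: (api_commutator (Uq_EF Phi i j)).
move=> b i j ij N; rewrite /N -serre_degE //; set n := serre_deg Phi i j.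
have rel : Uq_rel Phi (serre Phi (fun i => fgen Qq (if b then gE i else gF i)) i j).
  by case: b; [exact: Uq_serreE | exact: Uq_serreF].
have := api_serre (Uq_rel Phi) (fgen Qq (if b then gE i else gF i))
  (fgen Qq (if b then gE j else gF j)) n (fun s => (-1) ^+ s * qbin Phi i n s).
move=> E; have := etrans (esym E) (api_rel0 rel).
by rewrite /UqX; case: (b).
Qed.

Variable Dq : hopfAlgebra (Uq Phi).

Lemma Uq_quantum_hopf : is_Uq_hopf Dq -> quantum_hopf UqX (UqK Phi) (UqKinv Phi) Dq.
Proof.
move=> H i; have [[dE dF dK] [[eE eF eK] _]] := H i.
by split; [case; [exact: dE|exact: dF]|case; [exact: eE|exact: eF]|exact: dK|exact: eK].
Qed.

Variables (k : fieldType) (z : k) (l : nat).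
Hypothesis z0 : z != 0.
Local Notation red := (@reduces R V Phi k z l).
Local Notation ugen := (int_gen (qs Phi) UqX (UqK Phi) (UqKinv Phi)).

Lemma qfact_qnum i n : qfact Phi i n = qnum_fact (qs Phi i) n. Proof. by []. Qed.

Lemma divpow_UqX b i n :
  divpow (qs Phi) UqX b i n = if b then UqEdiv Phi i n else UqFdiv Phi i n.
Proof. by rewrite /UqEdiv /UqFdiv /divpow qfact_qnum /UqX; case: b. Qed.

Lemma UA_gen_int u : UA_gen u <-> ugen u.
Proof.
split=> [[i|i|i n|i n]|[i|i|b i n]].
- exact: int_K.
- exact: int_KV.
- by rewrite -[UqEdiv _ _ _](divpow_UqX true); exact: int_div.
- by rewrite -[UqFdiv _ _ _](divpow_UqX false); exact: int_div.
- exact: UA_genK.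
- exact: UA_genKinv.
- by rewrite divpow_UqX; case: b; [exact: UA_genE|exact: UA_genF].
Qed.

Lemma Uz_specialization : specialization (specializes z) red ugen.
Proof.
split.
- exact: specializes1.
- exact: specializesB.
- exact: specializesM.
- exact: reduces_inj.
- exact: reduces1.
- exact: reducesD.
- exact: reducesM.
- exact: reducesZ.
- by move=> u /UA_gen_int gu; exists (Uz_in z l (UAgen gu)), (UAgen gu).
- move=> Q Q1 QB QM QZ Qg u x [[u' Hu'] [<- _]] /=; move/asboolP: Hu'.
  elim=> {u u'} [u /UA_gen_int /Qg //||u v _ ? _ ?|u v _ ? _ ?|c u cA _ ?].
  + exact: Q1.
  + exact: QB.
  + exact: QM.
  + by have [e ce] := inA_specializes z cA; exact: QZ ce _.
- by move=> Q Qlin QU; apply: Uz_span_ind => // a; apply: QU (reduces_in z l a).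
Qed.

Variable D : hopfAlgebra (Uz Phi z l).
Hypothesis DqD : induced_hopf Dq D.

Lemma Uz_red_comul u x T : red u x -> red2 red (comul Dq u) T -> comul D x = T.
Proof.
move=> [a [<- <-]] [s [Hs Eu ->]]; case: DqD => + _ _.
suff [s' [E1 E2]] : exists s' : seq (UA Phi * UA Phi),
    \sum_(t <- s) hpure t.1.1 t.2.1 = \sum_(t <- s') hpure (UAval t.1) (UAval t.2) /\
    \sum_(t <- s) hpure t.1.2 t.2.2 = \sum_(t <- s') hpure (Uz_in z l t.1) (Uz_in z l t.2).
  by rewrite E2; apply; rewrite Eu.
elim: s Hs {Eu} => [|t s IH] Hs; first by exists [::]; rewrite !big_nil.
have [|s' [E1 E2]] := IH; first by move=> t' ?; apply: Hs; right.
have [[b [b1 b2]] [c [c1 c2]]] := Hs t (or_introl erefl).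
by exists ((b, c) :: s'); rewrite !big_cons /= b1 b2 c1 c2 E1 E2.
Qed.

Lemma Uz_red_antipode u x y : red u x -> red (antipode Dq u) y -> antipode D x = y.
Proof. by move=> [a [<- <-]] [b [Eb <-]]; case: DqD => _ _; apply. Qed.

Definition UzX (b : bool) i n : Uz Phi z l :=
  if b then UzEdiv Phi z l i n else UzFdiv Phi z l i n.
Lemma UzX_red b i n : red (divpow (qs Phi) UqX b i n) (UzX b i n).
Proof.
rewrite divpow_UqX; case: b; first exact: (reduces_in z l (UAgen (UA_genE Phi i n))).
exact: (reduces_in z l (UAgen (UA_genF Phi i n))).
Qed.

Lemma UzK_l i : UzK Phi z l i ^+ l = 1.
Proof. by rewrite apiX; apply: api_rel; constructor. Qed.

End UqRelations.

Lemma has_characteristic_pchar (k : fieldType) p :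
  has_characteristic k p -> (0 < p)%N -> p \in [pchar k].
Proof.
move=> pk p0; have [//||p' p'k] := @natf0_pchar k p; first by rewrite pk.
have p1 : p != 1%N by apply/eqP => p1; have := pk 1%N; rewrite p1 dvdnn oner_eq0.
have : (p %| p')%N by rewrite -pk; case/andP: p'k.
by move=> /(prime_nt_dvdP (pcharf_prime p'k) p1) ->.
Qed.

Local Close Scope ring_scope.

Theorem proposition3p1p1
  (R : archiRealFieldType) (V : vectType R) (Phi : rootSystem V)
  (k : fieldType) (p l r : nat) (zeta : k)
  (Dq : hopfAlgebra (Uq Phi)) (D : hopfAlgebra (Uz Phi zeta l)) :
  indecomposable Phi -> normalized Phi ->
  has_characteristic k p -> p <> 2 -> (type_G2 Phi -> p <> 3) ->
  odd l -> (0 < p -> coprime l p) -> (type_G2 Phi -> coprime l 3) ->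
  (l.-primitive_root zeta)%R ->
  (0 < r -> 0 < p) ->
  is_Uq_hopf Dq -> induced_hopf Dq D ->
  normal_subalg D (UzG (Phi := Phi) (z := zeta) (l := l) p r).
Proof.
move=> irr nrm pk p2 pG2 odd_l _ lG2 prim_z r_p HDq HD.
have [d [na [dP [naP [qP iP]]]]] := cartan_data irr nrm.
have d_gt0 i : (0 < d i)%N by case/andP: (dP i).1.
have qsE i : qs Phi i = (q ^+ d i)%R by exact: (qP i).1.
have QR := @Uq_quantum_relations _ _ Phi d na d_gt0 qsE (fun i => (qP i).2)
  (fun i j ij => (iP i j ij).1) (fun i j ij => (iP i j ij).2).
have l0 := prim_order_gt0 prim_z.
have z_l : (zeta ^+ l = 1)%R by exact: prim_expr_order.
have z0 : (zeta != 0)%R.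
  apply/eqP => z0; move: z_l; rewrite z0 expr0n (negPf (lt0n_neq0 l0)).
  by move=> /esym/eqP; rewrite oner_eq0.
have p_pr : (0 < p)%N -> prime p.
  by move=> p0; apply: (pcharf_prime (has_characteristic_pchar pk p0)).
have nil3 b b' i j : (nil_deg na b b' i j <= 3)%N /\ (nil_deg na b b' i j = 3%N -> type_G2 Phi).
  by rewrite /nil_deg; case: ifP => _; case: eqVneq => // ij; exact: naP.
have prim_v i : (l.-primitive_root ((zeta ^+ d i) ^+ 2))%R.
  rewrite -exprM prim_root_exp_coprime // coprimeMl coprime2n odd_l andbT.
  have [d3 dG2] := dP i; case: (d i) d3 dG2 => [|[|[|[|e]]]] // _ dG2.
  - exact: coprime1n.
  - by rewrite coprime2n.
  - by rewrite coprime_sym; apply/lG2/dG2.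
have p_char : (0 < r)%N -> p \in [pchar k]%R.
  by move=> /r_p; exact: has_characteristic_pchar.
have small b b' i j : small_deg k p l r (nil_deg na b b' i j).
  have [c3 cG2] := nil3 b b' i j; move: (nil_deg _ _ _ _ _) c3 cG2 => c c3 cG2; split.
    case: (ltnP c l) => cl; [by left|right].
    have l1 : l = 1%N.
      case: (eqVneq l 3%N) => [l3|l3]; last by move: odd_l; lia.
      by have := lG2 (cG2 ltac:(lia)); rewrite l3.
    split=> // m /andP [m0 mc]; rewrite pk; apply/negP => pm.
    have p0 : (0 < p)%N by case: (p) pm => //; rewrite dvd0n => /eqP m00; move: m0; rewrite m00.
    have := prime_gt1 (p_pr p0); have := dvdn_leq m0 pm => pm' p1.
    have p3 : p = 3%N by lia.
    by apply: (pG2 (cG2 _)) => //; lia.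
  move=> /r_p p0; have := prime_gt1 (p_pr p0); case: (ltnP c p) => // pc p1.
  have p3 : p = 3%N by lia.
  by exfalso; apply: (pG2 (cG2 _)) => //; lia.
have vspec i : specializes zeta (qs Phi i) (zeta ^+ d i)%R.
  by rewrite qsE; apply: specializesX; exact: specializes_q.
have vVspec i : specializes zeta (qs Phi i)^-1%R (zeta ^+ d i)^-1%R.
  by rewrite qsE -!exprVn; apply: specializesX; exact: specializes_qV.
have vl i : ((zeta ^+ d i) ^+ l = 1)%R by rewrite exprAC z_l expr1n.
have NN := @small_normal _ _ _ _ _ _ _ _ _ _ QR Dq D (Uq_quantum_hopf HDq) _ _
  (Uz_specialization Phi l z0) (Uz_red_comul HD) (Uz_red_antipode HD)
  _ _ _ _ vspec vVspec
  (fun i => reduces_in zeta l (UAgen (UA_genK Phi i)))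
  (fun i => reduces_in zeta l (UAgen (UA_genKinv Phi i)))
  (@UzX_red _ _ Phi _ zeta l) p l r odd_l prim_v vl (@UzK_l _ _ Phi _ zeta l) p_char small.
have to_UzG x : gen_subalg (fun _ => True)
    (small_gen (fun i => UzK Phi zeta l i) (@UzX _ _ Phi _ zeta l) p l r) x ->
    UzG (Phi := Phi) (z := zeta) (l := l) p r x.
  apply: gen_subalg_mono => {}x [b i|b i m mr|i]; last exact: UzG_K.
    by case: b; [exact: UzG_E|exact: UzG_F].
  by case: b; [exact: UzG_Ediv|exact: UzG_Fdiv].
have of_UzG x : UzG (Phi := Phi) (z := zeta) (l := l) p r x ->
    gen_subalg (fun _ => True)
    (small_gen (fun i => UzK Phi zeta l i) (@UzX _ _ Phi _ zeta l) p l r) x.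
  apply: gen_subalg_mono => {}x [i|i m mr|i|i m mr|i].
  - exact: (small_X _ _ _ _ _ true i).
  - exact: (small_Xdiv _ _ _ _ true i mr).
  - exact: (small_X _ _ _ _ _ false i).
  - exact: (small_Xdiv _ _ _ _ false i mr).
  - exact: small_K.
by split=> h a /of_UzG Na; apply: to_UzG; [exact: NN.1|exact: NN.2].
Qed.
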